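(* Let $\Delta_1=[\alpha_1,\beta_1]$, $\Delta_2=[\alpha_2,\beta_2]$ with $\alpha_1<\beta_1<\alpha_2<\beta_2$, and let $\mu_1,\mu_2$ be positive absolutely continuous measures with $\operatorname{supp}\mu_i=\Delta_i$ whose densities $\mu_i'$ extend to holomorphic and non-vanishing functions in some neighborhoods of $\Delta_i$, $i\in\{1,2\}$. Let $P_{\vec n}$ be the monic type II multiple orthogonal polynomials of $(\mu_1,\mu_2)$. Let $\mathcal N_0$ be any infinite sequence of multi-indices $\vec n=(n_1,n_2)$ for which there is $C>0$ with $n_1\le C$ for all $\vec n\in\mathcal N_0$. Then, as $|\vec n|\to\infty$, $\vec n\in\mathcal N_0$, $$P_{\vec n}(z)=(1+o(1))\,\frac{S_{\rho_2}(z)}{S_{\rho_2}(\infty)}\,S^{n_1}(z;\alpha_1)\,(z-\alpha_1)^{n_1}\,\varphi_2^{n_2}(z)$$ uniformly on compact subsets of $\overline{\mathbb C}\setminus(\{\alpha_1\}\cup\Delta_2)$. The analogous formula holds along any infinite sequence $\mathcal N_1$ with $n_2\le C$: $$P_{\vec n}(z)=(1+o(1))\,\frac{S_{\rho_1}(z)}{S_{\rho_1}(\infty)}\,\widetilde S^{\,n_2}(z;\beta_2)\,(z-\beta_2)^{n_2}\,\varphi_1^{n_1}(z)$$ uniformly on compact subsets of $\overline{\mathbb C}\setminus(\Delta_1\cup\{\beta_2\})$.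
   Context: $P_{\vec n}$ is the unique monic polynomial of degree $|\vec n|=n_1+n_2$ with $\int P_{\vec n}(x)x^l\mathrm d\mu_i(x)=0$ for $0\le l<n_i$, $i\in\{1,2\}$. $w_i(z)=\sqrt{(z-\alpha_i)(z-\beta_i)}$ is the branch holomorphic off $\Delta_i$ with $w_i(z)/z\to1$ as $z\to\infty$; $w_{i+}$ is its boundary value from the upper half-plane; $\varphi_i(z)=\frac12\big(z-\frac{\beta_i+\alpha_i}2+w_i(z)\big)$. $\rho_i(x)=-2\pi\mathrm i\,\mu_i'(x)$ on $\Delta_i$ (so $\rho_iw_{i+}>0$ on $(\alpha_i,\beta_i)$), and the Szegő function is $$S_{\rho_i}(z)=\exp\Big\{\frac{w_i(z)}{2\pi\mathrm i}\int_{\Delta_i}\frac{\log(\rho_iw_{i+})(x)}{z-x}\frac{\mathrm dx}{w_{i+}(x)}\Big\},\quad z\in\overline{\mathbb C}\setminus\Delta_i.$$ With $A_{0,2}=[(\beta_2-\alpha_2)/4]^2$ and $A_{1,1}=[(\beta_1-\alpha_1)/4]^2$, $$S(z;x_0)=\Big(\frac{\varphi_2(z)-\varphi_2(x_0)}{\varphi_2(x_0)\varphi_2(z)-A_{0,2}}\,\frac{\varphi_2(x_0)\varphi_2(z)}{z-x_0}\Big)^{1/2},\quad z\in\overline{\mathbb C}\setminus\Delta_2,\ x_0\in\mathbb R\setminus\Delta_2,$$ $$\widetilde S(z;x_0)=\Big(\frac{\varphi_1(z)-\varphi_1(x_0)}{\varphi_1(x_0)\varphi_1(z)-A_{1,1}}\,\frac{\varphi_1(x_0)\varphi_1(z)}{z-x_0}\Big)^{1/2},\quad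 z\in\overline{\mathbb C}\setminus\Delta_1,\ x_0\in\mathbb R\setminus\Delta_1,$$ with the roots chosen so that the value at $z=\infty$ is $1$. At $z=\infty$ the formulas are understood as statements about the ratio of the two sides. *)

(* Defs.v *)
From HB Require Import structures.
From mathcomp Require Import all_boot all_order all_algebra.
From mathcomp Require Import complex.
From mathcomp Require Import all_classical all_reals all_analysis.

Set Implicit Arguments.
Unset Strict Implicit.
Unset Printing Implicit Defensive.
Import Order.TTheory GRing.Theory Num.Theory.
Import numFieldNormedType.Exports.

Local Open Scope classical_set_scope.
Local Open Scope complex_scope.
Local Open Scope ring_scope.

Local Notation Re := complex.Re.
Local Notation Im := complex.Im.

(* R[i] as a normed module over itself, as the library does for abstract
   numeric fields. *)
HB.instance Definition _ (R : realType) := GRing.ComAlgebra.copy R[i] R[i]^o.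
HB.instance Definition _ (R : realType) := Vector.copy R[i] R[i]^o.
HB.instance Definition _ (R : realType) := NormedModule.copy R[i] R[i]^o.

(* The extended complex plane; None is the point at infinity. *)
Notation sphere R := (one_point_compactification R[i]).

Section complex_preliminaries.
Context {R : realType}.
Implicit Types (z : R[i]) (a b x : R).


(* The filter "z --> infinity" on the complex plane. *)
Definition cinfty : set_system R[i] :=
  [set P | exists M : R, forall z, M%:C < `|z| -> P z].

Global Instance cinfty_proper_filter : ProperFilter cinfty.
Proof.
split.
  move=> [M /(_ (`|M| + 1)%:C)]; apply.
  rewrite (ger0_norm (x := (`|M| + 1)%:C)); last by rewrite lecR addr_ge0.
  by rewrite ltcR (le_lt_trans (ler_norm M))// ltrDl.
split; first by exists 0.
  move=> P Q [M MP] [N NQ]; exists (Num.max M N) => z Mz.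
  have [h1 h2] : M%:C <= (Num.max M N)%:C :> R[i] /\ N%:C <= (Num.max M N)%:C :> R[i].
    by rewrite !lecR !le_max !lexx orbT.
  by split; [apply: MP; exact: le_lt_trans Mz|apply: NQ; exact: le_lt_trans Mz].
by move=> P Q PQ [M MP]; exists M => z /MP /PQ.
Qed.

(* Complex differentiability at every point of D (meant for open D). *)
Definition holomorphic_on (D : set R[i]) (f : R[i] -> R[i]) : Prop :=
  forall z, D z -> derivable f z 1.

Definition cexp z : R[i] :=
  (expR (Re z) * cos (Im z)) +i* (expR (Re z) * sin (Im z)).

Definition cintegral (D : set R) (f : R -> R[i]) : R[i] :=
  (\int[lebesgue_measure]_(x in D) Re (f x))
    +i* (\int[lebesgue_measure]_(x in D) Im (f x)).

Definition cseg a b : set R[i] := [set x%:C | x in `[a, b]].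

End complex_preliminaries.

Section measures.
Context {R : realType}.
Implicit Types (mu : {measure set (measurableTypeR R) -> \bar R}) (f : R -> R).

(* Absolute continuity of mu, with f a version of its density mu'. *)
Definition is_density mu f : Prop :=
  [/\ measurable_fun setT f, (forall x, 0 <= f x) &
      forall A, measurable A ->
        mu A = (\int[lebesgue_measure]_(x in A) (f x)%:E)%E].

Definition msupp mu : set R :=
  [set x | forall U : set R, open U -> U x -> (0 < mu U)%E].

Definition holomorphic_nonvanishing_extension (a b : R) f : Prop :=
  exists (U : set R[i]) (h : R[i] -> R[i]),
    [/\ open U, cseg a b `<=` U, holomorphic_on U h,
        (forall z, U z -> h z != 0) &
        {in `[a, b], forall x, h x%:C = (f x)%:C}].

Definition is_typeII mu1 mu2 (n : nat * nat) (P : {poly R}) : Prop :=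
  [/\ P \is monic, size P = (n.1 + n.2).+1,
      (forall l, (l < n.1)%N -> (\int[mu1]_x (P.[x] * x ^+ l)%:E = 0)%E) &
      (forall l, (l < n.2)%N -> (\int[mu2]_x (P.[x] * x ^+ l)%:E = 0)%E)].

End measures.

Section szego.
Context {R : realType}.
Variables (a b : R).

(* w is the branch of sqrt ((z - a) (z - b)) holomorphic off [a, b] with
   w z / z --> 1 at infinity; its values on [a, b] are irrelevant. *)
Definition is_wbranch (w : R[i] -> R[i]) : Prop :=
  [/\ holomorphic_on (~` cseg a b) w,
      (forall z, ~ cseg a b z -> w z ^+ 2 = (z - a%:C) * (z - b%:C)) &
      w z / z @[z --> cinfty] --> (1 : R[i])].

Variable w : R[i] -> R[i].

Definition wplus (x : R) : R[i] := lim (w (x +i* t) @[t --> 0^'+]).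

Definition phi (z : R[i]) : R[i] := (z - ((b + a) / 2)%:C + w z) / 2.

Definition rho (dmu : R -> R) (x : R) : R[i] := - (2 * pi)%:C * 'i%C * (dmu x)%:C.

(* rho * wplus is real and positive on ]a, b[, hence the real logarithm. *)
Definition szego (dmu : R -> R) (z : R[i]) : R[i] :=
  cexp (w z / ((2 * pi)%:C * 'i%C) *
    cintegral `[a, b] (fun x =>
      (ln (Re (rho dmu x * wplus x)))%:C / (z - x%:C) / wplus x)).

Definition szego_infty (dmu : R -> R) : R[i] :=
  lim (szego dmu z @[z --> cinfty]).

(* S is the function S(z; x0), x0 outside [a, b]: the holomorphic branch of
   the square root whose value at infinity is 1.  The radicand has a removable
   singularity at z = x0. *)
Definition is_szego_factor (x0 : R) (S : R[i] -> R[i]) : Prop :=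
  let A : R[i] := (((b - a) / 4) ^+ 2)%:C in
  let c := phi x0%:C in
  [/\ holomorphic_on (~` cseg a b) S,
      (forall z, ~ cseg a b z -> z != x0%:C ->
        S z ^+ 2 = (phi z - c) / (c * phi z - A) * (c * phi z / (z - x0%:C))) &
      S z @[z --> cinfty] --> (1 : R[i])].

End szego.

Section asymptotics.
Context {R : realType}.

(* The ratio F / G on the extended plane; its value at infinity is the limit. *)
Definition sphere_ratio (F G : R[i] -> R[i]) (z : sphere R) : R[i] :=
  if z is Some z' then F z' / G z' else lim (F z' / G z' @[z' --> cinfty]).

(* F_n = (1 + o(1)) G_n as |n| --> infinity, n in N, uniformly on compact
   subsets of D. *)
Definition locally_unif_equiv (N : set (nat * nat)) (D : set (sphere R))
    (F G : nat * nat -> R[i] -> R[i]) : Prop :=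
  forall K : set (sphere R), compact K -> K `<=` D ->
  forall eps : R, 0 < eps ->
  exists M : nat, forall n : nat * nat, N n -> (M <= n.1 + n.2)%N ->
  forall z, K z -> `|sphere_ratio (F n) (G n) z - 1| < eps%:C.

Definition ceval (P : {poly R}) (z : R[i]) : R[i] :=
  (map_poly (real_complex R) P).[z].

End asymptotics.

(* Main.v *)
(* Call [D] the interval carrying the large number [n] of conditions and [D']
   the one carrying the bounded number [k].  By sign changes, [P = p q] where
   [p] has [k] zeros in [D'] and [q] has [n] zeros in [D].  Among the points of
   [D'], [|q|] is geometrically largest at the end [x0] farthest from [D], and
   orthogonality then forces the zeros of [p] to tend to [x0].  So [q] is
   orthogonal on [D] for a weight uniformly close to [|x - x0|^k] times the
   density, and it remains to find its exterior asymptotics.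

   With [z = c + r (zeta + 1 / zeta)], [|zeta| < 1], and [x = c + 2 r cos t],
   [q] is compared with a trial polynomial [2 r^n Re (e^{int} g(e^{-it}))],
   where the polynomial [g] approximates the inner Szego function of the
   weight.  The weighted L2 distance of the two is bounded by a quantity
   independent of [n] that vanishes when [|g|^2] is exactly a Szego weight, and
   a mean value bound on polynomials in the disc turns it into a uniform
   estimate.  Finally [g] is identified with [szego] by computing the Cauchy
   type integrals of cosine polynomials. *)

Require Import Defs.
From HB Require Import structures.
From mathcomp Require Import all_boot all_order all_algebra.
From mathcomp Require Import complex.
From mathcomp Require Import all_classical all_reals all_analysis.
From mathcomp Require Import measurable_realfun ring lra.
Set Implicit Arguments.
Unset Strict Implicit.
Unset Printing Implicit Defensive.
Import Order.TTheory GRing.Theory Num.Theory.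
Import numFieldNormedType.Exports.
Local Open Scope classical_set_scope.
Local Open Scope complex_scope.
Local Open Scope ring_scope.

Local Notation Re := complex.Re.
Local Notation Im := complex.Im.
Local Notation leb := lebesgue_measure.
Local Notation normc := Normc.normc.

(** * Integrals over a segment *)

(** No contour is deformed: every integral is a real one over the angle in $[0, \pi]$, and analytic
    facts about the exterior are replaced by algebraic identities in $\zeta$ together with signs
    propagated from infinity.

    The weight of [q] is [p] times a density, and [p] varies with the multi-index. So the limit
    weight alone determines [g] and a companion polynomial [H]; these determine how close the actual
    weight must be to its limit and how large [n] must be; only then does [p] enter.

    [H] is the dual object in the Cauchy-Schwarz step: nothing is lost when $|H| = f |g|$ on the
    circle and $g H (1 - z^2)$ is nonnegative there. A function analytic in the disc with such
    boundary values is constant, so ideally $H$ is a constant over $g (1 - z^2)$. The poles at $\pm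
    1$, where the substitution $x = c + 2 r \cos t$ degenerates, prevent this and lead to the
    parameter [s] below.

    The point at infinity is settled separately: there the quotient of the two sides is exactly
    1. *)

Section continuity.
Context {R : realType}.
Implicit Types f g : R -> R.

(** A separate name lets the tactic [cont] match on the body of the function. *)
Definition contR f : Prop := continuous f.

Lemma contD f g : contR f -> contR g -> contR (fun x => f x + g x).
Proof. by move=> cf cg x; apply: continuousD; [exact: cf|exact: cg]. Qed.

Lemma contN f : contR f -> contR (fun x => - f x).
Proof. by move=> cf x; apply: continuousN; exact: cf. Qed.

Lemma contM f g : contR f -> contR g -> contR (fun x => f x * g x).
Proof. by move=> cf cg x; apply: continuousM; [exact: cf|exact: cg]. Qed.

Lemma contV f : (forall x, f x != 0) -> contR f -> contR (fun x => (f x)^-1).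
Proof. by move=> f0 cf x; apply: continuousV; [exact: f0|exact: cf]. Qed.

Lemma cont_cst (k : R) : contR (fun _ : R => k).
Proof. by move=> x; exact: cvg_cst. Qed.

Lemma cont_id : contR (fun x : R => x).
Proof. by move=> x; exact: cvg_id. Qed.

Lemma contX f n : contR f -> contR (fun x => f x ^+ n).
Proof.
move=> cf; elim: n => [|n IH]; first exact: cont_cst.
rewrite (_ : (fun x => _) = fun x => f x * f x ^+ n); first exact: contM.
by apply/funext => x; rewrite exprS.
Qed.

Lemma cont_comp f g : contR f -> contR g -> contR (fun x => f (g x)).
Proof. by move=> cf cg x; apply: continuous_comp; [exact: cg|exact: cf]. Qed.

Lemma cont_norm f : contR f -> contR (fun x => `|f x|).
Proof. by move=> cf x; apply: continuous_comp; [exact: cf|exact: norm_continuous]. Qed.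

Lemma cont_sum n (F : nat -> R -> R) :
  (forall i, contR (F i)) -> contR (fun x => \sum_(i < n) F i x).
Proof.
move=> cF; elim: n => [|n IH].
  rewrite (_ : (fun x => _) = fun=> 0); first exact: cont_cst.
  by apply/funext => x; rewrite big_ord0.
rewrite (_ : (fun x => _) = fun x => \sum_(i < n) F i x + F n x).
  exact: contD.
by apply/funext => x; rewrite big_ord_recr.
Qed.

Lemma cont_cos f : contR f -> contR (fun x => cos (f x)).
Proof. by move=> cf; apply: (cont_comp (f := cos)) => //; exact: continuous_cos. Qed.

Lemma cont_sin f : contR f -> contR (fun x => sin (f x)).
Proof. by move=> cf; apply: (cont_comp (f := sin)) => //; exact: continuous_sin. Qed.

Lemma cont_expR f : contR f -> contR (fun x => expR (f x)).
Proof. by move=> cf; apply: (cont_comp (f := expR)) => //; exact: continuous_expR. Qed.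

Lemma cont_ln f : (forall x, 0 < f x) -> contR f -> contR (fun x => ln (f x)).
Proof.
by move=> f0 cf x; apply: continuous_comp; [exact: cf|exact: continuous_ln].
Qed.

Lemma cont_horner (p : {poly R}) f : contR f -> contR (fun x => p.[f x]).
Proof.
by move=> cf; apply: (cont_comp (f := fun x => p.[x])) => //; exact: continuous_horner.
Qed.

End continuity.

Ltac cont := repeat match goal with
  | |- contR (fun _ => ?k) => exact (@cont_cst _ k)
  | |- contR (fun x => x) => exact (@cont_id _)
  | |- contR _ => eassumption
  | |- contR (fun x => - @?f x) => apply (@contN _ f)
  | |- contR (fun x => @?f x + @?g x) => apply (@contD _ f g)
  | |- contR (fun x => @?f x * @?g x) => apply (@contM _ f g)
  | |- contR (fun x => @?f x ^+ ?n) => apply (@contX _ f n)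
  | |- contR (fun x => cos (@?f x)) => apply (@cont_cos _ f)
  | |- contR (fun x => sin (@?f x)) => apply (@cont_sin _ f)
  | |- contR (fun x => expR (@?f x)) => apply (@cont_expR _ f)
  | |- contR (fun x => `|@?f x|) => apply (@cont_norm _ f)
  | |- contR (fun x => horner ?p (@?f x)) => apply (@cont_horner _ p f)
  end.

Section integrals.
Context {R : realType}.
Implicit Types (f g : R -> R) (a b k : R).

Definition Iab a b f : R := \int[leb]_(x in `[a, b]) f x.

Definition intble a b f := leb.-integrable `[a, b] (EFin \o f).

Lemma cont_intble a b f : contR f -> intble a b f.
Proof.
move=> cf; apply: continuous_compact_integrable; first exact: segment_compact.
exact: continuous_subspaceT.
Qed.

Lemma Iab_eq a b f g : (forall x, a <= x <= b -> f x = g x) -> Iab a b f = Iab a b g.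
Proof. by move=> fg; apply: eq_Rintegral => x; rewrite inE/= in_itv/= => /fg. Qed.

Lemma IabD a b f g : intble a b f -> intble a b g ->
  Iab a b (fun x => f x + g x) = Iab a b f + Iab a b g.
Proof. by move=> cf cg; apply: RintegralD. Qed.

Lemma IabB a b f g : intble a b f -> intble a b g ->
  Iab a b (fun x => f x - g x) = Iab a b f - Iab a b g.
Proof. by move=> cf cg; apply: RintegralB. Qed.

Lemma IabZ a b k f : intble a b f -> Iab a b (fun x => k * f x) = k * Iab a b f.
Proof. by move=> cf; apply: RintegralZl. Qed.

Lemma Iab_le a b f g : intble a b f -> intble a b g ->
  (forall x, a <= x <= b -> f x <= g x) -> Iab a b f <= Iab a b g.
Proof.
by move=> cf cg fg; apply: le_Rintegral => // x; rewrite /= in_itv/= => /fg.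
Qed.

Lemma Iab_ge0 a b f : (forall x, a <= x <= b -> 0 <= f x) -> 0 <= Iab a b f.
Proof. by move=> f0; apply: Rintegral_ge0 => x; rewrite /= in_itv/= => /f0. Qed.

Lemma Iab_cst a b k : a <= b -> Iab a b (fun=> k) = k * (b - a).
Proof.
move=> ab; rewrite /Iab Rintegral_cst//. rewrite /= lebesgue_measure_itv/= lte_fin.
case: ltP => h //=.
have -> : b = a by apply/eqP; rewrite eq_le h ab.
by rewrite subrr.
Qed.

Lemma intbleD a b f g : intble a b f -> intble a b g -> intble a b (fun x => f x + g x).
Proof.
move=> cf cg; rewrite /intble (_ : EFin \o _ = (EFin \o f) \+ (EFin \o g)).
  exact: integrableD.
by apply/funext => x.
Qed.

Lemma intbleZ a b k f : intble a b f -> intble a b (fun x => k * f x).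
Proof.
move=> cf; rewrite /intble (_ : EFin \o _ = (fun x => k%:E * (EFin \o f) x)%E).
  exact: integrableZl.
by apply/funext => x.
Qed.

Lemma Iab_sum a b n (F : nat -> R -> R) : (forall i, intble a b (F i)) ->
  Iab a b (fun x => \sum_(i < n) F i x) = \sum_(i < n) Iab a b (F i).
Proof.
move=> cF; have cS m : intble a b (fun x => \sum_(i < m) F i x).
  elim: m => [|m IH].
    rewrite (_ : (fun x => _) = fun=> 0); first by apply: cont_intble; exact: cont_cst.
    by apply/funext => x; rewrite big_ord0.
  rewrite (_ : (fun x => _) = fun x => \sum_(i < m) F i x + F m x).
    exact: intbleD.
  by apply/funext => x; rewrite big_ord_recr.
elim: n => [|n IH].
  rewrite big_ord0 (Iab_eq (g := fun=> 0)) => [|x _]; last by rewrite big_ord0.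
  by rewrite /Iab /Rintegral integral0.
rewrite big_ord_recr/= -IH -IabD//; apply: Iab_eq => x _.
by rewrite big_ord_recr.
Qed.

Lemma Iab_FTC a b f (F : R -> R) : a < b -> contR f ->
  (forall x : R, is_derive x 1 F (f x)) -> Iab a b f = F b - F a.
Proof.
move=> ab cf dF; rewrite /Iab /Rintegral (continuous_FTC2 (F := F))//.
- exact: continuous_subspaceT.
- have cF : continuous F.
    by move=> x; apply/differentiable_continuous/derivable1_diffP; case: (dF x).
  split; first by move=> x _; case: (dF x).
  - exact/cvg_at_right_filter/cF.
  - exact/cvg_at_left_filter/cF.
- by move=> x _; rewrite derive1E; apply: derive_val.
Qed.

End integrals.

(** * Real polynomials on the unit circle *)

Section modulus.
Context {R : realType}.
Implicit Types (z : R[i]) (x : R).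

Lemma sqr_normcE z : normc z ^+ 2 = Re z ^+ 2 + Im z ^+ 2.
Proof. by case: z => x y /=; rewrite sqr_sqrtr// addr_ge0// sqr_ge0. Qed.

Lemma normc_ge0 z : 0 <= normc z.
Proof. by case: z => x y; exact: sqrtr_ge0. Qed.

(** The norm of [R[i]] is itself a complex number; estimates are made on the real-valued [normc] and
    transferred by this identity. *)
Lemma normrcE z : `|z| = (normc z)%:C.
Proof. by case: z => x y; rewrite normc_def. Qed.

Lemma normcR x : normc x%:C = `|x|.
Proof. by rewrite /= expr0n addr0 sqrtr_sqr. Qed.

Lemma normcX z n : normc (z ^+ n) = normc z ^+ n.
Proof. by elim: n => [|n IH]; rewrite ?Normc.normc1// !exprS Normc.normcM IH. Qed.

Lemma normc_eq0 z : (normc z == 0) = (z == 0).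
Proof.
by apply/eqP/eqP => [/Normc.eq0_normc//|->]; exact: Normc.normc0.
Qed.

Lemma le_normcB z1 z2 : normc (z1 - z2) <= normc z1 + normc z2.
Proof. by rewrite -(normcN z2) le_normcD. Qed.

Lemma normcB z1 z2 : normc (z1 - z2) = normc (z2 - z1).
Proof. by rewrite -normcN opprB. Qed.

Lemma Re_le_normc z : `|Re z| <= normc z.
Proof. by rewrite -lecR -normrcE; exact: normc_ge_Re. Qed.

Lemma Im_le_normc z : `|Im z| <= normc z.
Proof.
rewrite -(ger0_norm (normc_ge0 z)) -ler_sqr ?nnegrE ?normr_ge0//.
by rewrite !real_normK ?num_real// sqr_normcE lerDr sqr_ge0.
Qed.

Lemma le_normc_ReIm z : normc z <= `|Re z| + `|Im z|.
Proof.
rewrite -ler_sqr ?nnegrE ?normc_ge0 ?addr_ge0//.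
rewrite sqr_normcE -(real_normK (num_real (Re z))) -(real_normK (num_real (Im z))).
have := normr_ge0 (Re z); have := normr_ge0 (Im z); nra.
Qed.

Lemma ceval_real (p : {poly R}) x : ceval p x%:C = (p.[x])%:C.
Proof. by rewrite /ceval horner_map. Qed.

Lemma cevalD (p q : {poly R}) z : ceval (p + q) z = ceval p z + ceval q z.
Proof. by rewrite /ceval rmorphD hornerD. Qed.

Lemma cevalB (p q : {poly R}) z : ceval (p - q) z = ceval p z - ceval q z.
Proof. by rewrite /ceval rmorphB hornerD hornerN. Qed.

Lemma cevalM (p q : {poly R}) z : ceval (p * q) z = ceval p z * ceval q z.
Proof. by rewrite /ceval rmorphM hornerM. Qed.

Lemma cevalC x z : ceval x%:P z = x%:C.
Proof. by rewrite /ceval map_polyC hornerC. Qed.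

Lemma cevalX z : ceval 'X z = z.
Proof. by rewrite /ceval map_polyX hornerX. Qed.

Lemma cevalXn (p : {poly R}) n z : ceval (p ^+ n) z = ceval p z ^+ n.
Proof. by rewrite /ceval rmorphXn horner_exp. Qed.

Lemma ceval_sum n (F : 'I_n -> {poly R}) z :
  ceval (\sum_i F i) z = \sum_i ceval (F i) z.
Proof. by rewrite /ceval rmorph_sum horner_sum. Qed.

Lemma ceval_coef (p : {poly R}) z : ceval p z = \sum_(i < size p) (p`_i)%:C * z ^+ i.
Proof.
rewrite -{1}[p]coefK poly_def ceval_sum; apply: eq_bigr => i _.
by rewrite -mul_polyC cevalM cevalC cevalXn cevalX.
Qed.

Lemma ceval_prod (s : seq R) z :
  ceval (\prod_(y <- s) ('X - y%:P)) z = \prod_(y <- s) (z - y%:C).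
Proof.
rewrite /ceval rmorph_prod/= horner_prod; apply: eq_bigr => y _.
by rewrite map_polyXsubC hornerXsubC.
Qed.

End modulus.

Section circle.
Context {R : realType}.
Implicit Types (p q : {poly R}) (t x : R) (z : R[i]).

Definition ecirc t : R[i] := cos t +i* sin t.

Lemma ecirc_norm t : normc (ecirc t) = 1.
Proof. by rewrite /= cos2Dsin2 sqrtr1. Qed.

Lemma ecircD s t : ecirc (s + t) = ecirc s * ecirc t.
Proof.
apply/eqP; rewrite eq_complex /= cosD sinD eqxx /=.
by rewrite addrC [cos s * _ + _]addrC [sin s * _]mulrC addrC eqxx.
Qed.

Lemma ecircX t n : ecirc t ^+ n = ecirc (n%:R * t).
Proof.
elim: n => [|n IH]; first by rewrite mul0r /ecirc cos0 sin0.
by rewrite exprS IH -ecircD -natr1 mulrDl mul1r addrC.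
Qed.

Lemma ecirc_neq0 t : ecirc t != 0.
Proof. by rewrite -normc_eq0 ecirc_norm oner_neq0. Qed.

Lemma ecircV t : (ecirc t)^-1 = ecirc (- t).
Proof.
apply: (mulfI (ecirc_neq0 t)); rewrite divff ?ecirc_neq0// -ecircD subrr.
by rewrite /ecirc cos0 sin0.
Qed.

Definition pc p t := Re (ceval p (ecirc t)).
Definition ps p t := Im (ceval p (ecirc t)).
Definition pn p t := pc p t ^+ 2 + ps p t ^+ 2.

Lemma pnE p t : pn p t = normc (ceval p (ecirc t)) ^+ 2.
Proof. by rewrite sqr_normcE. Qed.

Lemma pn_ge0 p t : 0 <= pn p t.
Proof. by rewrite pnE exprn_ge0// normc_ge0. Qed.

Lemma pnM p q t : pn (p * q) t = pn p t * pn q t.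
Proof. by rewrite !pnE cevalM Normc.normcM exprMn. Qed.

Lemma pcM p q t : pc (p * q) t = pc p t * pc q t - ps p t * ps q t.
Proof. by rewrite /pc /ps cevalM; case: (ceval p _); case: (ceval q _). Qed.

Lemma psM p q t : ps (p * q) t = pc p t * ps q t + ps p t * pc q t.
Proof. by rewrite /pc /ps cevalM; case: (ceval p _); case: (ceval q _). Qed.

Lemma pcD p q t : pc (p + q) t = pc p t + pc q t.
Proof. by rewrite /pc cevalD; case: (ceval p _); case: (ceval q _). Qed.

Lemma pcC x t : pc x%:P t = x.
Proof. by rewrite /pc cevalC. Qed.

Lemma psC x t : ps x%:P t = 0.
Proof. by rewrite /ps cevalC. Qed.

Lemma pcXn n t : pc 'X^n t = cos (n%:R * t).
Proof. by rewrite /pc cevalXn cevalX ecircX. Qed.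

Lemma psXn n t : ps 'X^n t = sin (n%:R * t).
Proof. by rewrite /ps cevalXn cevalX ecircX. Qed.

Lemma pcE p t : pc p t = \sum_(i < size p) p`_i * cos (i%:R * t).
Proof.
rewrite -{1}[p]coefK poly_def /pc /ceval rmorph_sum horner_sum (raddf_sum (@complex.Re R : Rcomplex R -> R)).
apply: eq_bigr => i _.
transitivity (Re (ceval ((p`_i)%:P * 'X^i) (ecirc t))); first by rewrite mul_polyC.
by rewrite cevalM cevalC cevalXn cevalX ecircX/= mul0r subr0.
Qed.

Lemma psE p t : ps p t = \sum_(i < size p) p`_i * sin (i%:R * t).
Proof.
rewrite -{1}[p]coefK poly_def /ps /ceval rmorph_sum horner_sum (raddf_sum (@complex.Im R : Rcomplex R -> R)).
apply: eq_bigr => i _.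
transitivity (Im (ceval ((p`_i)%:P * 'X^i) (ecirc t))); first by rewrite mul_polyC.
by rewrite cevalM cevalC cevalXn cevalX ecircX/= mul0r addr0.
Qed.

Lemma cont_pc p : contR (pc p).
Proof.
rewrite (_ : pc p = fun t => \sum_(i < size p) p`_i * cos (i%:R * t)).
  by apply: (cont_sum (F := fun i t => p`_i * cos (i%:R * t))) => i; cont.
by apply/funext => t; exact: pcE.
Qed.

Lemma cont_ps p : contR (ps p).
Proof.
rewrite (_ : ps p = fun t => \sum_(i < size p) p`_i * sin (i%:R * t)).
  by apply: (cont_sum (F := fun i t => p`_i * sin (i%:R * t))) => i; cont.
by apply/funext => t; exact: psE.
Qed.

Lemma cont_pn p : contR (pn p).
Proof. by apply: contD; apply: contX; [exact: cont_pc|exact: cont_ps]. Qed.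

Lemma J_cos n : (0 < n)%N -> Iab 0 pi (fun t : R => cos (n%:R * t)) = 0.
Proof.
move=> n0; have n0' : n%:R != 0 :> R by rewrite pnatr_eq0 -lt0n.
have dF (x : R) : is_derive x 1 (fun t : R => n%:R^-1 * sin (n%:R * t)) (cos (n%:R * x)).
  by apply: is_derive_eq; rewrite /GRing.scale/=; field.
have cF : contR (fun t : R => cos (n%:R * t)) by cont.
rewrite (Iab_FTC (pi_gt0 R) cF dF).
have -> : sin (n%:R * pi) = 0 :> R.
  elim: n {n0 n0' dF cF} => [|n IH]; first by rewrite mul0r sin0.
  by rewrite -natr1 mulrDl mul1r sinDpi IH oppr0.
by rewrite !mulr0 sin0 mulr0 subrr.
Qed.

(** Mean value property on the half circle: the coefficients are real, so only cosines occur, and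
    only the one of frequency zero survives. *)
Lemma J_pc p : Iab 0 pi (pc p) = pi * p`_0.
Proof.
rewrite (Iab_eq (g := fun t => \sum_(i < size p) p`_i * cos (i%:R * t))); last first.
  by move=> t _; exact: pcE.
rewrite (@Iab_sum _ _ _ _ (fun i t => p`_i * cos (i%:R * t))); last first.
  by move=> i; apply: cont_intble; cont.
transitivity (\sum_(i < size p) (if i == 0%N :> nat then pi * p`_0 else 0)).
  apply: eq_bigr => i _; rewrite IabZ; last by apply: cont_intble; cont.
  case: (posnP i) => i0; last by rewrite J_cos// mulr0.
  rewrite i0 (Iab_eq (g := fun=> 1)) ?Iab_cst ?pi_ge0//.
    by rewrite subr0 mul1r mulrC.
  by move=> x _; rewrite mul0r cos0.
case: (posnP (size p)) => [p0|p0].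
  have -> : p = 0 by apply/eqP; rewrite -size_poly_eq0 p0.
  by rewrite size_poly0 big_ord0 coef0 mulr0.
case: (size p) p0 => // m _.
by rewrite big_ord_recl/= big1 ?addr0.
Qed.

(* If [N] is the mean of |q|^2 over the circle, the mean of |X q + x|^2 is
   [N + x^2], so that the estimate follows by induction without summing
   the coefficients. *)
Lemma circle_mean_bound p z : normc z <= 1 ->
  (1 - normc z ^+ 2) * normc (ceval p z) ^+ 2 <= Iab 0 pi (pn p) / pi.
Proof.
move=> z1; have pi0 := pi_gt0 R.
elim/poly_ind: p => [|p x IH].
  rewrite /ceval rmorph0 horner0 Normc.normc0 expr0n mulr0.
  by rewrite divr_ge0 ?pi_ge0//; apply: Iab_ge0 => t _; exact: pn_ge0.
have -> : Iab 0 pi (pn (p * 'X + x%:P)) = Iab 0 pi (pn p) + pi * x ^+ 2.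
  rewrite (Iab_eq (g := fun t => (pn p t + 2 * x * pc (p * 'X) t) + x ^+ 2)).
    have c1 := @cont_pn p; have c2 := @cont_pc (p * 'X).
    rewrite (@IabD _ 0 pi (fun t => pn p t + 2 * x * pc (p * 'X) t) (fun=> x ^+ 2)); try by apply: cont_intble; cont.
    rewrite (@IabD _ 0 pi (pn p) (fun t => 2 * x * pc (p * 'X) t)); try by apply: cont_intble; cont.
    rewrite IabZ ?J_pc; last by apply: cont_intble.
    rewrite coefMX/= Iab_cst ?pi_ge0//; by rewrite !mulr0 addr0 subr0 [in RHS]mulrC.
  move=> t _; have <- : pn (p * 'X) t = pn p t.
    by rewrite pnM [pn 'X t]pnE cevalX ecirc_norm expr1n mulr1.
  have psE0 : ps (p * 'X + x%:P) t = ps (p * 'X) t.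
    by rewrite /ps cevalD cevalC; case: (ceval _ _) => u v /=; rewrite addr0.
  by rewrite /pn pcD psE0 pcC; ring.
set N := Iab 0 pi (pn p) in IH *.
have -> : (N + pi * x ^+ 2) / pi = N / pi + x ^+ 2.
  by rewrite mulrDl (mulrC pi) mulfK// lt0r_neq0.
have h1 : normc (ceval (p * 'X + x%:P) z) <= normc z * normc (ceval p z) + `|x|.
  by rewrite cevalD cevalM cevalX cevalC (le_trans (le_normcD _ _))// Normc.normcM normcR mulrC.
have h2 := normc_ge0 z; have h3 := normc_ge0 (ceval p z).
have h4 := normr_ge0 x.
have -> : x ^+ 2 = `|x| ^+ 2 by rewrite real_normK ?num_real.
have h5 : normc (ceval (p * 'X + x%:P) z) ^+ 2 <= (normc z * normc (ceval p z) + `|x|) ^+ 2.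
  by rewrite ler_sqr ?nnegrE ?normc_ge0// addr_ge0// mulr_ge0.
have h6 : 0 <= 1 - normc z ^+ 2 by rewrite subr_ge0 expr_le1.
apply: (le_trans (ler_wpM2l h6 h5)).
move: (N / pi) IH => M IH.
(* This square is exactly what remains of the inequality once [M] is replaced by its lower bound
   [(1 - r ^+ 2) * A ^+ 2]. *)
have := sqr_ge0 ((1 - normc z ^+ 2) * normc (ceval p z) - normc z * `|x|).
move: (normc (ceval p z)) (normc z) (`|x|) IH => A r y IH; nra.
Qed.

End circle.

(** * Trial polynomials and the error bound *)

Section chebyshev.
Context {R : realType}.
Implicit Types (p q g H u : {poly R}) (c r t x : R) (z : R[i]).

(** Multiplying a cosine of order $m$ by $\cos t$ produces only the orders $m \pm 1$, so $l < m$
    multiplications never reach order zero. *)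
Lemma J_orth_cosX l m : (l < m)%N ->
  Iab 0 pi (fun t : R => cos t ^+ l * cos (m%:R * t)) = 0.
Proof.
elim: l m => [|l IH] [//|m] lm.
  rewrite (Iab_eq (g := fun t => cos (m.+1%:R * t))) ?J_cos// => t _.
  by rewrite mul1r.
rewrite (Iab_eq (g := fun t => 2^-1 * (cos t ^+ l * cos (m.+2%:R * t)) +
    2^-1 * (cos t ^+ l * cos (m%:R * t)))).
  have lm2 : (l < m.+2)%N by rewrite ltnS ltnW// ltnW.
  by rewrite IabD ?IabZ ?IH ?mulr0 ?addr0//; apply: cont_intble; cont.
move=> t _; rewrite exprSr -!natr1 !mulrDl !mul1r.
have -> : m%:R * t + t + t = (m%:R * t + t) + t by [].
have e : cos (m%:R * t) = cos ((m%:R * t + t) - t) by rewrite addrK.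
by rewrite e [in RHS]cosD cosB; field.
Qed.

Lemma J_orth_poly q m : (size q <= m)%N ->
  Iab 0 pi (fun t => q.[cos t] * cos (m%:R * t)) = 0.
Proof.
move=> qm; rewrite (Iab_eq (g := fun t => \sum_(i < size q) q`_i * (cos t ^+ i * cos (m%:R * t)))).
  rewrite (@Iab_sum _ _ _ _ (fun i t => q`_i * (cos t ^+ i * cos (m%:R * t)))).
    apply: big1 => i _; rewrite IabZ ?J_orth_cosX ?mulr0 ?(leq_trans _ qm)//.
    by apply: cont_intble; cont.
  by move=> i; apply: cont_intble; cont.
move=> t _; rewrite horner_coef mulr_suml; apply: eq_bigr => i _.
by rewrite mulrA.
Qed.

(** The product of sines is half the difference of the cosines of orders [m - 1] and [m + 1], and
    [m - 1] is still at least the size of [u]. *)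
Lemma J_orth_sin c r u n m : 0 < r -> (size u <= n)%N -> (n < m)%N ->
  Iab 0 pi (fun t => u.[c + 2 * r * cos t] * (sin t * sin (m%:R * t))) = 0.
Proof.
move=> r0 un; case: m => // m nm.
pose l : {poly R} := (2 * r) *: 'X + c%:P.
pose v := u \Po l.
have sl : size l = 2.
  rewrite /l -mul_polyC size_MXaddC ?polyC_eq0 ?size_polyC.
  by rewrite (_ : 2 * r == 0 = false) ?andFb// mulf_eq0 pnatr_eq0 (gt_eqF r0).
have sv : size v = size u by rewrite size_comp_poly2.
have vE t : v.[cos t] = u.[c + 2 * r * cos t].
  by rewrite horner_comp /l !hornerE addrC.
rewrite (Iab_eq (g := fun t => 2^-1 * (v.[cos t] * cos (m%:R * t)) +
   (- 2^-1) * (v.[cos t] * cos (m.+2%:R * t)))).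
  rewrite IabD ?IabZ ?J_orth_poly ?sv ?mulr0 ?addr0//; try (apply: cont_intble; by cont).
    by rewrite ltnW// ltnW// ltnS (leq_ltn_trans un).
  by rewrite (leq_trans un).
move=> t _; rewrite vE -!natr1 !mulrDl !mul1r.
have e : cos (m%:R * t) = cos ((m%:R * t + t) - t) by rewrite addrK.
by rewrite e cosB [cos (_ + t + t)]cosD; field.
Qed.

Fixpoint tau2 c r n : {poly R} * {poly R} :=
  if n is n'.+1 then
    let: (p, q) := tau2 c r n' in (q, ('X - c%:P) * q - (r ^+ 2) *: p)
  else (2%:P, 'X - c%:P).

(* The Chebyshev polynomials normalized by [tau n (c + r (z + 1/z)) =
   r^n (z^n + z^-n)]; they are monic for [0 < n], but [tau 0 = 2]. *)
Definition tau c r n := (tau2 c r n).1.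

Lemma tauSS c r n :
  tau c r n.+2 = ('X - c%:P) * tau c r n.+1 - (r ^+ 2) *: tau c r n.
Proof. by rewrite /tau /=; case: (tau2 c r n) => p q. Qed.

(** The Joukowski map. It sends the unit circle onto the segment of centre [c] and half-length
    [2 * r], and the punctured disc onto its complement. *)
Definition jk c r z : R[i] := c%:C + r%:C * (z + z^-1).

Lemma jk_ecirc c r t : jk c r (ecirc t) = (c + 2 * r * cos t)%:C.
Proof.
rewrite /jk ecircV /ecirc cosN sinN; apply/eqP; rewrite eq_complex /=.
by apply/andP; split; apply/eqP; ring.
Qed.

Lemma ceval_tau c r n z : z != 0 ->
  ceval (tau c r n) (jk c r z) = (r ^+ n)%:C * (z ^+ n + z ^- n).
Proof.
move=> z0; suff: ceval (tau c r n) (jk c r z) = (r ^+ n)%:C * (z ^+ n + z ^- n) /\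
   ceval (tau c r n.+1) (jk c r z) = (r ^+ n.+1)%:C * (z ^+ n.+1 + z ^- n.+1) by case.
elim: n => [|n [IH1 IH2]].
  split; first by rewrite /tau cevalC /= mul1r expr0 invr1 (rmorphD _ 1 1).
  by rewrite /tau/= cevalB cevalX cevalC /jk !expr1 addrAC subrr add0r.
split => //; rewrite tauSS cevalB cevalM -mul_polyC cevalM IH1 IH2 cevalB cevalX !cevalC.
have -> : jk c r z - c%:C = r%:C * (z + z^-1) by rewrite /jk addrAC subrr add0r.
rewrite !rmorphXn/= !exprSr.
set a := z ^+ n; have a0 : a != 0 by rewrite expf_neq0.
by field; rewrite z0 a0.
Qed.

Lemma size_tau c r n : size (tau c r n.+1) = n.+2 /\ tau c r n.+1 \is monic.
Proof.
suff H m : (m <= n)%N -> size (tau c r m.+1) = m.+2 /\ tau c r m.+1 \is monic by exact: H.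
elim/ltn_ind: m => -[|m] IH mn.
  by rewrite /tau/= size_XsubC monicXsubC.
have [s1 m1] := IH m (ltnSn m) (ltnW mn).
rewrite tauSS.
have sM : size (('X - c%:P) * tau c r m.+1) = m.+3.
  by rewrite size_monicM ?monicXsubC// -?size_poly_eq0 ?s1// size_XsubC.
have sZ : (size (- ((r ^+ 2) *: tau c r m)) <= m.+2)%N.
  rewrite size_polyN (leq_trans (size_scale_leq _ _))//.
  case: m {sM s1 m1} IH mn => [|m] IH mn; last first.
    by have [-> _] := IH m (ltnW (ltnSn _)) (ltnW (ltnW mn)).
  by rewrite /tau size_polyC (leq_trans (leq_b1 _)).
split; first by rewrite size_polyDl ?sM.
by rewrite monicE lead_coefDl ?sM ?ltnS// -monicE monicMr ?monicXsubC.
Qed.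

(** Off the segment the summand $z^{-n} g(z)$ of [ceval_trial] dominates, so [g] is what the
    exterior behaviour reveals. The condition $g_0 = 1$ makes the polynomial monic. *)
Definition trial c r n g : {poly R} :=
  \sum_(j < size g) (g`_j * r ^+ j) *: tau c r (n - j).

Lemma ceval_trial c r n g z : z != 0 -> (size g <= n)%N ->
  ceval (trial c r n g) (jk c r z) =
  (r ^+ n)%:C * (z ^- n * ceval g z + z ^+ n * ceval g z^-1).
Proof.
move=> z0 gn; rewrite /trial ceval_sum [ceval g z]ceval_coef [ceval g z^-1]ceval_coef.
rewrite !mulr_sumr -big_split mulr_sumr; apply: eq_bigr => j _ /=.
have jn : (j <= n)%N by rewrite (leq_trans (ltnW (ltn_ord j))).
rewrite -mul_polyC cevalM cevalC ceval_tau//.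
rewrite -{4 5 6}(subnK jn) !rmorphM/= !rmorphXn/= !exprD exprVn.
have a0 : z ^+ j != 0 by rewrite expf_neq0.
have b0 : z ^+ (n - j) != 0 by rewrite expf_neq0.
by field; rewrite a0 b0.
Qed.

Lemma size_trial c r n g : (size g <= n)%N -> g`_0 = 1 ->
  size (trial c r n g) = n.+1 /\ trial c r n g \is monic.
Proof.
move=> gn g0; have : (0 < size g)%N.
  by case: posnP => // /eqP; rewrite size_poly_eq0 => /eqP g1; move: g0; rewrite g1 coef0 => /eqP; rewrite eq_sym oner_eq0.
rewrite /trial; case E : (size g) gn => [//|m] mn _.
rewrite big_ord_recl/= g0 mulr1 scale1r subn0.
case: n mn => // n mn; have [s1 m1] := size_tau c r n.
set S := \sum_(i < m) _.
have sS : (size S <= n.+1)%N.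
  apply: (leq_trans (size_sum _ _ _)); apply/bigmax_leqP => i _.
  apply: (leq_trans (size_scale_leq _ _)); rewrite /bump/= add1n subSS.
  case Ei : (n - i)%N => [|k]; first by rewrite /tau size_polyC (leq_trans (leq_b1 _)).
  by have [-> _] := size_tau c r k; rewrite ltnS -Ei leq_subr.
split; first by rewrite size_polyDl ?s1.
by rewrite monicE lead_coefDl ?s1 ?ltnS// -monicE.
Qed.

Lemma trial_circ c r n g t : (size g <= n)%N ->
  (trial c r n g).[c + 2 * r * cos t] =
  2 * r ^+ n * (cos (n%:R * t) * pc g t + sin (n%:R * t) * ps g t).
Proof.
move=> gn; have := ceval_trial c r (ecirc_neq0 t) gn.
rewrite jk_ecirc ceval_real => /(congr1 (@complex.Re R)).
have -> : ceval g (ecirc t)^-1 = (ceval g (ecirc t))^*.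
  rewrite !ceval_coef rmorph_sum; apply: eq_bigr => i _.
  rewrite rmorphM rmorphXn ecircV /ecirc cosN sinN; congr (_ * _).
  exact/esym/conjc_real.
rewrite -exprVn ecircV !ecircX.
rewrite /pc /ps mulrN; case: (ceval g _) => a b /=.
by rewrite cosN sinN => ->; ring.
Qed.

Lemma pcps_trig m g t :
  sin (m%:R * t) * pc g t + cos (m%:R * t) * ps g t = \sum_(i < size g) g`_i * sin ((m + i)%:R * t).
Proof.
rewrite pcE psE !mulr_sumr -big_split; apply: eq_bigr => i _ /=.
by rewrite natrD mulrDl sinD; ring.
Qed.

(** By the addition formula the bracket contains only sines of order larger than [n]. This is the
    freedom of subtracting a multiple of [H] in the error estimate without changing the integral. *)
Lemma J_orth_poly_sin c r u n H : 0 < r -> (size u <= n)%N ->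
  Iab 0 pi (fun t => u.[c + 2 * r * cos t] *
    (sin (n.+1%:R * t) * pc H t + cos (n.+1%:R * t) * ps H t) * sin t) = 0.
Proof.
move=> r0 un; rewrite (Iab_eq (g := fun t => \sum_(i < size H)
    H`_i * (u.[c + 2 * r * cos t] * (sin t * sin ((n.+1 + i)%:R * t))))).
  rewrite (@Iab_sum _ _ _ _ (fun i t => H`_i * (u.[c + 2 * r * cos t] * (sin t * sin ((n.+1 + i)%:R * t))))).
    apply: big1 => i _; rewrite IabZ ?(J_orth_sin c r0 un) ?mulr0// ?addSn ?ltnS ?leq_addr//.
    by apply: cont_intble; cont.
  by move=> i; apply: cont_intble; cont.
move=> t _; rewrite pcps_trig mulr_sumr mulr_suml; apply: eq_bigr => i _; ring.
Qed.

(** With [A'] and [B'] the conjugate sums, $|g|^2 = A^2 + A'^2$, $|H|^2 = B^2 + B'^2$, and the real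
    part of $g H (1 - z^2)$ is $2 \sin t\,(A B + A' B')$. The difference of the two sides is then
    the same weighted square formed with the conjugates. *)
Lemma orth_error_pointwise g H n t y : 0 < y -> 0 <= sin t ->
  let A := cos (n%:R * t) * pc g t + sin (n%:R * t) * ps g t in
  let B := sin (n.+1%:R * t) * pc H t + cos (n.+1%:R * t) * ps H t in
  (y * A - B) ^+ 2 / y * sin t <=
  y * pn g t * sin t + pn H t / y * sin t - pc (g * H * (1 - 'X^2)) t.
Proof.
move=> y0 st /=; set A := (X in y * X - _); set B := (X in _ * A - X).
pose A' := cos (n%:R * t) * ps g t - sin (n%:R * t) * pc g t.
pose B' := cos (n.+1%:R * t) * pc H t - sin (n.+1%:R * t) * ps H t.
have c2 : cos (n%:R * t) ^+ 2 = 1 - sin (n%:R * t) ^+ 2 by rewrite cos2sin2.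
have d2 : cos (n.+1%:R * t) ^+ 2 = 1 - sin (n.+1%:R * t) ^+ 2 by rewrite cos2sin2.
have eA : pn g t = A ^+ 2 + A' ^+ 2.
  transitivity ((cos (n%:R * t) ^+ 2 + sin (n%:R * t) ^+ 2) * pn g t).
    by rewrite cos2Dsin2 mul1r.
  by rewrite /pn /A /A'; ring.
have eB : pn H t = B ^+ 2 + B' ^+ 2.
  transitivity ((cos (n.+1%:R * t) ^+ 2 + sin (n.+1%:R * t) ^+ 2) * pn H t).
    by rewrite cos2Dsin2 mul1r.
  by rewrite /pn /B /B'; ring.
have eW : pc (g * H * (1 - 'X^2)) t = 2 * sin t * (A * B + A' * B').
  have -> : A * B + A' * B' = sin t * (pc g t * pc H t - ps g t * ps H t) + cos t * (ps g t * pc H t + pc g t * ps H t).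
    have s1 : sin t = sin (n.+1%:R * t) * cos (n%:R * t) - cos (n.+1%:R * t) * sin (n%:R * t).
      by rewrite -sinB -natr1 mulrDl mul1r addrAC subrr add0r.
    have c1 : cos t = cos (n.+1%:R * t) * cos (n%:R * t) + sin (n.+1%:R * t) * sin (n%:R * t).
      by rewrite -cosB -natr1 mulrDl mul1r addrAC subrr add0r.
    by rewrite s1 c1 /A /A' /B /B'; ring.
  rewrite pcM [pc (g * H) t]pcM [ps (g * H) t]psM.
  have -> : pc (1 - 'X^2) t = 2 * sin t ^+ 2.
    by rewrite pcD pcC -mulN1r -polyCN pcM pcC psC pcXn mulrC mul0r subr0 mulr_natl cos_mulr2n cos2sin2; ring.
  have -> : ps (1 - 'X^2) t = - (2 * sin t * cos t).
    rewrite /ps cevalB cevalC -[ceval _ _]/(ceval _ _); have := psXn 2 t; rewrite /ps.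
    by case: (ceval _ _) => a b /= ->; rewrite mulr_natl sin_mulr2n; ring.
  by ring.
have yV : y * y^-1 = 1 by rewrite divff// gt_eqF.
rewrite eA eB eW -subr_ge0.
have -> : y * (A ^+ 2 + A' ^+ 2) * sin t + (B ^+ 2 + B' ^+ 2) / y * sin t -
  2 * sin t * (A * B + A' * B') - (y * A - B) ^+ 2 / y * sin t =
  (y * A' - B') ^+ 2 / y * sin t by field; rewrite gt_eqF.
by rewrite mulr_ge0// divr_ge0 ?sqr_ge0// ltW.
Qed.

End chebyshev.

(** * Mean square and pointwise error of the trial polynomial *)

Section core.
Context {R : realType}.
Implicit Types (p q g H u d : {poly R}) (c r t x : R) (z : R[i]).

(** For $g_0 = 1$ the subtracted term is the integral of the real part of $g H (1 - z^2)$. Since $|1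
    - z^2| = 2 \sin t$, the arithmetic-geometric inequality bounds that real part by the other
    integrand, and the defect measures how far both inequalities are from equality. *)
Definition core_defect (f : R -> R) g H : R :=
  Iab 0 pi (fun t => f t * pn g t * sin t + pn H t / f t * sin t) - pi * H`_0.

(* Orthogonality of [q] and of the sines of order larger than [n] turns the
   integral of [d^2 f sin], [d] the error, into that of [d (f A - B) sin] with
   the [A], [B] of [orth_error_pointwise]; by Cauchy-Schwarz it is at most the
   integral of [(f A - B)^2 / f sin].  The cross term there is the cosine sum
   of [g H (1 - X^2)], whose mean is [g_0 H_0]. *)
Lemma core_L2 c r n (f : R -> R) m q g H : 0 < r -> (size g <= n)%N -> g`_0 = 1 ->
  contR f -> 0 < m -> (forall t, m <= f t) -> q \is monic -> size q = n.+1 ->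
  (forall u, (size u <= n)%N ->
     Iab 0 pi (fun t => u.[c + 2 * r * cos t] * q.[c + 2 * r * cos t] * (f t * sin t)) = 0) ->
  (size (trial c r n g - q)%R <= n)%N /\
  m * Iab 0 pi (fun t => (trial c r n g - q).[c + 2 * r * cos t] ^+ 2 * sin t) <=
  (2 * r ^+ n) ^+ 2 * core_defect f g H.
Proof.
move=> r0 gn g0 cf m0 mf mq sq orth.
have [sT mT] := size_trial c r gn g0.
set d := trial c r n g - q.
have sd : (size d <= n)%N.
  apply/leq_sizeP => j; rewrite leq_eqVlt coefB => /orP[/eqP <-|nj].
    have := monicP mT; have := monicP mq; rewrite !lead_coefE sT sq /= => -> ->.
    by rewrite subrr.
  by rewrite !nth_default ?subrr// ?sT ?sq.
split => //.
have f0 t : 0 < f t by exact: lt_le_trans (mf t).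
have fn0 t : f t != 0 by rewrite gt_eqF.
pose xx t := c + 2 * r * cos t.
have cx : contR xx by rewrite /xx; cont.
pose A t := cos (n%:R * t) * pc g t + sin (n%:R * t) * ps g t.
pose B t := sin (n.+1%:R * t) * pc H t + cos (n.+1%:R * t) * ps H t.
have cpc p := @cont_pc R p; have cps p := @cont_ps R p; have cpn p := @cont_pn R p.
have cA : contR A.
  by apply: contD; apply: contM; [cont|exact: cpc|cont|exact: cps].
have cB : contR B.
  by apply: contD; apply: contM; [cont|exact: cpc|cont|exact: cps].
have cV : contR (fun t => (f t)^-1) by exact: contV.
have cpnH := cpn H; have cpng := cpn g; have cpcH := cpc H; have cpsH := cps H.
pose k := 2 * r ^+ n.
pose D t := d.[xx t] ^+ 2 * (f t * sin t).
have JD : Iab 0 pi D = Iab 0 pi (fun t => k * (d.[xx t] * (f t * A t - B t) * sin t)).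
  transitivity (Iab 0 pi (fun t => k * (d.[xx t] * (f t * A t) * sin t))).
    rewrite -[LHS]addr0 -[X in _ + X](orth d sd) -IabD; try (by apply: cont_intble; rewrite /D; cont).
    apply: Iab_eq => t _; rewrite /D -/(xx t).
    have dE : d.[xx t] = (trial c r n g).[xx t] - q.[xx t] by rewrite /d hornerD hornerN.
    have -> : k * (d.[xx t] * (f t * A t) * sin t) = d.[xx t] * (k * A t) * (f t * sin t) by ring.
    have -> : k * A t = (trial c r n g).[xx t] by rewrite trial_circ.
    by rewrite dE; ring.
  have := J_orth_poly_sin c H r0 sd => /(congr1 (fun y => k * y)).
  rewrite mulr0 -IabZ => [JB|]; last by apply: cont_intble; cont.
  rewrite -[LHS]subr0 -[X in _ - X]JB -IabB; try (by apply: cont_intble; cont).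
  apply: Iab_eq => t _; rewrite -/(xx t) -/(B t); ring.
(* Cauchy-Schwarz in additive form: the pointwise bound has [D / 2] on its right-hand side, which is
   absorbed into the left after integration. *)
have D0 : Iab 0 pi D <= k ^+ 2 * Iab 0 pi (fun t => (f t * A t - B t) ^+ 2 / f t * sin t).
  have : Iab 0 pi D <= Iab 0 pi (fun t => 2^-1 * D t + 2^-1 * (k ^+ 2 * ((f t * A t - B t) ^+ 2 / f t * sin t))).
    rewrite {1}JD; apply: Iab_le; try (by apply: cont_intble; rewrite /D; cont).
    move=> t /sin_ge0_pi st; rewrite /D -subr_ge0.
    rewrite [X in 0 <= X](_ : _ = 2^-1 * ((f t * d.[xx t] - k * (f t * A t - B t)) ^+ 2 / f t * sin t)).
      have fV : 0 <= (f t)^-1 by rewrite invr_ge0 ltW.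
      by apply: mulr_ge0 => //; do 2 apply: mulr_ge0 => //; exact: sqr_ge0.
    by field.
  rewrite (@IabD _ 0 pi (fun t => 2^-1 * D t)); try (by apply: cont_intble; rewrite /D; cont).
  rewrite !IabZ; try (by apply: cont_intble; rewrite /D; cont).
  move: (Iab 0 pi D) (Iab 0 pi _) => a b; lra.
apply: (@le_trans _ _ (Iab 0 pi D)).
  rewrite -IabZ; last by apply: cont_intble; cont.
  apply: Iab_le; try (by apply: cont_intble; rewrite /D; cont).
  move=> t /sin_ge0_pi st; rewrite /D mulrCA; apply: ler_wpM2l; first exact: sqr_ge0.
  by apply: ler_wpM2r.
apply: (le_trans D0); apply: ler_wpM2l; first exact: sqr_ge0.
rewrite /core_defect.
have -> : pi * H`_0 = Iab 0 pi (pc (g * H * (1 - 'X^2))).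
  rewrite J_pc -!horner_coef0 !hornerM [g.[0]]horner_coef0 g0 hornerD hornerN hornerXn hornerC.
  by rewrite expr0n subr0 mulr1 mul1r.
have cG := cpc (g * H * (1 - 'X^2)).
rewrite -IabB; try (apply: cont_intble; by cont).
apply: Iab_le.
- by apply: cont_intble; cont.
- by apply: cont_intble; apply: contD; [cont|apply: contN; exact: cpc].
by move=> t /sin_ge0_pi st; exact: orth_error_pointwise.
Qed.

(* [z^n d(jk z)] is a polynomial in [z] with the modulus of [d] on the circle. *)
Lemma exterior_poly c r n d : (size d <= n.+1)%N ->
  exists U : {poly R}, (forall z, z != 0 -> ceval U z = z ^+ n * ceval d (jk c r z)) /\
    forall t, pn U t = d.[c + 2 * r * cos t] ^+ 2.
Proof.
move=> sd.
pose U : {poly R} := \sum_(j < size d) (d`_j)%:P * (c%:P * 'X + r%:P * ('X ^+ 2 + 1)) ^+ j * 'X ^+ (n - j).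
have UE z : z != 0 -> ceval U z = z ^+ n * ceval d (jk c r z).
  move=> z0; rewrite ceval_sum [ceval d _]ceval_coef mulr_sumr; apply: eq_bigr => j _.
  have jn : (j <= n)%N by rewrite -ltnS (leq_trans _ sd).
  rewrite !cevalM !cevalXn cevalD !cevalM cevalD cevalXn !cevalC cevalX.
  have -> : c%:C * z + r%:C * (z ^+ 2 + 1%:C) = jk c r z * z.
    by rewrite /jk; field.
  by rewrite -{2}(subnK jn) exprMn exprD; ring.
exists U; split => // t.
rewrite pnE UE ?ecirc_neq0// Normc.normcM normcX ecirc_norm expr1n mul1r.
by rewrite jk_ecirc ceval_real normcR real_normK ?num_real.
Qed.

(** The factor $1 - z^2$ is inserted before applying the mean value bound. On the circle its squared
    modulus $4 \sin^2 t \le 4 \sin t$ restores the weight of the mean square estimate; inside, it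
    costs $(1 - |z|^2)^2$, and the mean value bound supplies the third power. The constant 16 is
    this 4 times the $2^2$ of the trial polynomial. *)
Lemma core_pointwise c r n (f : R -> R) m q g H z : 0 < r -> (size g <= n)%N -> g`_0 = 1 ->
  contR f -> 0 < m -> (forall t, m <= f t) -> q \is monic -> size q = n.+1 ->
  (forall u, (size u <= n)%N ->
     Iab 0 pi (fun t => u.[c + 2 * r * cos t] * q.[c + 2 * r * cos t] * (f t * sin t)) = 0) ->
  z != 0 -> normc z < 1 ->
  (1 - normc z ^+ 2) ^+ 3 * normc (z ^+ n * ceval (trial c r n g - q) (jk c r z)) ^+ 2 <=
   16 * r ^+ n ^+ 2 * core_defect f g H / (pi * m).
Proof.
move=> r0 gn g0 cf m0 mf mq sq orth z0 z1.
have [sd L2] := core_L2 H r0 gn g0 cf m0 mf mq sq orth.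
set d := trial c r n g - q in sd L2 *.
have [U [UE Ut]] := exterior_poly c r (leqW sd).
have pi0 := pi_gt0 R.
have := circle_mean_bound (U * (1 - 'X^2)) (ltW z1).
rewrite cevalM UE// Normc.normcM exprMn.
set w := z ^+ n * _ => h.
have n0 := normc_ge0 z.
have hz : (1 - normc z ^+ 2) ^+ 2 <= normc (ceval (1 - 'X^2) z) ^+ 2.
  rewrite ler_sqr ?nnegrE ?normc_ge0 ?subr_ge0 ?expr_le1 ?(ltW z1)//.
  rewrite cevalB cevalC cevalXn cevalX lerBlDr -normcX -[X in X <= _](Normc.normc1 R).
  by rewrite -{1}(subrK (z ^+ 2) 1) le_normcD.
have h0 : 0 <= 1 - normc z ^+ 2 by rewrite subr_ge0 expr_le1 ?(ltW z1).
have hI : Iab 0 pi (pn (U * (1 - 'X^2))) <= 4 * Iab 0 pi (fun t => d.[c + 2 * r * cos t] ^+ 2 * sin t).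
  rewrite -IabZ; last by apply: cont_intble; cont.
  apply: Iab_le.
  - by apply: cont_intble; exact: cont_pn.
  - by apply: cont_intble; cont.
  move=> t /sin_ge0_pi st; rewrite pnM Ut.
  have -> : pn (1 - 'X^2) t = 4 * sin t ^+ 2.
    rewrite pnE cevalB cevalC cevalXn cevalX ecircX sqr_normcE /= mulr_natl cos_mulr2n sin_mulr2n.
    have -> : (1 - (cos t ^+ 2 *+ 2 - 1)) ^+ 2 = (sin t ^+ 2 *+ 2) ^+ 2 by rewrite cos2sin2; congr (_ ^+ 2); ring.
    have -> : (0 - (cos t * sin t) *+ 2) ^+ 2 = 4 * (cos t ^+ 2) * sin t ^+ 2 by ring.
    by rewrite cos2sin2; ring.
  rewrite mulrCA ler_pM2l// ler_wpM2l ?sqr_ge0// expr2 ler_piMr// sin_le1//.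
set I := Iab 0 pi (fun t => d.[_] ^+ 2 * sin t) in hI L2.
set I' := Iab 0 pi _ in h hI.
rewrite ler_pdivlMr ?mulr_gt0//.
apply: (@le_trans _ _ (4 * (m * I))); last first.
  rewrite (_ : 16 * _ * _ = 4 * ((2 * r ^+ n) ^+ 2 * core_defect f g H)); last by ring.
  by rewrite ler_pM2l.
have -> : 4 * (m * I) = 4 * I / pi * (pi * m).
  by rewrite [RHS]mulrA divfK ?gt_eqF// [in RHS]mulrC mulrCA.
apply: ler_wpM2r; first by rewrite mulr_ge0// ltW.
apply: (@le_trans _ _ (I' / pi)); last by rewrite ler_wpM2r// invr_ge0 ltW.
apply: le_trans h.
rewrite exprSr [leLHS]mulrAC [leLHS]mulrC -mulrA.
apply: ler_wpM2l => //; rewrite [leLHS]mulrC.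
rewrite [leLHS]mulrAC -expr2 [leLHS]mulrC; apply: ler_wpM2l => //; exact: sqr_ge0.
Qed.

Definition coef_norm g : R := \sum_(j < size g) `|g`_j|.

(** After normalization the trial polynomial contributes exactly $g(z) + z^{2n} g(1/z)$. As the size
    of [g] is at most [n], the second summand contains only powers of order larger than [n], whence
    [rho ^+ n * coef_norm g]; the rest is [core_pointwise]. *)
Lemma core_asymptotics c r n (f : R -> R) m q g H rho nu z :
  0 < r -> (size g <= n)%N -> g`_0 = 1 ->
  contR f -> 0 < m -> (forall t, m <= f t) -> q \is monic -> size q = n.+1 ->
  (forall u, (size u <= n)%N ->
     Iab 0 pi (fun t => u.[c + 2 * r * cos t] * q.[c + 2 * r * cos t] * (f t * sin t)) = 0) ->
  rho < 1 -> 0 <= nu -> 16 * core_defect f g H <= nu ^+ 2 * (pi * m) * (1 - rho ^+ 2) ^+ 3 ->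
  z != 0 -> normc z <= rho ->
  normc (ceval q (jk c r z) * (z / r%:C) ^+ n - ceval g z) <= rho ^+ n * coef_norm g + nu.
Proof.
move=> r0 gn g0 cf m0 mf mq sq orth rho1 nu0 hT z0 zr.
have pi0 := pi_gt0 R.
have n0 := normc_ge0 z.
have rc0 : r%:C != 0 :> R[i] by rewrite (fmorph_eq0 (real_complex R)) gt_eqF.
have := core_pointwise H r0 gn g0 cf m0 mf mq sq orth z0 (le_lt_trans zr rho1).
rewrite cevalB ceval_trial// => h.
set w := z ^+ n * _ in h.
have -> : ceval q (jk c r z) * (z / r%:C) ^+ n - ceval g z =
  z ^+ n * z ^+ n * ceval g z^-1 - w / (r%:C ^+ n).
  rewrite /w rmorphXn/= expr_div_n.
  have a0 : z ^+ n != 0 by rewrite expf_neq0.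
  have b0 : r%:C ^+ n != 0 :> R[i] by rewrite expf_neq0.
  by field; rewrite a0 b0.
apply: (le_trans (le_normcB _ _)); apply: lerD.
  rewrite ceval_coef mulr_sumr /coef_norm mulr_sumr.
  have : forall k (F : 'I_k -> R[i]) (G : 'I_k -> R), (forall i, normc (F i) <= G i) ->
     normc (\sum_i F i) <= \sum_i G i.
    move=> k F G FG; elim/big_ind2 : _ => //; first by rewrite Normc.normc0.
    by move=> x1 x2 y1 y2 h1 h2; rewrite (le_trans (le_normcD _ _))// lerD.
  apply => j; have jn : (j <= n)%N by rewrite (leq_trans (ltnW (ltn_ord j))).
  have -> : z ^+ n * z ^+ n * ((g`_j)%:C * z^-1 ^+ j) = (g`_j)%:C * z ^+ (n + (n - j)).
    have a0 : z ^+ j != 0 by rewrite expf_neq0.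
    by rewrite exprD -{2}(subnK jn) exprD exprVn; field.
  rewrite Normc.normcM normcR normcX mulrC ler_wpM2r//.
  rewrite exprD -[leRHS]mulr1; apply: ler_pM; rewrite ?exprn_ge0//.
    by rewrite lerXn2r// nnegrE// (le_trans _ zr).
  by rewrite exprn_ile1// (le_trans zr)// ltW.
rewrite Normc.normcM Normc.normcV normcX normcR gtr0_norm//.
rewrite -ler_sqr ?nnegrE//; last by rewrite mulr_ge0 ?invr_ge0 ?exprn_ge0 ?normc_ge0// ltW.
have r2 : rho ^+ 2 < 1 by rewrite expr_lt1// (le_trans _ zr).
have z2 : normc z ^+ 2 <= rho ^+ 2 by rewrite lerXn2r// nnegrE (le_trans _ zr).
have e0 : 0 < (1 - rho ^+ 2) ^+ 3 by rewrite exprn_gt0// subr_gt0.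
have rn : 0 < (r ^+ n) ^+ 2 by rewrite !exprn_gt0.
have pm : 0 < pi * m by rewrite mulr_gt0.
rewrite exprMn exprVn ler_pdivrMr//.
rewrite -(ler_pM2l e0) -(ler_pM2r pm).
apply: (@le_trans _ _ (16 * r ^+ n ^+ 2 * core_defect f g H)).
  rewrite -ler_pdivlMr//; apply: le_trans h.
  rewrite ler_wpM2r ?sqr_ge0// lerXn2r ?nnegrE ?subr_ge0 ?(ltW r2) ?(le_trans z2) ?(ltW r2)//.
  by rewrite lerB.
have := ler_wpM2l (ltW rn) hT; move: (core_defect _ _ _) (r ^+ n ^+ 2) ((1 - rho ^+ 2) ^+ 3) (pi * m) => a b d e.
by lra.
Qed.

End core.

(** * Approximation of the weight *)

Section weierstrass.
Context {R : realType}.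
Implicit Types (f phi : R -> R) (x y a b e : R).

Lemma bounded_segment f a b : contR f -> exists2 M, 0 < M & forall x, a <= x <= b -> `|f x| <= M.
Proof.
move=> cf; have [ab|ab] := leP a b; last first.
  by exists 1 => // x /andP[h1 h2]; move: ab; rewrite ltNge (le_trans h1 h2).
have cn : contR (fun x => `|f x|) by exact: cont_norm.
have [c _ hc] := EVT_max ab (continuous_subspaceT cn).
exists (`|f c| + 1); first by rewrite ltr_wpDl.
by move=> x xab; rewrite (le_trans (hc x _))// lerDl.
Qed.

Lemma unif_cont_segment f a b e : contR f -> 0 < e ->
  exists2 d, 0 < d & forall x y, a <= x <= b -> `|x - y| < d -> `|f x - f y| < e.
Proof.
move=> cf e0.
have := @segment_compact R a b; move/compact_near_coveringP.
move=> /(_ R 0^'+ (fun d x => forall y, `|x - y| < d -> `|f x - f y| < e)) H.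
have {}H := H _ _.
suff : \forall d \near (0 : R)^'+, `[a, b] `<=` (fun x => forall y, `|x - y| < d -> `|f x - f y| < e).
  move=> h; near (0 : R)^'+ => d; exists d => // x y xab.
  have hd : `[a, b] `<=` (fun x => forall y, `|x - y| < d -> `|f x - f y| < e) by near: d.
  by apply: (hd x); rewrite /= in_itv.
apply: H => x _.
have /cvgrPdist_lt/(_ (e / 2)) := cf x.
rewrite divr_gt0// => /(_ isT) /nbhs_ballP[h /= h0 hx].
exists (ball x (h / 2), [set d | d < h / 2]) => /=.
  split; first by apply: nbhsx_ballx; rewrite divr_gt0.
  by apply: nbhs_right_lt; rewrite divr_gt0.
move=> [u d] [/= xu dh] y uy.
have h1 : `|f x - f u| < e / 2.
  by apply: hx; rewrite /ball/= (lt_trans xu)// gtr_pMr// invf_lt1 ?ltr1n.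
have h2 : `|f x - f y| < e / 2.
  apply: hx; rewrite /ball/=; have -> : x - y = (x - u) + (u - y) by ring.
  rewrite (le_lt_trans (ler_normD _ _))// [h]splitr ltrD// (lt_trans uy)//.
have -> : f u - f y = (f x - f y) - (f x - f u) by ring.
by rewrite (le_lt_trans (ler_normB _ _))// [e]splitr ltrD.
Unshelve. all: by end_near. Qed.

(* [bern n phi] is the polynomial whose value at [x] is the expectation of
   [phi k] for [k] binomial with parameters [n, x]. *)
Fixpoint bern n (phi : nat -> R) : {poly R} :=
  if n is m.+1 then 'X * bern m (fun k => phi k.+1) + (1 - 'X) * bern m phi
  else (phi 0%N)%:P.

Lemma bernS n (phi : nat -> R) x :
  (bern n.+1 phi).[x] = x * (bern n (fun k => phi k.+1)).[x] + (1 - x) * (bern n phi).[x].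
Proof. by rewrite /= !hornerE. Qed.

Lemma bern_le n (phi psi : nat -> R) x : 0 <= x <= 1 ->
  (forall k, (k <= n)%N -> phi k <= psi k) -> (bern n phi).[x] <= (bern n psi).[x].
Proof.
move=> /andP[x0 x1]; elim: n phi psi => [|n IH] phi psi h.
  by rewrite /= !hornerC h.
rewrite !bernS; apply: lerD; apply: ler_wpM2l; rewrite ?subr_ge0//; apply: IH => k kn; apply: h => //.
exact: leqW.
Qed.

Lemma bern_lin n (phi psi : nat -> R) e x :
  (bern n (fun k => phi k + e * psi k)).[x] = (bern n phi).[x] + e * (bern n psi).[x].
Proof.
elim: n phi psi => [|n IH] phi psi; first by rewrite /= !hornerC.
by rewrite !bernS !IH; ring.
Qed.

Lemma bern_cst n e x : (bern n (fun=> e)).[x] = e.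
Proof. by elim: n => [|n IH]; rewrite ?bernS ?IH /= ?hornerC//; ring. Qed.

(** The second moment is taken about an arbitrary centre [y] because the recursion shifts the centre
    by one. *)
Lemma bern_sqr n x y :
  (bern n (fun k => (k%:R - y) ^+ 2)).[x] = (n%:R * x - y) ^+ 2 + n%:R * x * (1 - x).
Proof.
elim: n y => [|n IH] y; first by rewrite /= hornerC; ring.
rewrite bernS IH.
have -> : (fun k => (k.+1%:R - y) ^+ 2) = (fun k : nat => (k%:R - (y - 1)) ^+ 2).
  by apply/funext => k; rewrite -natr1; ring.
by rewrite IH -natr1; ring.
Qed.

(** Bernstein's argument. Uniform continuity and boundedness give $|f(x) - f(y)| \le e/2 + C (x -
    y)^2$, and the binomial expectation of the quadratic term is at most $C / n$. *)
Lemma weierstrass01 f e : contR f -> 0 < e ->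
  exists p : {poly R}, forall x, 0 <= x <= 1 -> `|p.[x] - f x| <= e.
Proof.
move=> cf e0.
have [d d0 hd] := unif_cont_segment 0 1 cf (divr_gt0 e0 (ltr0n R 2)).
have [M M0 hM] := bounded_segment 0 1 cf.
pose C := 2 * M / d ^+ 2.
have C0 : 0 < C by rewrite divr_gt0 ?exprn_gt0// mulr_gt0.
have hC x y : 0 <= x <= 1 -> 0 <= y <= 1 -> `|f x - f y| <= e / 2 + C * (x - y) ^+ 2.
  move=> x01 y01; have [xy|xy] := ltP `|x - y| d.
    by rewrite (le_trans (ltW (hd _ _ x01 xy)))// lerDl mulr_ge0 ?sqr_ge0// ltW.
  rewrite (le_trans (ler_normB _ _))//.
  have := hM x x01; have := hM y y01.
  suff : 2 * M <= C * (x - y) ^+ 2 by move: e0; lra.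
  rewrite /C mulrAC ler_pdivlMr ?exprn_gt0// ler_wpM2l ?mulr_ge0 ?(ltW M0)//.
  by rewrite -(real_normK (num_real (x - y))) lerXn2r// nnegrE// ltW.
pose n := (Num.truncn (2 * C / e)).+1.
have n0 : 0 < n%:R :> R by rewrite ltr0n.
have hn : C / n%:R <= e / 2.
  have : 2 * C / e < n%:R by exact: truncnS_gt.
  by rewrite ler_pdivrMr// ltr_pdivrMr//; lra.
exists (bern n (fun k => f (k%:R / n%:R))) => x x01.
have hk k : (k <= n)%N -> 0 <= k%:R / n%:R :> R /\ k%:R / n%:R <= 1 :> R.
  by move=> kn; rewrite divr_ge0// ler_pdivrMr// mul1r ler_nat.
(* [B 1] and [B (-1)] are the Bernstein polynomials of the quadratic upper and lower bounds of [f]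
   about [x]; the variance identity evaluates them at [x]. *)
pose B (s : R) := bern n (fun k => (f x + s * (e / 2)) + (s * C / n%:R ^+ 2) * (k%:R - n%:R * x) ^+ 2).
have BE s : (B s).[x] = f x + s * (e / 2 + C / n%:R * (x * (1 - x))).
  rewrite /B (@bern_lin n (fun=> f x + s * (e / 2)) (fun k => (k%:R - n%:R * x) ^+ 2)) bern_cst bern_sqr.
  by rewrite subrr expr0n add0r; field; rewrite gt_eqF.
have hb k : (k <= n)%N -> `|f (k%:R / n%:R) - f x| <= e / 2 + C / n%:R ^+ 2 * (k%:R - n%:R * x) ^+ 2.
  move=> /hk/andP h; apply: (le_trans (hC _ _ h x01)); rewrite lerD2l.
  have -> : k%:R / n%:R - x = (k%:R - n%:R * x) / n%:R by field; rewrite gt_eqF.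
  by rewrite expr_div_n mulrA [leRHS]mulrAC.
have hx : x * (1 - x) <= 1.
  by move: x01 => /andP[x0 x1]; rewrite -[leRHS]mulr1 ler_pM ?subr_ge0// gerBl.
have hxx : 0 <= x * (1 - x) by move: x01 => /andP[x0 x1]; rewrite mulr_ge0// subr_ge0.
have hCx : C / n%:R * (x * (1 - x)) <= e / 2.
  by rewrite (le_trans _ hn)// ler_piMr// divr_ge0// ltW.
have up : (bern n (fun k => f (k%:R / n%:R))).[x] <= (B 1).[x].
  apply: bern_le => // k /hb; rewrite ler_norml => /andP[_ h].
  by rewrite !mul1r -addrA -lerBlDl.
have lo : (B (-1)).[x] <= (bern n (fun k => f (k%:R / n%:R))).[x].
  apply: bern_le => // k /hb; rewrite ler_norml => /andP[h _].
  rewrite !mulN1r -addrA -lerBrDl mulNr mulNr; apply: le_trans h; rewrite opprD.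
  by rewrite lerD2l.
move: up lo; rewrite !BE ler_norml => up lo; apply/andP; split; lra.
Qed.

Lemma weierstrass f a b e : a < b -> contR f -> 0 < e ->
  exists p : {poly R}, forall x, a <= x <= b -> `|p.[x] - f x| <= e.
Proof.
move=> ab cf e0; have ab0 : 0 < b - a by rewrite subr_gt0.
have cg : contR (fun y => f (a + (b - a) * y)).
  by apply: (cont_comp cf); cont.
have [p hp] := weierstrass01 cg e0.
exists (p \Po ((b - a)^-1 *: ('X - a%:P))) => x /andP[ax xb].
have -> : f x = f (a + (b - a) * ((b - a)^-1 * (x - a))).
  by rewrite mulrA divff ?gt_eqF// mul1r addrC subrK.
rewrite horner_comp hornerZ hornerXsubC; apply: hp.
by rewrite mulrC divr_ge0 ?subr_ge0 ?(ltW ab)// ler_pdivrMr// mul1r lerD2r.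
Qed.

End weierstrass.

(** * Polynomial approximation in the disc *)

Section complex_exponential.
Context {R : realType}.
Implicit Types (z w : R[i]) (u v x : R).

Lemma cexpD z w : cexp (z + w) = cexp z * cexp w.
Proof.
case: z w => [a b] [c d]; apply/eqP; rewrite eq_complex /= expRD cosD sinD.
by apply/andP; split; apply/eqP; ring.
Qed.

Lemma cexp_real x : cexp x%:C = (expR x)%:C.
Proof. by rewrite /cexp /= cos0 sin0 mulr1 mulr0. Qed.

Lemma cexp0 : cexp (0 : R[i]) = 1.
Proof. by rewrite (cexp_real 0) expR0. Qed.

Lemma normc_cexp z : normc (cexp z) = expR (Re z).
Proof.
apply/eqP; rewrite -(@eqrXn2 _ 2)// ?normc_ge0 ?expR_ge0// sqr_normcE /=.
by rewrite !exprMn -mulrDr cos2Dsin2 mulr1.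
Qed.

Lemma cexp_neq0 z : cexp z != 0.
Proof. by rewrite -normc_eq0 normc_cexp gt_eqF ?expR_gt0. Qed.

Lemma cexpN z : cexp (- z) = (cexp z)^-1.
Proof. by apply: (mulIf (cexp_neq0 z)); rewrite -cexpD addNr cexp0 mulVf ?cexp_neq0. Qed.

Lemma sin_mvt x : 0 <= x -> exists2 y, 0 <= y <= x & sin x = cos y * x.
Proof.
move=> x0; have dsin (y : R) : y \in `]0, x[ -> is_derive y 1 sin (cos y).
  by move=> _; exact: is_derive_sin.
have [y] := MVT_segment x0 dsin (continuous_subspaceT (@continuous_sin R)).
by rewrite in_itv/= sin0 !subr0 => yx sx; exists y.
Qed.

Lemma abs_sin_le x : `|sin x| <= `|x|.
Proof.
wlog x0 : x / 0 <= x.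
  move=> H; have [|x0] := leP 0 x; first exact: H.
  by have := H (- x); rewrite sinN !normrN; apply; rewrite oppr_ge0 ltW.
have [y _ ->] := sin_mvt x0.
by rewrite normrM ler_piMl ?cos_max.
Qed.

Lemma cos_taylor x : 0 <= 1 - cos x <= x ^+ 2 / 2.
Proof.
rewrite subr_ge0 cos_le1 /=.
have -> : cos x = 1 - 2 * sin (x / 2) ^+ 2.
  by rewrite [in LHS](splitr x) -mulr2n cos_mulr2n cos2sin2; ring.
have := abs_sin_le (x / 2); rewrite -ler_sqr ?nnegrE//.
rewrite !real_normK ?num_real// => h; lra.
Qed.

Lemma sin_taylor x : `|sin x - x| <= `|x| ^+ 3.
Proof.
wlog x0 : x / 0 <= x.
  move=> H; have [|x0] := leP 0 x; first exact: H.
  by have := H (- x); rewrite sinN -opprD !normrN; apply; rewrite oppr_ge0 ltW.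
have [y /andP[y0 yx] ->] := sin_mvt x0.
have -> : cos y * x - x = - ((1 - cos y) * x) by ring.
have /andP[c0 c1] := cos_taylor y.
rewrite normrN normrM !ger0_norm// exprSr ler_wpM2r//.
rewrite (le_trans c1)// ler_pdivrMr// (@le_trans _ _ (x ^+ 2))//.
  by rewrite lerXn2r// nnegrE (le_trans y0).
by rewrite ler_peMr ?sqr_ge0// ler1n.
Qed.

(** The upper bound comes from the tangent bound at $-u$, which gives $e^u (1 - u) \le 1$. *)
Lemma expR_taylor u : `|u| <= 1 / 2 -> 0 <= expR u - 1 - u <= 2 * u ^+ 2.
Proof.
move=> hu; have := hu; rewrite ler_norml => /andP[u1 u2].
have h := expR_ge1Dx u; rewrite -addrA -opprD subr_ge0 h /=.
have h2 := expR_ge1Dx (- u).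
have : expR u * (1 - u) <= 1.
  by have := ler_wpM2l (expR_ge0 u) h2; rewrite expRxMexpNx_1.
move: h; move: (expR u) => e h1 h3.
have : (e - (1 + u)) * (1 - u) <= u ^+ 2 by nra.
have : 0 <= (e - (1 + u)) * (1 / 2 - u) by rewrite mulr_ge0//; lra.
nra.
Qed.

Lemma cexp_taylor w : normc w <= 1 / 2 -> normc (cexp w - 1 - w) <= 9 * normc w ^+ 2.
Proof.
move=> hw; have := Re_le_normc w; have := Im_le_normc w.
have n0 := normc_ge0 w.
move: (normc w) hw n0 => n hw n0; case: w => u v; rewrite [Im _]/= [Re _]/= => hv hu.
apply: (le_trans (le_normc_ReIm _)) => /=.
have /expR_taylor/andP[e0 e1] := le_trans hu hw.
have hu2 : u ^+ 2 <= n ^+ 2 by rewrite -(real_normK (num_real u)) lerXn2r// nnegrE.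
have hv2 : v ^+ 2 <= n ^+ 2 by rewrite -(real_normK (num_real v)) lerXn2r// nnegrE.
have n2 : n ^+ 2 <= 1 / 4 by nra.
have n3 : n ^+ 3 <= n ^+ 2 / 2 by rewrite exprSr ler_wpM2l ?sqr_ge0//; lra.
have [ul uu] : - (1 / 2) <= u /\ u <= 1 / 2.
  by apply/andP; rewrite -ler_norml (le_trans hu).
have he : 0 <= expR u <= 2.
  by rewrite expR_ge0 /=; move: (expR u) e1 => e; lra.
have /andP[c0 c1] := cos_taylor v.
have hs := sin_taylor v.
have hv3 : `|v| ^+ 3 <= n ^+ 3 by rewrite lerXn2r// nnegrE.
move/andP: he => [he0 he2].
have h1 : `|expR u * cos v - 1 - u| <= 3 * n ^+ 2.
  have -> : expR u * cos v - 1 - u = (expR u - 1 - u) - expR u * (1 - cos v) by ring.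
  rewrite (le_trans (ler_normB _ _))// normrM !ger0_norm//.
  have : expR u * (1 - cos v) <= 2 * (v ^+ 2 / 2) by rewrite ler_pM.
  by lra.
have h2 : `|expR u * sin v - 0 - v| <= 6 * n ^+ 2.
  have -> : expR u * sin v - 0 - v = (expR u - 1) * sin v + (sin v - v) by ring.
  rewrite (le_trans (ler_normD _ _))// normrM.
  have : `|expR u - 1| <= 2 * n.
    have -> : expR u - 1 = (expR u - 1 - u) + u by ring.
    rewrite (le_trans (ler_normD _ _))// (ger0_norm e0).
    have : 2 * u ^+ 2 <= n by nra.
    by lra.
  move=> h3; have : `|expR u - 1| * `|sin v| <= 2 * n * n.
    by rewrite ler_pM// (le_trans (abs_sin_le v)).
  rewrite -mulrA -expr2 => h4; have := le_trans hs hv3.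
  have : 0 <= n ^+ 2 by exact: sqr_ge0.
  move: (n ^+ 2) (n ^+ 3) n3 h4 => n2' n3' h5 h6 h7 h8; lra.
have : 0 <= n ^+ 2 by exact: sqr_ge0.
move: h1 h2; rewrite !subr0; move: (n ^+ 2) => n2' h1 h2 h3; lra.
Qed.

Lemma normc_sub_exp (a b : R[i]) (M : R) n : normc a <= M -> normc b <= M ->
  normc (a ^+ n.+1 - b ^+ n.+1) <= n.+1%:R * normc (a - b) * M ^+ n.
Proof.
move=> ha hb; have M0 : 0 <= M by rewrite (le_trans (normc_ge0 a)).
elim: n => [|n IH]; first by rewrite !expr1 mulr1 mul1r.
have -> : a ^+ n.+2 - b ^+ n.+2 = a * (a ^+ n.+1 - b ^+ n.+1) + (a - b) * b ^+ n.+1.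
  by rewrite [a ^+ n.+2]exprS [b ^+ n.+2]exprS; ring.
rewrite (le_trans (le_normcD _ _))// !Normc.normcM normcX.
have h1 : normc a * normc (a ^+ n.+1 - b ^+ n.+1) <= M * (n.+1%:R * normc (a - b) * M ^+ n).
  by rewrite ler_pM ?normc_ge0.
have h2 : normc (a - b) * normc b ^+ n.+1 <= normc (a - b) * M ^+ n.+1.
  by rewrite ler_wpM2l ?normc_ge0// lerXn2r// nnegrE ?normc_ge0.
rewrite (le_trans (lerD h1 h2))// -[n.+2%:R]natr1 exprS.
by rewrite le_eqVlt; apply/orP; left; apply/eqP; ring.
Qed.

(* Compare [1 + w/N] with [exp(w/N)] and raise to the power [N]. *)
Lemma cexp_limit (B e : R) : 0 < e -> exists N : nat, forall w, normc w <= B ->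
  normc ((1 + w / N%:R) ^+ N - cexp w) <= e.
Proof.
move=> e0; pose B' := `|B| + 1; have B1 : 1 <= B' by rewrite lerDr.
have B0 : 0 < B' by exact: lt_le_trans B1.
pose C := 9 * B' ^+ 2 * expR B'.
have C0 : 0 <= C.
  by apply: mulr_ge0; [apply: mulr_ge0 => //; exact: sqr_ge0|exact: expR_ge0].
pose n := Num.truncn (2 * B' + C / e).
have hn : 2 * B' + C / e < n.+1%:R by exact: truncnS_gt.
have n0 : 0 < n.+1%:R :> R by rewrite ltr0n.
exists n.+1 => w hw.
have wB : normc w <= B' by rewrite (le_trans hw)// (le_trans (ler_norm B))// lerDl.
have nN : normc (n.+1%:R : R[i]) = n.+1%:R.
  by rewrite -(rmorph_nat (real_complex R)) normcR ger0_norm.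
pose v := w / n.+1%:R.
have vn : normc v = normc w / n.+1%:R by rewrite Normc.normcM Normc.normcV nN.
have vB : normc v <= B' / n.+1%:R by rewrite vn ler_wpM2r// invr_ge0 ltW.
have Ce : 0 <= C / e by rewrite divr_ge0// ltW.
have vh : normc v <= 1 / 2.
  by rewrite (le_trans vB)// ler_pdivrMr//; lra.
have -> : cexp w = cexp v ^+ n.+1.
  have -> : w = v *+ n.+1.
    by rewrite -mulr_natr /v divfK// -normc_eq0 nN gt_eqF.
  elim: (n.+1) => [|k IH]; first by rewrite mulr0n cexp0.
  by rewrite mulrS cexpD IH exprS.
have ha : normc (1 + v) <= expR (normc v).
  rewrite (le_trans (le_normcD _ _))// Normc.normc1; exact: expR_ge1Dx.
have hb : normc (cexp v) <= expR (normc v).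
  by rewrite normc_cexp ler_expR (le_trans (ler_norm _))// Re_le_normc.
apply: (le_trans (normc_sub_exp _ ha hb)).
have hE : expR (normc v) ^+ n <= expR B'.
  rewrite -expRM_natl ler_expR (@le_trans _ _ (n.+1%:R * normc v))//.
    by rewrite ler_wpM2r ?normc_ge0// ler_nat.
  by rewrite vn mulrC divfK// gt_eqF.
have hT : normc (1 + v - cexp v) <= 9 * (B' / n.+1%:R) ^+ 2.
  rewrite normcB opprD addrA (le_trans (cexp_taylor vh))// ler_wpM2l//.
  by rewrite lerXn2r// nnegrE ?normc_ge0//; apply: divr_ge0; exact: ltW.
apply: (@le_trans _ _ (n.+1%:R * (9 * (B' / n.+1%:R) ^+ 2) * expR B')).
  apply: ler_pM => //; rewrite ?mulr_ge0 ?normc_ge0 ?exprn_ge0 ?expR_ge0//.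
  by rewrite ler_wpM2l.
have -> : n.+1%:R * (9 * (B' / n.+1%:R) ^+ 2) * expR B' = C / n.+1%:R.
  by rewrite /C; field; rewrite gt_eqF.
rewrite ler_pdivrMr// mulrC -ler_pdivrMr// (le_trans _ (ltW hn))//.
by rewrite lerDr mulr_ge0// ltW.
Qed.

End complex_exponential.

Section disc_approximation.
Context {R : realType}.
Implicit Types (z w : R[i]) (a e x : R) (p g : {poly R}) (F G : R[i] -> R[i]).

(** The approximating polynomials have real coefficients, as [trial] requires. *)
Definition disc_approx F := forall e, 0 < e ->
  exists p, forall z, normc z <= 1 -> normc (ceval p z - F z) <= e.

Lemma ceval_bound p z : normc z <= 1 -> normc (ceval p z) <= coef_norm p.
Proof.
move=> z1; rewrite ceval_coef /coef_norm.
elim/big_ind2 : _ => [|x1 x2 y1 y2 h1 h2|i _]; first by rewrite Normc.normc0.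
  by rewrite (le_trans (le_normcD _ _))// lerD.
by rewrite Normc.normcM normcR normcX ler_piMr// exprn_ile1// normc_ge0.
Qed.

Lemma disc_approx_bounded F : disc_approx F ->
  exists2 M, 0 < M & forall z, normc z <= 1 -> normc (F z) <= M.
Proof.
move=> /(_ 1 ltr01)[p hp]; exists (coef_norm p + 1).
  by rewrite ltr_wpDl// sumr_ge0.
move=> z z1; rewrite -(subrK (ceval p z) (F z)) (le_trans (le_normcD _ _))// addrC lerD//.
  exact: ceval_bound.
by rewrite normcB hp.
Qed.

Lemma disc_approx_poly p : disc_approx (ceval p).
Proof. by move=> e e0; exists p => z _; rewrite subrr Normc.normc0 ltW. Qed.

Lemma disc_approx_mul F G : disc_approx F -> disc_approx G -> disc_approx (fun z => F z * G z).
Proof.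
move=> aF aG e e0.
have [M M0 hM] := disc_approx_bounded aF; have [N N0 hN] := disc_approx_bounded aG.
pose d := Num.min 1 (e / (M + N + 1)).
have MN : 0 < M + N + 1 by rewrite !addr_gt0.
have d0 : 0 < d by rewrite lt_min ltr01 divr_gt0.
have [p hp] := aF d d0; have [q hq] := aG d d0.
exists (p * q) => z z1; rewrite cevalM.
have -> : ceval p z * ceval q z - F z * G z =
  (ceval p z - F z) * (ceval q z - G z) + (F z * (ceval q z - G z) + (ceval p z - F z) * G z) by ring.
have h1 := hp z z1; have h2 := hq z z1; have h3 := hM z z1; have h4 := hN z z1.
have d1 : d <= 1 by rewrite ge_min lexx.
have hd : d * (M + N + 1) <= e by rewrite -ler_pdivlMr// ge_min lexx orbT.
rewrite (le_trans (le_normcD _ _))//.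
have : normc ((ceval p z - F z) * (ceval q z - G z)) <= d.
  by rewrite Normc.normcM -[leRHS]mulr1 ler_pM ?normc_ge0// (le_trans h2).
have : normc (F z * (ceval q z - G z)) <= M * d by rewrite Normc.normcM ler_pM ?normc_ge0.
have : normc ((ceval p z - F z) * G z) <= d * N by rewrite Normc.normcM ler_pM ?normc_ge0.
have := le_normcD (F z * (ceval q z - G z)) ((ceval p z - F z) * G z).
by lra.
Qed.

Lemma disc_approx_exp F k : disc_approx F -> disc_approx (fun z => F z ^+ k).
Proof.
move=> aF; elim: k => [|k IH].
  by move=> e e0; exists 1%:P => z _; rewrite cevalC expr0 subrr Normc.normc0 ltW.
move=> e e0; have [p hp] := disc_approx_mul aF IH e0.
by exists p => z z1; rewrite exprS; exact: hp.
Qed.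

(** The power $(1 + p/N)^N$ of [cexp_limit] is itself a polynomial. *)
Lemma disc_approx_cexp p : disc_approx (fun z => cexp (ceval p z)).
Proof.
move=> e e0; have [N hN] := cexp_limit (coef_norm p) e0.
exists ((1 + p * (N%:R^-1)%:P) ^+ N) => z z1.
have := hN _ (ceval_bound p z1).
by rewrite cevalXn cevalD cevalM !cevalC fmorphV/= rmorph_nat.
Qed.

Lemma expr_small (x e : R) : 0 <= x < 1 -> 0 < e ->
  exists N : nat, forall n, (N <= n)%N -> x ^+ n <= e.
Proof.
move=> /andP[x0 x1] e0.
have /cvgrPdist_le/(_ e e0) : (x ^+ n) @[n --> \oo] --> (0 : R).
  by apply: cvg_expr; rewrite ger0_norm.
move=> [N _ hN]; exists N => n Nn.
by have := hN n Nn; rewrite sub0r normrN ger0_norm// exprn_ge0.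
Qed.

Lemma disc_approx_inv a : `|a| < 1 -> disc_approx (fun z => (1 - a%:C * z)^-1).
Proof.
move=> a1 e e0; have a0 := normr_ge0 a.
have d0 : 0 < 1 - `|a| by rewrite subr_gt0.
have a01 : 0 <= `|a| < 1 by rewrite a0.
have [N hN] := expr_small a01 (mulr_gt0 e0 d0).
exists (\sum_(i < N) (a%:P * 'X) ^+ i) => z z1; rewrite ceval_sum.
have -> : \sum_(i < N) ceval ((a%:P * 'X) ^+ i) z = \sum_(i < N) (a%:C * z) ^+ i.
  by apply: eq_bigr => i _; rewrite cevalXn cevalM cevalC cevalX.
set y := a%:C * z.
have hy : normc y <= `|a| by rewrite Normc.normcM normcR ler_piMr.
have h1 : 1 - `|a| <= normc (1 - y).
  rewrite lerBlDr -[X in X <= _](Normc.normc1 R) -{1}(subrK y 1).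
  by rewrite (le_trans (le_normcD _ _))// lerD2l.
have y1 : 1 - y != 0 by rewrite -normc_eq0 gt_eqF// (lt_le_trans d0).
have -> : \sum_(i < N) y ^+ i - (1 - y)^-1 = - (y ^+ N / (1 - y)).
  apply: (mulIf y1); rewrite mulrBl mulNr divfK// mulVf//.
  have -> : y ^+ N = 1 + (y - 1) * \sum_(i < N) y ^+ i by rewrite -subrX1; ring.
  by ring.
rewrite normcN Normc.normcM Normc.normcV normcX ler_pdivrMr ?(lt_le_trans d0)//.
rewrite (le_trans (lerXn2r N _ _ hy))// ?nnegrE ?normc_ge0//.
by rewrite (le_trans (hN N (leqnn N)))// ler_pM2l.
Qed.

Lemma disc_approx_sqr F : disc_approx F -> disc_approx (fun z => F (z ^+ 2)).
Proof.
move=> aF e e0; have [p hp] := aF e e0.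
exists (p \Po 'X^2) => z z1.
have -> : ceval (p \Po 'X^2) z = ceval p (z ^+ 2).
  by rewrite /ceval map_comp_poly horner_comp map_polyXn hornerXn.
by apply: hp; rewrite normcX exprn_ile1// normc_ge0.
Qed.

(** Correcting the constant term costs no more than the error at 0. An exact value is required
    because $g_0 = 1$ is what makes [trial] monic. *)
Lemma disc_approx_coef0 F x e : disc_approx F -> F 0 = x%:C -> 0 < e ->
  exists2 p : {poly R}, p`_0 = x & forall z, normc z <= 1 -> normc (ceval p z - F z) <= e.
Proof.
move=> aF F0 e0; have [p hp] := aF _ (divr_gt0 e0 (ltr0n R 2)).
have p0 : ceval p 0 = (p`_0)%:C by rewrite (ceval_real p 0) horner_coef0.
exists (p + (x - p`_0)%:P); first by rewrite coefD coefC/= addrC subrK.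
move=> z z1; rewrite cevalD cevalC rmorphB/= -F0 -p0.
have -> : ceval p z + (F 0 - ceval p 0) - F z = (ceval p z - F z) - (ceval p 0 - F 0) by ring.
rewrite (le_trans (le_normcB _ _))// [e]splitr lerD// hp//.
by rewrite Normc.normc0.
Qed.

End disc_approximation.

(** * Polynomials with nearly vanishing defect *)

Section approximants.
Context {R : realType}.
Implicit Types (z : R[i]) (a c e r s t x m M : R) (p g H T : {poly R}) (h f : R -> R).

(** Multiplication by $\cos t$ averages the two shifts of the coefficients; on [T * 'X + u] it gives
    $(T z^2 + T)/2 + u z$, which is again a polynomial. *)
Lemma horner_cos_pc c r p : exists T, forall t, p.[c + 2 * r * cos t] = pc T t.
Proof.
elim/poly_ind: p => [|p k [T hT]].
  by exists 0 => t; rewrite horner0 -polyC0 pcC.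
have [T1 hT1] : exists T1, forall t, cos t * pc T t = pc T1 t.
  elim/poly_ind: T {hT} => [|T u _].
    by exists 0 => t; rewrite -polyC0 pcC mulr0.
  exists ((2^-1)%:P * (T * 'X^2 + T) + u%:P * 'X) => t.
  have := pcXn 1 t; have := psXn 1 t; rewrite !mul1r => hs hc.
  have := pcXn 2 t; have := psXn 2 t.
  rewrite !mulr_natl cos_mulr2n sin_mulr2n => hs2 hc2.
  rewrite !pcD !pcM pcD pcM !pcC !psC !mul0r !subr0 hs hc hs2 hc2.
  by field.
exists (c%:P * T + (2 * r)%:P * T1 + k%:P) => t.
rewrite hornerMXaddC hT !pcD !pcM !pcC !psC !mul0r !subr0 -hT1; ring.
Qed.

(* [s < 1] regularizes [4 sin^2 t = |1 - z^2|^2], which vanishes at the ends,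
   to the positive [|1 - s z^2|^2]. *)
Definition qs s t : R := (1 - s) ^+ 2 + 4 * s * sin t ^+ 2.

Lemma qsE s t : qs s t = normc (1 - s%:C * ecirc t ^+ 2) ^+ 2.
Proof.
rewrite ecircX sqr_normcE /= mulr_natl cos_mulr2n sin_mulr2n /qs !mul0r.
have -> : (1 - (s * (cos t ^+ 2 *+ 2 - 1) - 0)) ^+ 2 +
  (0 - (s * ((cos t * sin t) *+ 2) + 0)) ^+ 2 =
  (1 + s - 2 * s * cos t ^+ 2) ^+ 2 + 4 * s ^+ 2 * cos t ^+ 2 * sin t ^+ 2 by ring.
by rewrite cos2sin2; ring.
Qed.

Lemma qs_gt0 s t : 0 < s < 1 -> 0 < qs s t.
Proof.
move=> /andP[s0 s1]; rewrite /qs ltr_pwDl ?exprn_gt0 ?subr_gt0//.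
by rewrite mulr_ge0 ?sqr_ge0// mulr_ge0// ltW.
Qed.

Lemma qs_le4 s t : 0 < s < 1 -> qs s t <= 4.
Proof.
move=> /andP[s0 s1]; rewrite /qs; have := sin_le1 t; have := sin_geN1 t => h1 h2.
have : sin t ^+ 2 <= 1 by nra.
move: (sin t ^+ 2) => y hy; nra.
Qed.

Lemma sin_le_qs s t : 0 < s < 1 -> ((1 + s) * sin t) ^+ 2 <= qs s t.
Proof.
move=> /andP[s0 s1]; rewrite /qs -subr_ge0.
have -> : (1 - s) ^+ 2 + 4 * s * sin t ^+ 2 - ((1 + s) * sin t) ^+ 2 = ((1 - s) * cos t) ^+ 2.
  by rewrite [RHS]exprMn cos2sin2; ring.
exact: sqr_ge0.
Qed.

Lemma exists_log_approx h m c r s e : contR h -> 0 < m -> (forall x, m <= h x) -> 0 < r ->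
  0 < s < 1 -> 0 < e ->
  exists T, forall t, `|2 * pc T t - (ln (h (c + 2 * r * cos t)) + 2^-1 * ln (qs s t))| <= e.
Proof.
move=> ch m0 mh r0 s01 e0; have /andP[s0 s1] := s01.
have r20 : 0 < 2 * r by rewrite mulr_gt0.
(* This is [qs s] as a function of $x$, through $\sin^2 t = 1 - \cos^2 t$. The absolute value keeps
   it positive beyond the segment, so its logarithm is continuous on the whole line. *)
pose Y x := (1 - s) ^+ 2 + 4 * s * `|1 - ((x - c) / (2 * r)) ^+ 2|.
have Y0 x : 0 < Y x.
  rewrite /Y ltr_pwDl ?exprn_gt0 ?subr_gt0//.
  by rewrite mulr_ge0// mulr_ge0// ltW.
have cY : contR Y by rewrite /Y; cont.
have h0 x : 0 < h x by exact: lt_le_trans (mh x).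
have cl1 := cont_ln h0 ch; have cl2 := cont_ln Y0 cY.
have cF : contR (fun x => ln (h x) + 2^-1 * ln (Y x)) by cont.
have lt1 : c - 2 * r < c + 2 * r by lra.
have [p hp] := weierstrass lt1 cF e0.
have [T hT] := horner_cos_pc c r p.
exists ((2^-1)%:P * T) => t; rewrite pcM pcC psC mul0r subr0 mulrA divff ?mul1r ?pnatr_eq0// -hT.
have -> : qs s t = Y (c + 2 * r * cos t).
  rewrite /Y /qs (_ : (c + 2 * r * cos t - c) / (2 * r) = cos t); last first.
    by rewrite addrAC subrr add0r mulrC mulKf// gt_eqF.
  by rewrite -sin2cos2 ger0_norm// sqr_ge0.
apply: hp; have := cos_le1 t; have := cos_geN1 t => h1 h2.
by apply/andP; split; nra.
Qed.

(* [H] approximates a multiple of [e^T (1 - a0 z)^k / (1 - s z^2)], so that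
   [|g|^2 fi] and [|H|^2 / fi] nearly agree and are nearly constant. *)
Lemma exists_approximants h m M c r a0 k (C0 t0 : R) : contR h -> 0 < m ->
  (forall x, m <= h x <= M) -> 0 < r -> `|a0| < 1 -> 0 < C0 -> 0 < t0 <= 2^-1 ->
  let fi t := C0 * (pn (1 - a0%:P * 'X) t) ^+ k * h (c + 2 * r * cos t) in
  exists s T g H, [/\ 0 < s < 1, 1 - s <= t0,
    forall t, `|2 * pc T t - (ln (h (c + 2 * r * cos t)) + 2^-1 * ln (qs s t))| <= t0,
    g`_0 = 1 & [/\
    forall z, normc z <= 1 ->
      normc (ceval g z - (expR T`_0)%:C * cexp (- ceval T z) * (1 - a0%:C * z)^-1 ^+ k) <= t0,
    0 <= H`_0 <= C0 * (6 * M) &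
    Iab 0 pi (fun t => fi t * pn g t * sin t + pn H t / fi t * sin t) <=
      pi * H`_0 * (2 * expR t0 / (1 + s)) + t0]].
Proof.
move=> ch m0 hm r0 a01 C00 /andP[t00 t02] fi.
pose s := 1 - t0.
have s01 : 0 < s < 1 by rewrite /s; apply/andP; split; lra.
have /andP[s0 s1] := s01.
have mh x : m <= h x by have /andP[] := hm x.
have h0 x : 0 < h x by exact: lt_le_trans (mh x).
have M0 : 0 < M by have /andP[h1 h2] := hm 0; rewrite (lt_le_trans m0)// (le_trans h1).
have [T hT] := exists_log_approx c ch m0 mh r0 s01 t00.
pose E := expR T`_0; have E0 : 0 < E by exact: expR_gt0.
have aI : disc_approx (fun z => (1 - a0%:C * z)^-1) by exact: disc_approx_inv.
have aS : disc_approx (fun z => (1 - s%:C * z ^+ 2)^-1).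
  by apply: (disc_approx_sqr (F := fun z => (1 - s%:C * z)^-1)); apply: disc_approx_inv; rewrite gtr0_norm.
(* The ideal [g] and [H]. The constant [E] normalizes [G 0] to 1, and the product [G z * K z] is the
   constant [C0 * E ^+ 2] over $1 - s z^2$. *)
pose G z := E%:C * cexp (- ceval T z) * (1 - a0%:C * z)^-1 ^+ k.
pose K z := (C0 * E)%:C * cexp (ceval T z) * ceval (1 - a0%:P * 'X) z ^+ k * (1 - s%:C * z ^+ 2)^-1.
have aC (x : R) : disc_approx (fun=> x%:C).
  by move=> e e0; exists x%:P => z _; rewrite cevalC subrr Normc.normc0 ltW.
have aG : disc_approx G.
  apply: disc_approx_mul; last exact: disc_approx_exp.
  apply: disc_approx_mul => //.
  have := disc_approx_cexp (- T); rewrite (_ : (fun z => cexp (ceval (- T) z)) = fun z => cexp (- ceval T z))//.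
  by apply/funext => z; rewrite /ceval rmorphN hornerN.
have aK : disc_approx K.
  apply: disc_approx_mul => //; apply: disc_approx_mul; last exact/disc_approx_exp/disc_approx_poly.
  by apply: disc_approx_mul => //; exact: disc_approx_cexp.
have T00 : ceval T 0 = (T`_0)%:C by rewrite (ceval_real T 0) horner_coef0.
have G0 : G 0 = 1%:C.
  rewrite /G mulr0 subr0 invr1 expr1n mulr1 T00 -rmorphN cexp_real -rmorphM /E.
  by rewrite expRxMexpNx_1.
have K0 : K 0 = (C0 * E ^+ 2)%:C.
  rewrite /K cevalB cevalM !cevalC cevalX expr0n !mulr0 subr0 invr1 mulr1 expr1n mulr1.
  by rewrite T00 cexp_real -rmorphM/= -mulrA.
have [BG BG0 hBG] := disc_approx_bounded aG.
have [BK BK0 hBK] := disc_approx_bounded aK.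
have cpc p := @cont_pc R p; have cpn p := @cont_pn R p.
have cfi : contR fi.
  have c1 := cpn (1 - a0%:P * 'X).
  have c2 : contR (fun t => h (c + 2 * r * cos t)) by apply: (cont_comp ch); cont.
  by rewrite /fi; cont.
have n1 t : normc (ecirc t) <= 1 by rewrite ecirc_norm.
have dz z : normc z <= 1 -> 1 - a0%:C * z != 0.
  move=> z1; rewrite subr_eq0; apply: contraL a01 => /eqP e; rewrite -leNgt.
  have := Normc.normc1 R; rewrite e Normc.normcM normcR => <-.
  by rewrite ler_piMr.
have pnz t : 0 < pn (1 - a0%:P * 'X) t.
  rewrite pnE exprn_gt0// lt_neqAle normc_ge0 andbT eq_sym normc_eq0.
  by rewrite cevalB cevalM !cevalC cevalX dz.
have fi0 t : 0 < fi t by rewrite /fi !mulr_gt0// exprn_gt0.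
have cfV : contR (fun t => (fi t)^-1) by apply: contV => // t; rewrite gt_eqF.
have [F1 F10 hF1] := bounded_segment 0 pi cfi.
have [F2 F20 hF2] := bounded_segment 0 pi cfV.
(* The cost over $[0, \pi]$, per unit of error, of replacing [G] and [K] by polynomials within
   [e <= 1]; it dictates the choice of [e]. *)
pose L := pi * (F1 * (2 * BG + 1) + F2 * (2 * BK + 1)).
have pi0 := pi_gt0 R.
have L0 : 0 < L.
  by rewrite mulr_gt0// addr_gt0// mulr_gt0// addr_gt0// mulr_gt0.
pose e := Num.min t0 (t0 / L).
have e0 : 0 < e by rewrite lt_min t00 divr_gt0.
have et : e <= t0 by rewrite ge_min lexx.
have eL : e * L <= t0 by rewrite -ler_pdivlMr// ge_min lexx orbT.
have [g g0 hg] := disc_approx_coef0 aG G0 e0.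
have [H H0 hH] := disc_approx_coef0 aK K0 e0.
have e1 : e <= 1 by rewrite (le_trans et)// (le_trans t02)//; lra.
have sqle (u v : R[i]) B : normc v <= B -> normc (u - v) <= e ->
    normc u ^+ 2 <= normc v ^+ 2 + (2 * B + 1) * e.
  move=> hv huv; have := le_normcD (u - v) v; rewrite subrK.
  have := normc_ge0 u; have := normc_ge0 v; have := normc_ge0 (u - v).
  move: (normc u) (normc v) (normc (u - v)) hv huv => U V W hv huv W0 V0 U0 hU.
  have : U <= V + e by lra.
  move=> hU'; have : U ^+ 2 <= (V + e) ^+ 2 by rewrite lerXn2r// nnegrE addr_ge0// ltW.
  have : V * e <= B * e by rewrite ler_wpM2r// ltW.
  have : e * e <= e by rewrite ler_piMl// ltW.
  move: (U ^+ 2) => U2; nra.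
exists s, T, g, H; split => //.
- by rewrite /s; lra.
split.
- by move=> z z1; rewrite (le_trans (hg z z1)).
- rewrite H0 mulr_ge0 ?sqr_ge0 ?(ltW C00)//= ler_pM2l//.
  (* The mean of [2 * pc T] is twice the constant coefficient of [T]. The term [ln 2] is half the
     logarithm of the bound 4 on [qs]; after exponentiation the factor 6 is $2 \cdot 3$ with
     $e^{t_0} \le 3$. *)
  have : pi * (2 * T`_0) <= pi * (ln M + ln 2 + t0).
    rewrite mulrCA -J_pc -IabZ; last by apply: cont_intble; exact: cpc.
    rewrite [leRHS]mulrC -[in leRHS](subr0 pi) -Iab_cst ?pi_ge0//.
    apply: Iab_le.
    + by apply: cont_intble; have := cpc T => ?; cont.
    + by apply: cont_intble; cont.
    move=> t _; have := hT t; rewrite ler_norml => /andP[_ ht].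
    have : ln (h (c + 2 * r * cos t)) <= ln M.
      by rewrite ler_ln ?posrE//; have /andP[] := hm (c + 2 * r * cos t).
    have : ln (qs s t) <= ln (2 ^+ 2).
      rewrite ler_ln ?posrE ?qs_gt0 ?exprn_gt0// (le_trans (qs_le4 _ s01))//.
      by rewrite -natrX.
    rewrite lnXn//; move: (ln _) (ln _) (ln _) (ln _) ht => x1 x2 x3 x4; lra.
  rewrite ler_pM2l// => hT0.
  rewrite /E -expRM_natl (@le_trans _ _ (expR (ln M + ln 2 + t0)))// ?ler_expR//.
  rewrite !expRD !lnK ?posrE//.
  have : expR t0 <= 3.
    have /expR_taylor/andP[_ h1] : `|t0| <= 1 / 2 by rewrite (ger0_norm (ltW t00)); lra.
    move: (expR t0) h1 => y; nra.
  move=> h3; rewrite (_ : 6 * M = M * 2 * 3); last by ring.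
  by rewrite ler_pM2l// mulr_gt0.
(* A common bound for the two halves of the integrand formed with [G] and [K]. Up to [expR t0] both
   are [C0 * E ^+ 2] times $\sin t / \sqrt{q_s}$, where $q_s$ is [qs s t], and this quotient is at
   most $1/(1 + s)$. As [t0] tends to 0 the ratio of [2 * Z] to $H_0$ tends to 1, so the defect
   closes. *)
pose Z := C0 * E ^+ 2 * expR t0 / (1 + s).
have Z0 : 0 <= Z.
  by rewrite divr_ge0 ?mulr_ge0 ?expR_ge0 ?sqr_ge0// ?ltW// addr_gt0.
have c1s : 0 < 1 + s by rewrite addr_gt0.
have main t : 0 <= t <= pi -> fi t * normc (G (ecirc t)) ^+ 2 * sin t <= Z /\
   normc (K (ecirc t)) ^+ 2 / fi t * sin t <= Z.
  move=> /sin_ge0_pi st.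
  set Q := Num.sqrt (qs s t).
  have q0 := qs_gt0 t s01.
  have Q0 : 0 < Q by rewrite sqrtr_gt0.
  have QE : normc (1 - s%:C * ecirc t ^+ 2) = Q.
    by apply/eqP; rewrite -(@eqrXn2 _ 2)// ?normc_ge0 ?ltW// -qsE sqr_sqrtr// ltW.
  have sQ : sin t <= Q / (1 + s).
    rewrite ler_pdivlMr// mulrC -ler_sqr ?nnegrE ?(ltW Q0) ?mulr_ge0 ?(ltW c1s)//.
    by rewrite sqr_sqrtr ?(ltW q0)//; exact: sin_le_qs.
  have lQ : 2^-1 * ln (qs s t) = ln Q.
    by rewrite -[in LHS](sqr_sqrtr (ltW q0)) -/Q lnXn// mulr2n; field.
  pose hh := h (c + 2 * r * cos t).
  have hh0 : 0 < hh by exact: h0.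
  have := hT t; rewrite -/hh lQ ler_norml => /andP[l1 l2].
  pose w := pn (1 - a0%:P * 'X) t ^+ k.
  have w0 : 0 < w by rewrite exprn_gt0.
  have pw : pn (1 - a0%:P * 'X) t = normc (1 - a0%:C * ecirc t) ^+ 2.
    by rewrite pnE cevalB cevalM !cevalC cevalX.
  have wE : normc (1 - a0%:C * ecirc t) ^+ k ^+ 2 = w by rewrite /w pw -!exprM mulnC.
  have eP : expR (2 * pc T t) <= hh * Q * expR t0.
    have -> : hh * Q = expR (ln hh + ln Q) by rewrite expRD !lnK ?posrE.
    by rewrite -expRD ler_expR; lra.
  have eN : expR (- (2 * pc T t)) <= (hh * Q)^-1 * expR t0.
    have -> : (hh * Q)^-1 = expR (- (ln hh + ln Q)) by rewrite expRN expRD !lnK ?posrE.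
    by rewrite -expRD ler_expR; lra.
  split.
    rewrite /G !Normc.normcM normc_cexp normcR normcX Normc.normcV (gtr0_norm E0).
    have -> : Re (- ceval T (ecirc t)) = - pc T t by rewrite /pc; case: (ceval _ _).
    have -> : fi t * (E * expR (- pc T t) * (normc (1 - a0%:C * ecirc t))^-1 ^+ k) ^+ 2 * sin t =
       C0 * E ^+ 2 * (hh * expR (- (2 * pc T t))) * sin t.
      rewrite /fi -/w -/hh exprVn !exprMn exprVn wE -[expR (- pc T t) ^+ 2]expRM_natl mulrN.
      by field; rewrite gt_eqF.
    apply: (@le_trans _ _ (C0 * E ^+ 2 * (Q^-1 * expR t0) * (Q / (1 + s)))).
      apply: ler_pM => //.
        by rewrite !mulr_ge0 ?expR_ge0 ?sqr_ge0// ltW.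
      have CE : 0 <= C0 * E ^+ 2 by rewrite mulr_ge0 ?sqr_ge0 ?(ltW C00).
      apply: ler_wpM2l => //.
      rewrite (_ : Q^-1 * expR t0 = hh * ((hh * Q)^-1 * expR t0)); first by rewrite ler_wpM2l// ltW.
      by field; rewrite !gt_eqF.
    by rewrite /Z le_eqVlt; apply/orP; left; apply/eqP; field; rewrite !gt_eqF.
  rewrite /K !Normc.normcM normc_cexp normcR normcX Normc.normcV (gtr0_norm (mulr_gt0 C00 E0)) QE.
  rewrite cevalB cevalM !cevalC cevalX -/(pc T t).
  have -> : (C0 * E * expR (pc T t) * normc (1%:C - a0%:C * ecirc t) ^+ k / Q) ^+ 2 / fi t * sin t =
     C0 * E ^+ 2 * (expR (2 * pc T t) / (hh * Q)) / Q * sin t.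
    rewrite /fi -/w -/hh !exprMn exprVn wE -[expR (pc T t) ^+ 2]expRM_natl.
    by field; rewrite !gt_eqF.
  apply: (@le_trans _ _ (C0 * E ^+ 2 * (expR t0) / Q * (Q / (1 + s)))).
    apply: ler_pM => //.
      by rewrite !mulr_ge0 ?invr_ge0 ?mulr_ge0 ?expR_ge0 ?sqr_ge0// ltW.
    apply: ler_wpM2r; first by rewrite invr_ge0 ltW.
    apply: ler_wpM2l; first by rewrite mulr_ge0 ?sqr_ge0 ?(ltW C00).
    by rewrite ler_pdivrMr ?mulr_gt0// [leRHS]mulrC.
  by rewrite /Z le_eqVlt; apply/orP; left; apply/eqP; field; rewrite !gt_eqF.
have bound t : 0 <= t <= pi -> fi t * pn g t * sin t + pn H t / fi t * sin t <=
   2 * Z + (F1 * (2 * BG + 1) + F2 * (2 * BK + 1)) * e.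
  move=> t0pi; have [m1 m2] := main t t0pi.
  have st := sin_ge0_pi t0pi; have st1 := sin_le1 t.
  have g1 := sqle _ _ _ (hBG _ (n1 t)) (hg _ (n1 t)).
  have g2 := sqle _ _ _ (hBK _ (n1 t)) (hH _ (n1 t)).
  rewrite !pnE.
  have f1 : fi t <= F1 by rewrite (le_trans (ler_norm _))// hF1.
  have f2 : (fi t)^-1 <= F2 by rewrite (le_trans (ler_norm _))// hF2.
  have fV0 : 0 < (fi t)^-1 by rewrite invr_gt0.
  have BGe : 0 <= (2 * BG + 1) * e by rewrite mulr_ge0 ?addr_ge0 ?mulr_ge0 ?(ltW BG0) ?(ltW e0).
  have BKe : 0 <= (2 * BK + 1) * e by rewrite mulr_ge0 ?addr_ge0 ?mulr_ge0 ?(ltW BK0) ?(ltW e0).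
  have a1 : fi t * normc (ceval g (ecirc t)) ^+ 2 * sin t <= Z + F1 * ((2 * BG + 1) * e).
    apply: (@le_trans _ _ (fi t * normc (G (ecirc t)) ^+ 2 * sin t + fi t * ((2 * BG + 1) * e) * sin t)).
      by rewrite -mulrDl -mulrDr ler_wpM2r// ler_wpM2l// ltW.
    apply: lerD => //; rewrite -[leRHS]mulr1; apply: ler_pM => //.
      by rewrite mulr_ge0// ltW.
    by rewrite ler_wpM2r.
  have a2 : normc (ceval H (ecirc t)) ^+ 2 / fi t * sin t <= Z + F2 * ((2 * BK + 1) * e).
    apply: (@le_trans _ _ (normc (K (ecirc t)) ^+ 2 / fi t * sin t + ((2 * BK + 1) * e) / fi t * sin t)).
      by rewrite -mulrDl -mulrDl ler_wpM2r// ler_wpM2r// ltW.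
    apply: lerD => //; rewrite -[leRHS]mulr1; apply: ler_pM => //.
      by rewrite mulr_ge0// ltW.
    by rewrite [leRHS]mulrC ler_wpM2l.
  have := lerD a1 a2; rewrite (_ : Z + _ + _ = 2 * Z + (F1 * (2 * BG + 1) + F2 * (2 * BK + 1)) * e) //; ring.
apply: (@le_trans _ _ ((2 * Z + (F1 * (2 * BG + 1) + F2 * (2 * BK + 1)) * e) * (pi - 0))).
  rewrite -Iab_cst ?pi_ge0//; apply: Iab_le => //.
  - by apply: cont_intble; have := cpn g; have := cpn H => ? ?; cont.
  - by apply: cont_intble; cont.
rewrite subr0 mulrDl H0; apply: lerD.
  by rewrite /Z le_eqVlt; apply/orP; left; apply/eqP; field; rewrite !gt_eqF.
by apply: le_trans eL; rewrite /L le_eqVlt; apply/orP; left; apply/eqP; ring.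
Qed.

End approximants.

Section small_defect.
Context {R : realType}.
Implicit Types (z : R[i]) (m M c r : R) (g H T : {poly R}) (h f : R -> R).

(** The pair [g], [H] is built for the model weight [fi] and serves every [f] within the factor
    [1 + d] of it: one inequality controls the term with [g], the other the term with [1 / f]. *)
Lemma exists_small_defect h m M c r (a0 : R) k (C0 e : R) : contR h -> 0 < m ->
  (forall x, m <= h x <= M) -> 0 < r -> `|a0| < 1 -> 0 < C0 -> 0 < e ->
  let fi t := C0 * (pn (1 - a0%:P * 'X) t) ^+ k * h (c + 2 * r * cos t) in
  exists s T g H (d : R), [/\ 0 < s < 1, 1 - s <= e,
    forall t, `|2 * pc T t - (ln (h (c + 2 * r * cos t)) + 2^-1 * ln (qs s t))| <= e,
    g`_0 = 1 & [/\
    forall z, normc z <= 1 ->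
      normc (ceval g z - (expR T`_0)%:C * cexp (- ceval T z) * (1 - a0%:C * z)^-1 ^+ k) <= e,
    0 < d &
    forall f, contR f -> (forall t, 0 < f t) ->
      (forall t, f t <= (1 + d) * fi t /\ fi t <= (1 + d) * f t) -> core_defect f g H <= e]].
Proof.
move=> ch m0 hm r0 a01 C00 e0 fi.
have M0 : 0 < M by have /andP[h1 h2] := hm 0; rewrite (lt_le_trans m0)// (le_trans h1).
have pi0 := pi_gt0 R.
pose B := pi * (C0 * (6 * M)).
have B0 : 0 < B by rewrite !mulr_gt0.
(* [B] bounds $\pi H_0$. For $t_0 \le 1/2$ the accumulated factor $(1 + t_0)^2 (1 + 2 t_0)$ is at
   most $1 + 10 t_0$, and the additive error at most $2 t_0$; hence [10 * B + 2]. *)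
pose t0 := Num.min (2^-1) (Num.min e (e / (10 * B + 2))).
have BB : 0 < 10 * B + 2 by rewrite addr_gt0// mulr_gt0.
have t00 : 0 < t0 by rewrite !lt_min invr_gt0 ltr0n e0 divr_gt0.
have t02 : t0 <= 2^-1 by rewrite ge_min lexx.
have te : t0 <= e by rewrite !ge_min lexx orbT.
have tB : t0 * (10 * B + 2) <= e by rewrite -ler_pdivlMr// !ge_min lexx !orbT.
have t0_bds : 0 < t0 <= 2^-1 by rewrite t00.
have [s [T [g [H [s01 st hT g0 [hg /andP[H0 HM] hI]]]]]] :=
  @exists_approximants R h m M c r a0 k C0 t0 ch m0 hm r0 a01 C00 t0_bds.
exists s, T, g, H, t0; split => //.
- exact: le_trans te.
- by move=> t; exact: le_trans te.
split => //; first by move=> z z1; rewrite (le_trans (hg z z1)).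
move=> f cf f0 hf; rewrite /core_defect.
have cpc p := @cont_pc R p; have cpn p := @cont_pn R p.
have cg := cpn g; have cH := cpn H.
have cfi : contR fi.
  have c1 := cpn (1 - a0%:P * 'X).
  have c2 : contR (fun t => h (c + 2 * r * cos t)) by apply: (cont_comp ch); cont.
  by rewrite /fi; cont.
have d1 : 0 < 1 + t0 by rewrite addr_gt0.
have fi0 t : 0 < fi t.
  by have [h1 _] := hf t; have := lt_le_trans (f0 t) h1; rewrite pmulr_rgt0.
have cV : contR (fun t => (f t)^-1) by apply: contV => // t; rewrite gt_eqF.
have cfV : contR (fun t => (fi t)^-1) by apply: contV => // t; rewrite gt_eqF.
have hle : Iab 0 pi (fun t => f t * pn g t * sin t + pn H t / f t * sin t) <=
   (1 + t0) * Iab 0 pi (fun t => fi t * pn g t * sin t + pn H t / fi t * sin t).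
  rewrite -IabZ; last by apply: cont_intble; cont.
  apply: Iab_le; try by apply: cont_intble; cont.
  move=> t /sin_ge0_pi s0; have [h1 h2] := hf t.
  have p1 := pn_ge0 g t; have p2 := pn_ge0 H t.
  rewrite [leRHS]mulrDr; apply: lerD.
    have -> : (1 + t0) * (fi t * pn g t * sin t) = (1 + t0) * fi t * pn g t * sin t by ring.
    by apply: ler_wpM2r => //; apply: ler_wpM2r.
  have -> : (1 + t0) * (pn H t / fi t * sin t) = pn H t * ((1 + t0) / fi t) * sin t by ring.
  apply: ler_wpM2r => //; apply: ler_wpM2l => //.
  by rewrite ler_pdivlMr// mulrC ler_pdivrMr.
have : (1 + t0) * Iab 0 pi (fun t => fi t * pn g t * sin t + pn H t / fi t * sin t) <=
   (1 + t0) * (pi * H`_0 * (2 * expR t0 / (1 + s)) + t0) by rewrite ler_pM2l.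
have s1 : 2 / (1 + s) <= 1 + t0.
  by move: s01 => /andP[? ?]; rewrite ler_pdivrMr; [nra|lra].
have hE : expR t0 <= 1 + 2 * t0.
  have /expR_taylor/andP[_ h1] : `|t0| <= 1 / 2 by rewrite (ger0_norm (ltW t00)); lra.
  move: (expR t0) h1 => y; nra.
have hy : 2 * expR t0 / (1 + s) <= (1 + t0) * (1 + 2 * t0).
  rewrite mulrAC; apply: ler_pM => //; rewrite ?expR_ge0// divr_ge0//.
  by move: s01 => /andP[? ?]; lra.
have pH0 : 0 <= pi * H`_0 by rewrite mulr_ge0// ltW.
have pHB : pi * H`_0 <= B by rewrite ler_pM2l.
move: hle; move: (Iab _ _ _) (Iab _ _ _) => I1 I2.
have := ler_wpM2l pH0 hy; move: (2 * expR t0 / _) => Y.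
move: (pi * H`_0) pH0 pHB => P P0 PB hY hI1 hI2.
have h3 : (1 + t0) * (P * Y + t0) <= (1 + t0) * (P * ((1 + t0) * (1 + 2 * t0)) + t0).
  by rewrite ler_pM2l// lerD2r.
have h4 : (1 + t0) * ((1 + t0) * (1 + 2 * t0)) <= 1 + 10 * t0 by nra.
have h5 := ler_wpM2l P0 h4.
have h6 : P * t0 <= B * t0 by rewrite ler_wpM2r// ltW.
have h7 : (1 + t0) * t0 <= 2 * t0 by nra.
by move: hI1 hI2 h3 h5 h6 h7 tB; clear; nra.
Qed.

End small_defect.

(** * The cosine substitution *)

Section substitution.
Context {R : realType}.
Implicit Types (u : R -> R) (c r t x e : R).

Lemma cos_diff c r (t0 t1 : R) : 0 < r -> 0 <= t0 -> t0 < t1 -> t1 <= pi ->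
  {in `[t0, t1] &, {homo (fun t => c + 2 * r * cos t) : x y /~ x < y}}.
Proof.
move=> r0 h0 h01 h1 x y; rewrite !in_itv/= => /andP[x0 x1] /andP[y0 y1] xy.
have xI : x \in `[0, pi] by rewrite in_itv/= (le_trans h0 x0) (le_trans x1 h1).
have yI : y \in `[0, pi] by rewrite in_itv/= (le_trans h0 y0) (le_trans y1 h1).
by rewrite ltrD2l ltr_pM2l ?mulr_gt0// ltr_cos.
Qed.

Lemma integral_subst_cos u c r (t0 t1 : R) : 0 < r -> 0 <= t0 -> t0 < t1 -> t1 <= pi ->
  {within `[c + 2 * r * cos t1, c + 2 * r * cos t0], continuous u} ->
  (\int[leb]_(x in `[(c + 2 * r * cos t1)%R, (c + 2 * r * cos t0)%R]) (u x)%:E =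
  \int[leb]_(t in `[t0, t1]) (u (c + 2 * r * cos t) * (2 * r * sin t))%:E)%E.
Proof.
move=> r0 h0 h01 h1 cu.
pose F t : R := c + 2 * r * cos t.
have dF (t : R) : is_derive t 1 F (- (2 * r * sin t)).
  by apply: is_derive_eq; rewrite /GRing.scale/=; ring.
have F'E : F^`()%classic = (fun t => - (2 * r * sin t)).
  by apply/funext => t; rewrite derive1E; apply: derive_val.
have cF : contR F by rewrite /F; cont.
have cF' : contR F^`()%classic by rewrite F'E; cont.
rewrite (@integration_by_substitution_decreasing _ F).
- apply: eq_integral => t _; congr EFin; rewrite -[LHS]/(u (F t) * - F^`()%classic t) F'E opprK//.
- exact: ltW.
- exact: cos_diff.
- by move=> x _; exact: cF'.
- by apply/cvg_ex; exists (F^`()%classic t0); apply/cvg_at_right_filter/cF'.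
- by apply/cvg_ex; exists (F^`()%classic t1); apply/cvg_at_left_filter/cF'.
- split; first by move=> x _; case: (dF x).
  + exact/cvg_at_right_filter/cF.
  + exact/cvg_at_left_filter/cF.
- by [].
Qed.

Lemma Iab_subst u c r : 0 < r -> contR u ->
  Iab (c - 2 * r) (c + 2 * r) u = Iab 0 pi (fun t => u (c + 2 * r * cos t) * (2 * r * sin t)).
Proof.
move=> r0 cu; rewrite /Iab /Rintegral; congr fine.
have := @integral_subst_cos u c r 0 pi r0 (lexx _) (pi_gt0 R) (lexx _).
by rewrite cos0 cospi mulr1 mulrN1; apply; exact: continuous_subspaceT.
Qed.

(* The substitution is first made on [[inset n, pi - inset n]]. *)
Definition inset (n : nat) : R := n.+2%:R^-1.

Lemma inset_gt0 n : 0 < inset n. Proof. by rewrite invr_gt0. Qed.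

Lemma inset_lt n : inset n <= 2^-1.
Proof. by rewrite lef_pV2 ?posrE// ler_nat. Qed.

Lemma inset_le m n : (m <= n)%N -> inset n <= inset m.
Proof. by move=> mn; rewrite lef_pV2 ?posrE// ler_nat !ltnS. Qed.

Lemma inset_small e : 0 < e -> exists n, inset n < e.
Proof.
move=> e0; exists (Num.truncn e^-1).
rewrite -[ltRHS]invrK ltf_pV2 ?posrE ?invr_gt0//.
by rewrite (lt_trans (truncnS_gt _))// ltr_nat.
Qed.

Lemma pi_inset n : inset n < pi - inset n.
Proof. have := inset_lt n; have := pi_ge2 R; lra. Qed.

#[local] Hint Resolve inset_gt0 inset_lt inset_le pi_inset : core.

Lemma cvg_itv_pi (f : R -> R) : measurable_fun `]0%R, pi[ f -> (forall t, 0 < t < pi -> 0 <= f t) ->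
  (\int[leb]_(t in `[inset i, (pi - inset i)%R]) (f t)%:E @[i --> \oo] --> \int[leb]_(t in `]0%R, pi[) (f t)%:E)%E.
Proof.
move=> mf f0.
have sub i : `[inset i, pi - inset i] `<=` `]0, pi[%classic.
  move=> t /=; rewrite !in_itv/= => /andP[t0 t1].
  by rewrite (lt_le_trans (inset_gt0 i))//= (le_lt_trans t1)// ltrBlDr ltrDl inset_gt0.
have -> : `]0%R, pi[%classic = \bigcup_i `[inset i, pi - inset i]%classic.
  apply/seteqP; split => [t|t [i _]]; last exact: sub.
  rewrite /= in_itv/= => /andP[t0 t1].
  have [|n] := @inset_small (Num.min t (pi - t)); first by rewrite lt_min t0 subr_gt0.
  rewrite lt_min => /andP[h1 h2].
  by exists n => //=; rewrite in_itv/= (ltW h1)/= lerBrDr -lerBrDl ltW.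
apply: ge0_nondecreasing_set_cvg_integral => //.
- move=> m n mn; apply/subsetPset => t /=; rewrite !in_itv/= => /andP[t0 t1].
  by rewrite (le_trans (inset_le mn) t0)/= (le_trans t1)// lerB// inset_le.
- by move=> i; apply/measurable_EFinP; apply: measurable_funS mf => //; exact: sub.
- by move=> i t /sub /=; rewrite in_itv/= lee_fin; exact: f0.
Qed.

Lemma cvg_itv_cos (f : R -> R) c r : 0 < r ->
  measurable_fun `]c - 2 * r, c + 2 * r[ f -> (forall x, c - 2 * r < x < c + 2 * r -> 0 <= f x) ->
  (\int[leb]_(x in `[(c + 2 * r * cos (pi - inset i))%R, (c + 2 * r * cos (inset i))%R]) (f x)%:E @[i --> \oo]
    --> \int[leb]_(x in `](c - 2 * r)%R, (c + 2 * r)%R[) (f x)%:E)%E.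
Proof.
move=> r0 mf f0.
have cN i : cos (pi - inset i) = - cos (inset i) by rewrite addrC cosDpi cosN.
have c1 i : cos (inset i) < 1.
  rewrite -cos0 ltr_cos// in_itv/= ?lexx ?pi_ge0//.
  by have := inset_gt0 i; have := pi_inset i => h1 h2; apply/andP; split; lra.
have r20 : 0 < 2 * r by rewrite mulr_gt0.
have sub i : `[c + 2 * r * cos (pi - inset i), c + 2 * r * cos (inset i)] `<=` `]c - 2 * r, c + 2 * r[%classic.
  move=> x /=; rewrite !in_itv/= cN => /andP[x0 x1]; have := c1 i => ci.
  by apply/andP; split; nra.
have -> : `]c - 2 * r, c + 2 * r[%classic = \bigcup_i `[c + 2 * r * cos (pi - inset i), c + 2 * r * cos (inset i)]%classic.
  apply/seteqP; split => [x|x [i _]]; last exact: sub.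
  rewrite /= in_itv/= => /andP[x0 x1].
  pose y := `|x - c| / (2 * r).
  have y1 : y < 1.
    by rewrite /y ltr_pdivrMr// mul1r ltr_norml; apply/andP; split; lra.
  have ccos : {for 0, continuous (@cos R)} by exact: continuous_cos.
  have /cvgrPdist_lt/(_ (1 - y)) := ccos.
  rewrite subr_gt0 => /(_ y1) /nbhs_ballP[d /= d0 hd].
  have [n hn] := inset_small d0.
  have := hd (inset n); rewrite /ball/= sub0r normrN gtr0_norm// cos0 => /(_ hn).
  rewrite ltr_norml => /andP[_ h1].
  have yc : y < cos (inset n) by lra.
  exists n => //=; rewrite in_itv/= cN.
  move: yc; rewrite /y ltr_pdivrMr// ltr_norml => /andP[h2 h3].
  by apply/andP; split; lra.
apply: ge0_nondecreasing_set_cvg_integral => //.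
- move=> m n mn; apply/subsetPset => x /=; rewrite !in_itv/= !cN => /andP[x0 x1].
  have : cos (inset m) <= cos (inset n).
    have nI i : inset i \in `[0%R, pi].
      by rewrite in_itv/=; have := inset_gt0 i; have := pi_inset i => h1 h2; apply/andP; split; lra.
    by rewrite leNgt ltr_cos// -leNgt inset_le.
  by move=> h; apply/andP; split; nra.
- by move=> i; apply/measurable_EFinP; apply: measurable_funS mf => //; exact: sub.
- by move=> i x /sub /=; rewrite in_itv/= lee_fin; exact: f0.
Qed.

(** The integrand may be unbounded at the ends, so the substitution is made on the inset segments
    and both sides pass to the limit by monotone convergence, which is where the sign is used. *)
Lemma ge0_integral_subst_open u c r : 0 < r ->
  {in `]c - 2 * r, c + 2 * r[, continuous u} ->
  (forall x, c - 2 * r < x < c + 2 * r -> 0 <= u x) ->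
  (\int[leb]_(x in `](c - 2 * r)%R, (c + 2 * r)%R[) (u x)%:E =
   \int[leb]_(t in `]0%R, pi[) (u (c + 2 * r * cos t) * (2 * r * sin t))%:E)%E.
Proof.
move=> r0 cu u0.
have r20 : 0 < 2 * r by rewrite mulr_gt0.
have cx : contR (fun t => c + 2 * r * cos t) by cont.
have cs : contR (fun t => 2 * r * sin t) by cont.
have inI t : 0 < t < pi -> c - 2 * r < c + 2 * r * cos t < c + 2 * r.
  move=> /andP[t0 t1].
  have h1 : cos t < 1 by rewrite -cos0 ltr_cos// in_itv/= ?lexx ?pi_ge0// (ltW t0) ltW.
  have h2 : -1 < cos t by rewrite -cospi ltr_cos// in_itv/= ?lexx ?pi_ge0// (ltW t0) ltW.
  by apply/andP; split; nra.
have mu : measurable_fun `]c - 2 * r, c + 2 * r[ u.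
  apply: open_continuous_measurable_fun; first exact: interval_open.
  by move=> x /set_mem /= h; apply: cu.
pose v t := u (c + 2 * r * cos t) * (2 * r * sin t).
have mv : measurable_fun `]0%R, pi[ v.
  apply: open_continuous_measurable_fun; first exact: interval_open.
  move=> t /set_mem; rewrite /= in_itv/= => ht.
  apply: (@continuousM _ _ (fun t => u (c + 2 * r * cos t)) (fun t => 2 * r * sin t)).
    apply: continuous_comp.
      exact: cx.
    by apply: cu; rewrite in_itv/= inI.
  exact: cs.
have v0 t : 0 < t < pi -> 0 <= v t.
  move=> ht; apply: mulr_ge0; first by rewrite u0// inI.
  by rewrite mulr_ge0 ?(ltW r20)// ltW// sin_gt0_pi.
have h1 := cvg_itv_cos r0 mu u0; have h2 := cvg_itv_pi mv v0.
suff e : (fun i => \int[leb]_(x in `[(c + 2 * r * cos (pi - inset i))%R, (c + 2 * r * cos (inset i))%R]) (u x)%:E)%E =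
   (fun i => \int[leb]_(t in `[inset i, (pi - inset i)%R]) (v t)%:E)%E.
  by rewrite e in h1; exact: (cvg_unique (@ereal_hausdorff R) h1 h2).
apply/funext => i.
rewrite integral_subst_cos//.
- exact: ltW.
- by rewrite gerBl ltW.
apply: continuous_in_subspaceT => x /set_mem; rewrite /= in_itv/= => /andP[x0 x1].
apply: cu; rewrite in_itv/=.
have : cos (inset i) < 1.
  rewrite -cos0 ltr_cos// in_itv/= ?lexx ?pi_ge0//.
  by have := inset_gt0 i; have := pi_inset i => h3 h4; apply/andP; split; lra.
have cN : cos (pi - inset i) = - cos (inset i) by rewrite addrC cosDpi cosN.
move: x0; rewrite cN => x0 ci.
by apply/andP; split; nra.
Qed.

(** Positive and negative parts are transported separately, as extended reals, so the identity
    persists when one of them is infinite. *)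
Lemma Rintegral_subst_open u c r : 0 < r ->
  {in `]c - 2 * r, c + 2 * r[, continuous u} ->
  \int[leb]_(x in `[c - 2 * r, c + 2 * r]) u x =
  Iab 0 pi (fun t => u (c + 2 * r * cos t) * (2 * r * sin t)).
Proof.
move=> r0 cu; rewrite /Iab /Rintegral; congr fine.
have r20 : 0 < 2 * r by rewrite mulr_gt0.
have cx : contR (fun t => c + 2 * r * cos t) by cont.
have cs : contR (fun t => 2 * r * sin t) by cont.
have mu : measurable_fun `]c - 2 * r, c + 2 * r[ u.
  apply: open_continuous_measurable_fun; first exact: interval_open.
  by move=> x /set_mem /= h; apply: cu.
have inI t : 0 < t < pi -> c - 2 * r < c + 2 * r * cos t < c + 2 * r.
  move=> /andP[t0 t1].
  have h1 : cos t < 1 by rewrite -cos0 ltr_cos// in_itv/= ?lexx ?pi_ge0// (ltW t0) ltW.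
  have h2 : -1 < cos t by rewrite -cospi ltr_cos// in_itv/= ?lexx ?pi_ge0// (ltW t0) ltW.
  by apply/andP; split; nra.
have mv : measurable_fun `]0%R, pi[ (fun t => u (c + 2 * r * cos t) * (2 * r * sin t)).
  apply: open_continuous_measurable_fun; first exact: interval_open.
  move=> t /set_mem; rewrite /= in_itv/= => ht.
  apply: (@continuousM _ _ (fun t => u (c + 2 * r * cos t)) (fun t => 2 * r * sin t)).
    apply: continuous_comp.
      exact: cx.
    by apply: cu; rewrite in_itv/= inI.
  exact: cs.
rewrite [LHS]integral_itv_bndoo; last by apply/measurable_EFinP; exact: mu.
rewrite [RHS]integral_itv_bndoo; last by apply/measurable_EFinP; exact: mv.
pose up x := Num.max (u x) 0; pose um x := Num.max (- u x) 0.
have cup : {in `]c - 2 * r, c + 2 * r[, continuous up}.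
  by move=> x hx; apply: (@continuous_max _ _ u (fun=> 0)); [exact: cu|exact: cvg_cst].
have cum : {in `]c - 2 * r, c + 2 * r[, continuous um}.
  by move=> x hx; apply: (@continuous_max _ _ (fun x => - u x) (fun=> 0)); [apply: continuousN; exact: cu|exact: cvg_cst].
rewrite integralE [RHS]integralE; congr (_ - _)%E.
  transitivity (\int[leb]_(x in `](c - 2 * r)%R, (c + 2 * r)%R[) (up x)%:E)%E.
    by apply: eq_integral => x _; rewrite funeposE -EFin_max.
  rewrite ge0_integral_subst_open//; last by move=> x _; rewrite le_max lexx orbT.
  apply: eq_integral => t /set_mem; rewrite /= in_itv/= => ht.
  rewrite funeposE -EFin_max; congr EFin.
  have s0 : 0 <= 2 * r * sin t by rewrite mulr_ge0 ?(ltW r20)// ltW// sin_gt0_pi.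
  by rewrite /up maxr_pMl// mul0r.
transitivity (\int[leb]_(x in `](c - 2 * r)%R, (c + 2 * r)%R[) (um x)%:E)%E.
  by apply: eq_integral => x _; rewrite funenegE -EFinN -EFin_max.
rewrite ge0_integral_subst_open//; last by move=> x _; rewrite le_max lexx orbT.
apply: eq_integral => t /set_mem; rewrite /= in_itv/= => ht.
rewrite funenegE -EFinN -EFin_max; congr EFin.
have s0 : 0 <= 2 * r * sin t by rewrite mulr_ge0 ?(ltW r20)// ltW// sin_gt0_pi.
by rewrite /um maxr_pMl// mul0r mulNr.
Qed.

End substitution.

(** * An integrable majorant for logarithmic end singularities *)

Section log_sine.
Context {R : realType}.
Implicit Types (s t : R) (f g : R -> R).

Lemma catM f g t : {for t, continuous f} -> {for t, continuous g} ->
  {for t, continuous (fun t => f t * g t)}.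
Proof. exact: continuousM. Qed.

Lemma catD f g t : {for t, continuous f} -> {for t, continuous g} ->
  {for t, continuous (fun t => f t + g t)}.
Proof. exact: continuousD. Qed.

Lemma catV f t : f t != 0 -> {for t, continuous f} -> {for t, continuous (fun t => (f t)^-1)}.
Proof. exact: continuousV. Qed.

Lemma catC f g t : {for t, continuous g} -> {for g t, continuous f} ->
  {for t, continuous (fun t => f (g t))}.
Proof. exact: continuous_comp. Qed.

Definition contoo f := {in `]0, pi[, continuous f}.

Lemma contoo_meas f : contoo f -> measurable_fun `]0%R, pi[ f.
Proof.
move=> cf; apply: open_continuous_measurable_fun; first exact: interval_open.
by move=> x /set_mem /= h; apply: cf.
Qed.

Lemma intble_oo f : contoo f ->
  leb.-integrable `]0%R, pi[ (EFin \o f) -> intble 0 pi f.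
Proof.
move=> cf /integrableP[mf fi]; apply/integrableP; split.
  apply/measurable_EFinP; apply: (@measurable_fun_itv_cc _ _ _ false true).
  exact: contoo_meas.
by rewrite integral_itv_bndoo//; apply: measurableT_comp.
Qed.

Lemma Iab_oo f : contoo f -> Iab 0 pi f = \int[leb]_(t in `]0%R, pi[) f t.
Proof.
move=> cf; rewrite /Iab /Rintegral integral_itv_bndoo//.
by apply/measurable_EFinP; exact: contoo_meas.
Qed.

(** The universal majorant near the ends: $(\sin t)^{-1/2}$ is integrable, yet it dominates $\ln
    \sin t$ and the error made by the regularization [qs]. *)
Definition sinVh t : R := (Num.sqrt (sin t))^-1.

Lemma sinVh_ge0 t : 0 <= sinVh t.
Proof. by rewrite invr_ge0 sqrtr_ge0. Qed.

Lemma contoo_sinVh : contoo sinVh.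
Proof.
move=> t; rewrite in_itv/= => ht; apply: (@catV (fun t => Num.sqrt (sin t))).
  by rewrite gt_eqF// sqrtr_gt0; exact: sin_gt0_pi.
by apply: (@catC Num.sqrt sin); [exact: continuous_sin|exact: sqrt_continuous].
Qed.

(* [8 (sqrt (sin (t/2)) - sqrt (cos (t/2)))] is a bounded function whose
   derivative dominates [1 / sqrt (sin t)]. *)
Lemma sinVh_segment (x y : R) : 0 < x -> x < y -> y < pi ->
  (\int[leb]_(t in `[x, y]) (sinVh t)%:E <= 16%:E)%E.
Proof.
move=> x0 xy y1.
pose S t := Num.sqrt (sin (2^-1 * t)) : R; pose K t := Num.sqrt (cos (2^-1 * t)) : R.
pose G t := 8 * (S t - K t).
pose G' t := 2 * (cos (2^-1 * t) * (S t)^-1 + sin (2^-1 * t) * (K t)^-1).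
have pos t : 0 < t < pi -> 0 < sin (2^-1 * t) /\ 0 < cos (2^-1 * t).
  move=> /andP[t0 t1]; split.
    by apply: sin_gt0_pi; apply/andP; split; lra.
  by apply: cos_gt0_pihalf; apply/andP; split; lra.
have dG t : 0 < t < pi -> is_derive t 1 G (G' t).
  move=> /pos[s0 c0].
  have d1 : is_derive (sin (2^-1 * t)) 1 Num.sqrt ((2 * S t)^-1) by exact: is_derive1_sqrt.
  have d2 : is_derive (cos (2^-1 * t)) 1 Num.sqrt ((2 * K t)^-1) by exact: is_derive1_sqrt.
  have e1 : is_derive t 1 (fun t : R => sin (2^-1 * t)) (2^-1 * cos (2^-1 * t)).
    by apply: is_derive_eq; rewrite /GRing.scale/=; ring.
  have e2 : is_derive t 1 (fun t : R => cos (2^-1 * t)) (- (2^-1 * sin (2^-1 * t))).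
    by apply: is_derive_eq; rewrite /GRing.scale/=; ring.
  have f1 : is_derive t 1 S ((2 * S t)^-1 * (2^-1 * cos (2^-1 * t))).
    exact: (@is_derive1_comp _ Num.sqrt (fun t : R => sin (2^-1 * t))).
  have f2 : is_derive t 1 K ((2 * K t)^-1 * (- (2^-1 * sin (2^-1 * t)))).
    exact: (@is_derive1_comp _ Num.sqrt (fun t : R => cos (2^-1 * t))).
  rewrite /G; apply: is_derive_eq; rewrite /G' /GRing.scale/=.
  have S0 : S t != 0 by rewrite gt_eqF// sqrtr_gt0.
  have K0 : K t != 0 by rewrite gt_eqF// sqrtr_gt0.
  by field; rewrite S0 K0.
have inI t : x <= t <= y -> 0 < t < pi.
  by move=> /andP[t0 t1]; rewrite (lt_le_trans x0 t0) (le_lt_trans t1 y1).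
have cG t : 0 < t < pi -> {for t, continuous G}.
  by move=> /dG[d _]; apply/differentiable_continuous/derivable1_diffP.
have cs1 : contR (fun t : R => sin (2^-1 * t)) by cont.
have cc1 : contR (fun t : R => cos (2^-1 * t)) by cont.
have cS t : {for t, continuous S}.
  by apply: (@catC Num.sqrt (fun t : R => sin (2^-1 * t))); [exact: cs1|exact: sqrt_continuous].
have cK t : {for t, continuous K}.
  by apply: (@catC Num.sqrt (fun t : R => cos (2^-1 * t))); [exact: cc1|exact: sqrt_continuous].
have cG' t : 0 < t < pi -> {for t, continuous G'}.
  move=> /pos[s0 c0].
  have S0 : S t != 0 by rewrite gt_eqF// sqrtr_gt0.
  have K0 : K t != 0 by rewrite gt_eqF// sqrtr_gt0.
  apply: (@catM (fun=> 2)); first exact: cvg_cst.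
  apply: catD; apply: catM.
  - exact: cc1.
  - exact: catV.
  - exact: cs1.
  - exact: catV.
have cwG' : {within `[x, y], continuous G'}.
  apply: continuous_in_subspaceT => t /set_mem; rewrite /= in_itv/= => /inI; exact: cG'.
have cw0 : {within `[x, y], continuous sinVh}.
  apply: continuous_in_subspaceT => t /set_mem; rewrite /= in_itv/= => /inI h.
  by apply: contoo_sinVh; rewrite in_itv.
have xI : x <= x <= y by rewrite lexx ltW.
have yI : x <= y <= y by rewrite lexx ltW.
apply: (@le_trans _ _ (\int[leb]_(t in `[x, y]) (G' t)%:E)%E); last first.
  rewrite (continuous_FTC2 xy cwG' (F := G)).
  - rewrite -EFinB lee_fin /G.
    have h1 t : 0 < t < pi -> 0 <= S t <= 1 /\ 0 <= K t <= 1.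
      move=> _; rewrite !sqrtr_ge0/= -[X in _ <= X]sqrtr1 -[X in _ /\ _ <= X]sqrtr1.
      by rewrite !ler_wsqrtr ?sin_le1 ?cos_le1.
    have [/andP[a1 a2] /andP[a3 a4]] := h1 x (inI x xI).
    have [/andP[b1 b2] /andP[b3 b4]] := h1 y (inI y yI).
    lra.
  - split; first by move=> t; rewrite in_itv/= => /andP[t0 t1]; case: (dG t) => //; apply: inI; rewrite !ltW.
    + exact/cvg_at_right_filter/cG/inI.
    + exact/cvg_at_left_filter/cG/inI.
  - move=> t; rewrite in_itv/= => /andP[t0 t1]; rewrite derive1E.
    by have := dG t; rewrite inI ?ltW// => /(_ isT) d; apply: derive_val.
apply: ge0_le_integral => //.
- by move=> t _; rewrite lee_fin sinVh_ge0.
- by apply/measurable_EFinP; exact: subspace_continuous_measurable_fun.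
- by apply/measurable_EFinP; exact: subspace_continuous_measurable_fun.
move=> t /=; rewrite in_itv/= => /inI /pos[s0 c0]; rewrite lee_fin.
have S0 : 0 < S t by rewrite sqrtr_gt0.
have K0 : 0 < K t by rewrite sqrtr_gt0.
have S2 : S t ^+ 2 = sin (2^-1 * t) by rewrite sqr_sqrtr// ltW.
have K2 : K t ^+ 2 = cos (2^-1 * t) by rewrite sqr_sqrtr// ltW.
have sk : S t ^+ 4 + K t ^+ 4 = 1.
  by rewrite -[4%N]/(2 * 2)%N !exprM S2 K2 addrC cos2Dsin2.
rewrite /sinVh /G' -S2 -K2.
have -> : sin t = 2 * (S t ^+ 2) * (K t ^+ 2).
  have {1}-> : t = 2^-1 * t + 2^-1 * t by field.
  by rewrite sinD S2 K2; ring.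
have -> : Num.sqrt (2 * S t ^+ 2 * K t ^+ 2) = Num.sqrt 2 * (S t * K t).
  by rewrite -mulrA -exprMn sqrtrM// sqrtr_sqr gtr0_norm// mulr_gt0.
have q1 : 1 <= Num.sqrt 2 :> R by rewrite -[X in X <= _]sqrtr1 ler_wsqrtr// ler1n.
move: (S t) (K t) S0 K0 sk => a b a0 b0 sk.
apply: (@le_trans _ _ (a * b)^-1).
  by rewrite lef_pV2 ?posrE ?mulr_gt0 ?sqrtr_gt0// ler_peMl// mulr_ge0// ltW.
(* What is left is $2 (a^3 + b^3) \ge 1$, which follows from $a^4 + b^4 = 1$ and $a, b \le 1$. *)
rewrite -subr_ge0.
have -> : 2 * (b ^+ 2 / a + a ^+ 2 / b) - (a * b)^-1 = (2 * (b ^+ 3 + a ^+ 3) - 1) / (a * b).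
  by field; rewrite !gt_eqF.
apply: divr_ge0; last by rewrite mulr_ge0// ltW.
have a1 : a <= 1.
  rewrite leNgt; apply/negP => h; have := exprn_gt0 4 b0.
  have : 1 < a ^+ 4 by rewrite exprn_egt1.
  by lra.
have b1 : b <= 1.
  rewrite leNgt; apply/negP => h; have := exprn_gt0 4 a0.
  have : 1 < b ^+ 4 by rewrite exprn_egt1.
  by lra.
have ha : a ^+ 4 <= a ^+ 3 by rewrite [leLHS]exprS; apply: ler_piMl => //; apply: exprn_ge0; exact: ltW.
have hb : b ^+ 4 <= b ^+ 3 by rewrite [leLHS]exprS; apply: ler_piMl => //; apply: exprn_ge0; exact: ltW.
lra.
Qed.

Lemma cvg_le_integral f M : contoo f -> (forall t, 0 < t < pi -> 0 <= f t) ->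
  (forall x y, 0 < x -> x < y -> y < pi -> (\int[leb]_(t in `[x, y]) (f t)%:E <= M%:E)%E) ->
  (\int[leb]_(t in `]0%R, pi[) (f t)%:E <= M%:E)%E.
Proof.
move=> cf f0 fM; have h := cvg_itv_pi (contoo_meas cf) f0.
rewrite -(cvg_lim (@ereal_hausdorff R) h).
apply: lime_le; first by apply/cvg_ex; eexists; exact: h.
apply: nearW => n; apply: fM; [exact: inset_gt0|exact: pi_inset|].
by rewrite gtrBl inset_gt0.
Qed.

Lemma sinVh_int : (\int[leb]_(t in `]0%R, pi[) (sinVh t)%:E <= 16%:E)%E.
Proof.
apply: cvg_le_integral; first exact: contoo_sinVh.
  by move=> t _; exact: sinVh_ge0.
exact: sinVh_segment.
Qed.

Lemma dominated_oo f (C : R) : contoo f -> (forall t, 0 < t < pi -> `|f t| <= C * sinVh t) ->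
  leb.-integrable `]0%R, pi[ (EFin \o f).
Proof.
move=> cf fC.
have iS : leb.-integrable `]0%R, pi[ (EFin \o sinVh).
  apply/integrableP; split; first by apply/measurable_EFinP; apply: contoo_meas; exact: contoo_sinVh.
  apply: le_lt_trans (ltry 16); apply: le_trans sinVh_int.
  rewrite le_eqVlt; apply/orP; left; apply/eqP; apply: eq_integral => t _.
  by rewrite /= ger0_norm// sinVh_ge0.
have iCS : leb.-integrable `]0%R, pi[ (EFin \o (fun t => C * sinVh t)).
  rewrite (_ : EFin \o _ = (fun x => C%:E * (EFin \o sinVh) x)%E); first exact: integrableZl.
  by apply/funext.
apply: (le_integrable _ _ _ iCS) => //.
  by apply/measurable_EFinP; exact: contoo_meas.
move=> t /=; rewrite in_itv/= => ht; rewrite lee_fin (le_trans (fC t ht))//.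
by rewrite ler_norm.
Qed.

Lemma dominated_intble f (C : R) : contoo f -> (forall t, 0 < t < pi -> `|f t| <= C * sinVh t) ->
  intble 0 pi f.
Proof. by move=> cf fC; apply: intble_oo => //; exact: dominated_oo fC. Qed.

Lemma dominated_Iab f (C : R) : 0 <= C -> contoo f ->
  (forall t, 0 < t < pi -> `|f t| <= C * sinVh t) -> `|Iab 0 pi f| <= C * 16.
Proof.
move=> C0 cf fC; rewrite Iab_oo//.
have iCS : leb.-integrable `]0%R, pi[ (EFin \o (fun t => C * sinVh t)).
  apply: (@dominated_oo _ C) => [t ht|t _].
    by apply: (@catM (fun=> C)); [exact: cvg_cst|exact: contoo_sinVh].
  by rewrite ger0_norm// mulr_ge0// sinVh_ge0.
have iS : leb.-integrable `]0%R, pi[ (EFin \o sinVh).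
  apply: (@dominated_oo _ 1); first exact: contoo_sinVh.
  by move=> t _; rewrite mul1r ger0_norm// sinVh_ge0.
have ifn := dominated_oo cf fC.
have ifa : leb.-integrable `]0%R, pi[ (EFin \o (fun t => `|f t|)).
  by have := integrable_norm ifn; exact.
apply: (le_trans (le_normr_Rintegral _ ifn)) => //.
apply: (@le_trans _ _ (\int[leb]_(t in `]0%R, pi[) (C * sinVh t))).
  apply: le_Rintegral => // t /=; rewrite in_itv/=; exact: fC.
rewrite RintegralZl// ler_wpM2l// -lee_fin fineK; first exact: sinVh_int.
exact: integrable_fin_num.
Qed.

(** Here $-\ln \sin t$ is twice the logarithm of [sinVh t], and a logarithm lies below its
    argument. *)
Lemma ln_sin_bound t : 0 < t < pi -> 0 <= - ln (sin t) <= 2 * sinVh t.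
Proof.
move=> /sin_gt0_pi s0; rewrite oppr_ge0 ln_le0 ?sin_le1//=.
have q0 : 0 < Num.sqrt (sin t) by rewrite sqrtr_gt0.
have -> : ln (sin t) = - (2 * ln (sinVh t)).
  rewrite /sinVh lnV ?posrE// mulrN opprK -[in LHS](sqr_sqrtr (ltW s0)) lnXn// mulr2n; ring.
rewrite opprK ler_pM2l// ltW// ln_sublinear// invr_gt0//.
Qed.

Lemma contoo_ln_sin : contoo (fun t => ln (sin t)).
Proof.
move=> t; rewrite in_itv/= => /sin_gt0_pi s0.
by apply: (@catC (@ln R) sin); [exact: continuous_sin|exact: continuous_ln].
Qed.

(** The quotient of [qs] by the square of $(1 + s) \sin t$ is at most $(1 + v^2)^2 \le (1 + v)^4$
    with $v^2 = (1 - s)/\sin t$. Passing from $v^2$ to $v$ replaces the non-integrable $1/\sin t$ by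
    [sinVh], at the price of $\sqrt{1 - s}$. *)
Lemma qs_sin_bound s t : 0 < s < 1 -> 0 < t < pi ->
  0 <= 2^-1 * ln (qs s t) - ln (1 + s) - ln (sin t) <= 2 * Num.sqrt (1 - s) * sinVh t.
Proof.
move=> s01 /[dup] ht /sin_gt0_pi st; have /andP[s0 s1] := s01.
have q0 := qs_gt0 t s01.
have s10 : 0 < 1 + s by lra.
have h1 := sin_le_qs t s01.
have p0 : 0 < (1 + s) * sin t by rewrite mulr_gt0.
have E : ln (1 + s) + ln (sin t) = 2^-1 * ln (((1 + s) * sin t) ^+ 2).
  by rewrite lnXn// lnM ?posrE// mulr2n; field.
rewrite -addrA -opprD E -mulrBr; apply/andP; split.
  by rewrite mulr_ge0// subr_ge0 ler_ln ?posrE// exprn_gt0.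
rewrite -ln_div ?posrE ?exprn_gt0//.
pose v := Num.sqrt (1 - s) * sinVh t.
have v0 : 0 <= v by rewrite mulr_ge0 ?sqrtr_ge0// sinVh_ge0.
have v2 : v ^+ 2 = (1 - s) / sin t.
  by rewrite /v exprMn /sinVh exprVn !sqr_sqrtr// ?subr_ge0 ltW.
have hv : qs s t / ((1 + s) * sin t) ^+ 2 <= (1 + v) ^+ 4.
  apply: (@le_trans _ _ ((1 + v ^+ 2) ^+ 2)); last first.
    rewrite -[4%N]/(2 * 2)%N exprM lerXn2r// ?nnegrE ?addr_ge0 ?sqr_ge0//.
    rewrite sqrrD expr1n mul1r -addrA lerD2l lerDr mulrn_wge0//.
  rewrite v2 ler_pdivrMr ?exprn_gt0// -exprMn.
  have -> : (1 + (1 - s) / sin t) * ((1 + s) * sin t) = (1 + s) * (sin t + (1 - s)).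
    by field; rewrite gt_eqF.
  rewrite /qs; have := sin_le1 t; move: (sin t) st => y y0 y1.
  rewrite -subr_ge0.
  have -> : ((1 + s) * (y + (1 - s))) ^+ 2 - ((1 - s) ^+ 2 + 4 * s * y ^+ 2) =
     (1 - s) ^+ 2 * y ^+ 2 + (1 - s) ^+ 2 * ((1 + s) ^+ 2 - 1) + 2 * (1 + s) ^+ 2 * y * (1 - s) by ring.
  have x1 : 0 <= (1 - s) ^+ 2 by exact: sqr_ge0.
  have x2 : 0 <= (1 + s) ^+ 2 - 1 by nra.
  have x3 : 0 <= (1 + s) ^+ 2 * y * (1 - s).
    by apply: mulr_ge0; [apply: mulr_ge0; [exact: sqr_ge0|exact: ltW]|lra].
  have x4 : 0 <= y ^+ 2 by exact: sqr_ge0.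
  have := mulr_ge0 x1 x2; have := mulr_ge0 x1 x4; lra.
have v10 : 0 < 1 + v by rewrite ltr_pwDl.
have : ln (qs s t / ((1 + s) * sin t) ^+ 2) <= ln ((1 + v) ^+ 4).
  have a0 : 0 < qs s t / ((1 + s) * sin t) ^+ 2 by apply: divr_gt0 => //; exact: exprn_gt0.
  have b0 : 0 < (1 + v) ^+ 4 by exact: exprn_gt0.
  by rewrite ler_ln ?posrE; [exact: hv|exact: a0|exact: b0].
rewrite lnXn//.
have : ln (1 + v) <= v by apply: le_ln1Dx; lra.
rewrite -mulrA -/v; move: (ln _) (ln _) => l1 l2 h2 h3.
have : l1 *+ 4 = 4 * l1 by rewrite mulr_natl.
lra.
Qed.

End log_sine.

(** * The conformal map *)

Section complex_topology.
Context {R : realType}.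
Implicit Types (z y : R[i]) (e d t M : R) (f g : R[i] -> R[i]).

Lemma cvg_cinftyP f (l : R[i]) : f z @[z --> cinfty] --> l <->
  forall e, 0 < e -> exists M, forall z, M < normc z -> normc (f z - l) < e.
Proof.
split => [/cvgrPdist_lt H e e0|H].
  have := H e%:C; rewrite ltcR => /(_ e0) [M hM]; exists M => z Mz.
  have := hM z; rewrite normrcE ltcR => /(_ Mz).
  by rewrite normrcE ltcR normcB.
apply/cvgrPdist_lt => e; case: e => e e'; rewrite ltcE/= => /andP[/eqP -> e0].
have [M hM] := H e e0; exists M => z; rewrite normrcE ltcR => /hM h.
by rewrite normrcE ltcR normcB.
Qed.

Lemma ctsP f z : {for z, continuous f} <->
  forall e, 0 < e -> exists2 d, 0 < d & forall y, normc (y - z) < d -> normc (f y - f z) < e.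
Proof.
split => [/cvgrPdist_lt H e e0|H].
  have := H e%:C; rewrite ltcR => /(_ e0) /nbhs_ballP[[d d'] /=].
  rewrite ltcE/= => /andP[/eqP -> d0] hd; exists d => // y; rewrite normcB => yz.
  have := hd y; rewrite -ball_normE /ball_ /= normrcE ltcR => /(_ yz).
  by rewrite normrcE ltcR normcB.
apply/(@cvgrPdist_lt _ _ _ (nbhs z) (nbhs_filter z)) => e; case: e => e e'; rewrite ltcE/= => /andP[/eqP -> e0].
have [d d0 hd] := H e e0; apply/nbhs_ballP; exists d%:C; first by rewrite /= ltcR.
move=> y; rewrite -ball_normE /ball_ /= normrcE ltcR => yz.
by rewrite normrcE ltcR normcB hd// normcB.
Qed.

Lemma ctsRP (f : R[i] -> R) z :
  (forall e, 0 < e -> exists2 d, 0 < d & forall y, normc (y - z) < d -> `|f y - f z| < e) ->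
  {for z, continuous f}.
Proof.
move=> H; apply/(@cvgrPdist_lt _ _ _ (nbhs z) (nbhs_filter z)) => e e0; have [d d0 hd] := H e e0.
apply/nbhs_ballP; exists d%:C; first by rewrite /= ltcR.
move=> y; rewrite -ball_normE /ball_ /= normrcE ltcR => yz.
by rewrite distrC hd// normcB.
Qed.

Lemma normc_dist y z : `|normc y - normc z| <= normc (y - z).
Proof.
have := le_normcD (y - z) z; have := le_normcD (z - y) y.
rewrite !subrK (normcB z y) ler_norml => h1 h2; apply/andP; split; lra.
Qed.

Lemma cts_Re f z : {for z, continuous f} -> {for z, continuous (fun z => Re (f z))}.
Proof.
move=> /ctsP cf; apply: ctsRP => e e0; have [d d0 hd] := cf e e0; exists d => // y /hd h.
rewrite (le_lt_trans _ h)//; have := Re_le_normc (f y - f z).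
by case: (f y) (f z) => u1 v1 [u2 v2].
Qed.

Lemma cts_of_derivable f z : derivable f z 1 -> {for z, continuous f}.
Proof. by move=> /derivable1_diffP/differentiable_continuous. Qed.

Lemma vertical_path z t : normc (z + t *i - z) = `|t|.
Proof. by rewrite addrAC subrr add0r /= expr0n add0r sqrtr_sqr. Qed.

(* Positivity propagates from infinity along vertical rays, which avoid
   compact subsets of the real axis. *)
Lemma vertical_positivity (D : set R[i]) (f : R[i] -> R) z (sg : R) : `|sg| = 1 ->
  (forall t, 0 <= t -> D (z + (sg * t) *i)) ->
  (forall y, D y -> {for y, continuous f}) -> (forall y, D y -> f y != 0) ->
  (exists M, forall y, M < normc y -> 0 < f y) -> 0 < f z.
Proof.
move=> sg1 Dz cf f0 [M hM].
pose p t : R[i] := z + (sg * t) *i.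
have p0 : p 0 = z by rewrite /p mulr0; case: (z) => u v; apply/eqP; rewrite eq_complex/= !addr0 !eqxx.
pose T := `|M| + normc z + 1.
have T0 : 0 <= T by rewrite !addr_ge0// normc_ge0.
have fT : 0 < f (p T).
  apply: hM; have := le_normcB (p T) z; rewrite vertical_path normrM sg1 mul1r ger0_norm//.
  have := ler_norm M; rewrite /T; lra.
rewrite ltNge -p0; apply/negP => fz.
have cg : {within `[0, T], continuous (fun t => f (p t))}.
  apply: continuous_in_subspaceT => t /set_mem; rewrite /= in_itv/= => /andP[t0 _].
  apply: (@continuous_comp _ _ _ p f); last exact: (cf _ (Dz t t0)).
  apply/cvgrPdist_lt => e; case: e => e e'; rewrite ltcE/= => /andP[/eqP -> e0].
  near=> s.
  rewrite normrcE ltcR /p.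
  have -> : z + (sg * t) *i - (z + (sg * s) *i) = (0 + (sg * (t - s)) *i) - 0.
    by case: (z) => u v; apply/eqP; rewrite eq_complex /=; apply/andP; split; apply/eqP; ring.
  rewrite vertical_path normrM sg1 mul1r.
  near: s; exact: cvgr_dist_lt.
have [|t + ft] := IVT T0 cg (v := 0).
  by rewrite ge_min le_max fz (ltW fT) orbT.
rewrite in_itv/= => /andP[t0 _].
by have := f0 _ (Dz t t0); rewrite ft eqxx.
Unshelve. all: by end_near. Qed.

Lemma csegP (a b : R) z : cseg a b z <-> Im z = 0 /\ a <= Re z <= b.
Proof.
split => [[x /=]|[i0 h]].
  by rewrite in_itv/= => h <-.
by exists (Re z); [rewrite /= in_itv|case: z i0 {h} => u v /= ->].
Qed.

(* A point off [a, b] and different from [x0] sees infinity along one of the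
   two vertical rays. *)
Lemma vertical_ray (a b x0 : R) z : ~ cseg a b z -> z <> x0%:C ->
  exists2 sg : R, `|sg| = 1 & forall t, 0 <= t ->
    ~ cseg a b (z + (sg * t) *i) /\ (z + (sg * t) *i) <> x0%:C.
Proof.
move=> zab zx; exists (if 0 <= Im z then 1 else -1); first by case: ifP; rewrite ?normrN normr1.
move=> t t0; set sg := if _ then _ else _.
have [tz|tz] := eqVneq t 0.
  rewrite tz mulr0 (_ : z + 0 *i = z)//.
  by case: (z) => u v; apply/eqP; rewrite eq_complex/= !addr0 !eqxx.
have I0 : Im (z + (sg * t) *i) != 0.
  have -> : Im (z + (sg * t) *i) = Im z + sg * t by case: (z).
  have tp : 0 < t by rewrite lt_neqAle eq_sym tz.
  by rewrite /sg; case: (leP 0 (Im z)) => h; apply/negP => /eqP; lra.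
split; first by move=> /csegP[/eqP]; rewrite (negbTE I0).
by move=> e; move: I0; rewrite e /= eqxx.
Qed.

End complex_topology.

Lemma cts_cst {R : realType} (k z : R[i]) : {for z, continuous (fun _ : R[i] => k)}.
Proof.
by apply/ctsP => e e0; exists 1 => // y _; rewrite subrr Normc.normc0.
Qed.

Section branch.
Context {R : realType}.
Variables (a b : R) (w : R[i] -> R[i]).
Hypotheses (ab : a < b) (hw : is_wbranch a b w).
Implicit Types (z y : R[i]) (x t e M : R).

Let c : R := (b + a) / 2.
Let r : R := (b - a) / 4.

Lemma quarter_gt0 : 0 < (b - a) / 4.
Proof. by rewrite divr_gt0// subr_gt0. Qed.

Let r0 : 0 < r. Proof. exact: quarter_gt0. Qed.

Let rC0 : r%:C != 0 :> R[i].
Proof. by rewrite (fmorph_eq0 (real_complex R)) gt_eqF. Qed.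

Let aE : a = c - 2 * r. Proof. by rewrite /c /r; field. Qed.
Let bE : b = c + 2 * r. Proof. by rewrite /c /r; field. Qed.

Local Notation ph := (phi a b w).

(* The inverse of the Joukowski map [jk c r]. *)
Definition zeta z : R[i] := ((b - a) / 4)%:C / ph z.

Lemma wE z : w z = ph z *+ 2 - (z - c%:C).
Proof. by rewrite /phi -/c; field. Qed.

(** The two factors correspond to the two branches of the square root: their sum is $z - c$ and
    their difference is [w] up to sign. *)
Lemma phi_quadratic z : ~ cseg a b z -> ph z * (z - c%:C - ph z) = (r ^+ 2)%:C.
Proof.
case: hw => _ h2 _ zab; have := h2 z zab; rewrite wE.
have -> : a%:C = c%:C - 2 * r%:C :> R[i] by apply/eqP; rewrite eq_complex /= {1}aE; apply/andP; split; apply/eqP; ring.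
have -> : b%:C = c%:C + 2 * r%:C :> R[i] by apply/eqP; rewrite eq_complex /= {1}bE; apply/andP; split; apply/eqP; ring.
rewrite rmorphXn/=.
set p := ph z; set C := c%:C; set Q := r%:C => h.
have -> : p * (z - C - p) = ((z - C) ^+ 2 - (p *+ 2 - (z - C)) ^+ 2) / 4 by field.
by rewrite h; field.
Qed.

Lemma phi_neq0 z : ~ cseg a b z -> ph z != 0.
Proof.
move=> /phi_quadratic h; apply/eqP => p0; move: h; rewrite p0 mul0r => /esym/eqP.
by rewrite (fmorph_eq0 (real_complex R)) expf_eq0/= gt_eqF.
Qed.

Lemma zeta_neq0 z : ~ cseg a b z -> zeta z != 0.
Proof. by move=> h; rewrite mulf_neq0// invr_eq0 phi_neq0. Qed.

Lemma phi_zeta z : ~ cseg a b z -> ph z = r%:C / zeta z.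
Proof. by move=> h; rewrite /zeta -/r invf_div mulrC divfK. Qed.

Lemma zeta_jk z : ~ cseg a b z -> z = jk c r (zeta z).
Proof.
move=> h; have p0 := phi_neq0 h.
have e : r%:C * (r%:C / ph z) = z - c%:C - ph z.
  by apply: (mulfI p0); rewrite phi_quadratic// rmorphXn/=; field.
have e2 : r%:C * (zeta z)^-1 = ph z by rewrite /zeta -/r invf_div mulrC divfK.
by rewrite /jk mulrDr e2 /zeta -/r e; ring.
Qed.

Lemma w_zeta z : ~ cseg a b z -> w z = r%:C * ((zeta z)^-1 - zeta z).
Proof.
move=> h; have z0 := zeta_neq0 h; rewrite wE {2}(zeta_jk h) phi_zeta// /jk.
by field.
Qed.

Lemma cts_w z : ~ cseg a b z -> {for z, continuous w}.
Proof. by case: hw => hol _ _ h; apply: cts_of_derivable; exact: hol. Qed.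

Lemma cts_phi z : ~ cseg a b z -> {for z, continuous ph}.
Proof.
move=> /cts_w/ctsP cf; apply/ctsP => e e0; have [d d0 hd] := cf e e0.
exists (Num.min d e); first by rewrite lt_min d0.
move=> y; rewrite lt_min => /andP[/hd h1 h2].
rewrite /phi -mulrBl.
have -> : y - ((b + a) / 2)%:C + w y - (z - ((b + a) / 2)%:C + w z) = (y - z) + (w y - w z) by ring.
rewrite Normc.normcM Normc.normcV.
have -> : normc (2 : R[i]) = 2 by rewrite -(rmorph_nat (real_complex R)) normcR ger0_norm.
rewrite ltr_pdivrMr//; have := le_normcD (y - z) (w y - w z); lra.
Qed.

Lemma phi_infty e : 0 < e -> exists M, forall z, M < normc z -> normc (ph z / z - 1) < e.
Proof.
case: hw => _ _ /cvg_cinftyP lw e0; have [M hM] := lw e e0.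
exists (Num.max M (Num.max 1 (`|c| / e))) => z; rewrite !gt_max => /andP[Mz /andP[z1 cz]].
have nz : 0 < normc z by rewrite (lt_trans _ z1).
have z0 : z != 0 by rewrite -normc_eq0 gt_eqF.
have -> : ph z / z - 1 = ((w z / z - 1) - c%:C / z) / 2.
  by rewrite /phi -/c; field.
rewrite Normc.normcM Normc.normcV.
have -> : normc (2 : R[i]) = 2 by rewrite -(rmorph_nat (real_complex R)) normcR ger0_norm.
rewrite ltr_pdivrMr//; have := le_normcB (w z / z - 1) (c%:C / z).
have : normc (c%:C / z) < e by rewrite Normc.normcM normcR Normc.normcV ltr_pdivrMr// mulrC -ltr_pdivrMr.
have := hM z Mz; lra.
Qed.

Lemma phi_large M : exists M', forall z, M' < normc z -> M < normc (ph z).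
Proof.
have [M0 hM] := phi_infty (e := 2^-1) ltac:(by rewrite invr_gt0).
exists (Num.max M0 (2 * `|M| + 1)) => z; rewrite gt_max => /andP[/hM h1 h2].
have nz : 0 < normc z by rewrite (le_lt_trans _ h2)// addr_ge0// mulr_ge0.
have z0 : z != 0 by rewrite -normc_eq0 gt_eqF.
have h3 : 2^-1 < normc (ph z / z).
  have := le_normcD (ph z / z - 1) (- (ph z / z)); rewrite addrAC subrr add0r !normcN Normc.normc1.
  by move: h1; lra.
have : normc (ph z) = normc (ph z / z) * normc z by rewrite -Normc.normcM divfK.
move=> ->; have := ler_norm M.
have : 2^-1 * normc z < normc (ph z / z) * normc z by rewrite ltr_pM2r.
by move: h2; lra.
Qed.

Lemma zeta_infty e : 0 < e -> exists M, forall z, M < normc z -> normc (zeta z) < e.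
Proof.
move=> e0; have [M hM] := phi_large (r / e); exists M => z /hM h.
have p0 : 0 < normc (ph z) by rewrite (le_lt_trans _ h)// divr_ge0// ltW.
rewrite /zeta Normc.normcM Normc.normcV normcR gtr0_norm// ltr_pdivrMr// [ltRHS]mulrC.
by rewrite -ltr_pdivrMr.
Qed.

Lemma unit_jk z : normc z = 1 -> cseg a b (jk c r z).
Proof.
move=> z1; have z0 : z != 0 by rewrite -normc_eq0 z1 oner_neq0.
have : Re z ^+ 2 + Im z ^+ 2 = 1 by rewrite -sqr_normcE z1 expr1n.
case: z z1 z0 => u v /= _ _ uv.
apply/csegP; rewrite /= uv !divr1; split; first by ring.
rewrite aE bE; have : -1 <= u <= 1.
  by have := sqr_ge0 v => v2; apply/andP; split; nra.
rewrite mul0r subr0 => /andP[u1 u2].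
have h1 : 0 <= r * (1 - u) by rewrite mulr_ge0 ?(ltW r0)// subr_ge0.
have h2 : 0 <= r * (1 + u) by rewrite mulr_ge0 ?(ltW r0)//; lra.
by move: h1 h2; move: r c => r' c' h1 h2; apply/andP; split; lra.
Qed.

(** If $|\varphi| = r$ at a point off the segment, then $\zeta$ is on the circle and the point is in
    the segment after all. So $|\varphi| - r$ has no zero outside; it is positive near infinity, and
    the sign propagates along a vertical ray. *)
Lemma zeta_lt1 z : ~ cseg a b z -> normc (zeta z) < 1.
Proof.
move=> zab.
suff : 0 < normc (ph z) - r.
  rewrite subr_gt0 => h; rewrite /zeta Normc.normcM Normc.normcV normcR gtr0_norm//.
  rewrite ltr_pdivrMr ?mul1r; [exact: h|exact: (lt_trans r0 h)].
(* A dummy point different from [z], since [vertical_ray] asks for a point to avoid. *)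
pose x0 := if z == (b + 1)%:C then b + 2 else b + 1.
have zx : z <> x0%:C.
  rewrite /x0; case: eqP => // -> /eqP; rewrite eq_complex/= eqxx andbT => /eqP; lra.
have [sg sg1 hs] := vertical_ray zab zx.
apply: (@vertical_positivity R (~` cseg a b) (fun z => normc (ph z) - r) z sg sg1).
- by move=> t t0; have [] := hs t t0.
- move=> y yab; apply: ctsRP => e e0; have /ctsP cf := cts_phi yab.
  have [d d0 hd] := cf e e0; exists d => // u /hd; apply: le_lt_trans.
  rewrite (_ : _ - r - (_ - r) = normc (ph u) - normc (ph y)); last by ring.
  exact: normc_dist.
- move=> y yab; apply/eqP => e; apply: yab.
  have e1 : normc (zeta y) = 1.
    have : normc (ph y) = r by lra.
    by move=> h; rewrite /zeta Normc.normcM Normc.normcV normcR gtr0_norm// h divff// gt_eqF.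
  have [yab|yab] := pselect (cseg a b y); first by [].
  by rewrite (zeta_jk yab); exact: unit_jk.
- have [M hM] := phi_large r; exists M => y /hM h; rewrite subr_gt0//.
Qed.

(** In the disc coordinate, $\mathrm{Im}\, z > 0$ means $\mathrm{Im}\, \zeta < 0$, and $w = r
    (1/\zeta - \zeta)$. This decides the sign of the boundary value [wplus]. *)
Lemma Im_w_gt0 z : 0 < Im z -> 0 < Im (w z).
Proof.
move=> iz; have zab : ~ cseg a b z by move=> /csegP[h _]; move: iz; rewrite h ltxx.
have z1 := zeta_lt1 zab; have z0 := zeta_neq0 zab.
have n1 : Re (zeta z) ^+ 2 + Im (zeta z) ^+ 2 < 1.
  by rewrite -sqr_normcE expr_lt1// normc_ge0.
have n0 : 0 < Re (zeta z) ^+ 2 + Im (zeta z) ^+ 2.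
  by rewrite -sqr_normcE exprn_gt0// lt_neqAle normc_ge0 andbT eq_sym normc_eq0.
move: iz; rewrite {1}(zeta_jk zab) w_zeta// /jk.
case: (zeta z) n0 n1 => u v /= n0 n1.
move: (u ^+ 2 + v ^+ 2) n0 n1 => n n0 n1.
rewrite !mul0r !addr0 add0r => h.
have v0 : v < 0.
  move: h; rewrite (_ : r * (v - v / n) = - (v * (r * (n^-1 - 1)))); last by field; rewrite gt_eqF.
  rewrite oppr_gt0 pmulr_llt0// mulr_gt0// subr_gt0 invf_gt1//.
rewrite (_ : r * (- (v / n) - v) = - v * (r * (n^-1 + 1))); last by field; rewrite gt_eqF.
by rewrite mulr_gt0 ?oppr_gt0// mulr_gt0// addr_gt0// invr_gt0.
Qed.

(** With $y$ the claimed imaginary part, $(w - iy)(w + iy)$ is of order $t$, while $|w + iy| \ge y$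
    because the imaginary part of $w$ is positive. Hence $w - iy$ is of order $t$. *)
Lemma wplusE x : a < x < b -> wplus w x = 0 +i* Num.sqrt ((x - a) * (b - x)).
Proof.
move=> /andP[ax xb]; rewrite /wplus; apply/cvg_lim; first exact: norm_hausdorff.
set y := Num.sqrt _.
have q0 : 0 < (x - a) * (b - x) by rewrite mulr_gt0 ?subr_gt0.
have y0 : 0 < y by rewrite sqrtr_gt0.
have y2 : y ^+ 2 = (x - a) * (b - x) by rewrite sqr_sqrtr// ltW.
apply/cvgrPdist_lt => e; case: e => e e'; rewrite ltcE/= => /andP[/eqP -> e0].
pose L := (b - a) + 1.
have L0 : 0 < L by rewrite /L; lra.
near=> t.
have t0 : 0 < t by near: t; exact: nbhs_right_gt.
have t1 : t < 1 by near: t; exact: nbhs_right_lt.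
have te : t < e * y / L by near: t; apply: nbhs_right_lt; rewrite divr_gt0// mulr_gt0.
have := @Im_w_gt0 (x +i* t) t0.
have zab : ~ cseg a b (x +i* t) by move=> /csegP[/= h _]; move: t0; rewrite h ltxx.
case: hw => _ /(_ _ zab) + _.
set W := w _ => hW iW.
rewrite normrcE ltcR normcB.
have d0 : normc (W - (0 +i* y)) * normc (W + (0 +i* y)) <= t * L.
  rewrite -Normc.normcM -subr_sqr hW.
  have -> : (x +i* t - a%:C) * (x +i* t - b%:C) - (0 +i* y) ^+ 2 = t%:C * ((- t) +i* (x - b + (x - a))).
    rewrite !expr2; apply/eqP; rewrite eq_complex /=; apply/andP; split; apply/eqP; last by ring.
    by rewrite (_ : y * y = (x - a) * (b - x)); [ring|rewrite -expr2].
  rewrite Normc.normcM normcR gtr0_norm// ler_pM2l//.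
  rewrite (le_trans (le_normc_ReIm _))//= normrN gtr0_norm// addrC lerD ?(ltW t1)//.
  by rewrite ler_norml; apply/andP; split; lra.
have d1 : y <= normc (W + (0 +i* y)).
  rewrite (le_trans _ (Im_le_normc _))// (_ : Im (W + (0 +i* y)) = Im W + y); last by case: (W).
  by rewrite gtr0_norm ?addr_gt0// lerDr ltW.
rewrite -(ltr_pM2r y0); apply: le_lt_trans (_ : t * L < _).
  by apply: le_trans d0; rewrite ler_wpM2l// normc_ge0.
by rewrite -ltr_pdivlMr.
Unshelve. all: by end_near. Qed.

Lemma zeta_real x0 : ~ cseg a b x0%:C ->
  exists a0 : R, [/\ zeta x0%:C = a0%:C, `|a0| < 1 & a0 != 0].
Proof.
move=> xab; have z1 := zeta_lt1 xab; have z0 := zeta_neq0 xab.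
have e := zeta_jk xab.
move: (zeta x0%:C) e z1 z0 => z e z1 z0; exists (Re z).
have n0 : 0 < Re z ^+ 2 + Im z ^+ 2.
  by rewrite -sqr_normcE exprn_gt0// lt_neqAle normc_ge0 andbT eq_sym normc_eq0.
have n1 : Re z ^+ 2 + Im z ^+ 2 < 1.
  by rewrite -sqr_normcE expr_lt1// normc_ge0.
have i0 : Im z = 0.
  move: e => /(congr1 (@complex.Im R)); rewrite /jk.
  case: (z) n0 n1 => u v /= n0 n1; rewrite !mul0r !addr0 add0r.
  rewrite (_ : r * (v - v / (u ^+ 2 + v ^+ 2)) = v * (r * (1 - (u ^+ 2 + v ^+ 2)^-1))); last by field; rewrite gt_eqF.
  move=> /esym/eqP; rewrite mulf_eq0 (mulf_eq0 r) (gt_eqF r0) subr_eq0 => /orP[/eqP//|/= /eqP h].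
  by move: n1; rewrite -[u ^+ 2 + _]invrK -h invr1 ltxx.
have zr : z = (Re z)%:C by move: i0; case: (z) => u v /= ->.
split => //; first by rewrite -normcR -zr.
by apply/eqP => h; move: z0; rewrite zr h eqxx.
Qed.

(** In the coordinate $\zeta$ the radicand is the square of $1/(1 - \zeta_0 \zeta)$, with $\zeta_0$
    the coordinate of [x0]. So [S] times the denominator is $\pm 1$; the sign is read at infinity
    and carried along a vertical ray avoiding [x0], where the radicand is not defined. *)
Lemma szego_factorE x0 S : ~ cseg a b x0%:C -> is_szego_factor a b w x0 S ->
  forall z, ~ cseg a b z -> z <> x0%:C -> S z = (1 - zeta x0%:C * zeta z)^-1.
Proof.
move=> xab [holS S2 limS] z zab zx.
pose D y := ~ cseg a b y /\ y <> x0%:C.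
pose s y := S y * (1 - zeta x0%:C * zeta y).
have zx1 := zeta_lt1 xab.
have d0 y : D y -> 1 - zeta x0%:C * zeta y != 0.
  move=> [yab _]; rewrite subr_eq0; apply/eqP => e.
  have := Normc.normc1 R; rewrite e Normc.normcM; have := zeta_lt1 yab.
  by have := normc_ge0 (zeta y); have := normc_ge0 (zeta x0%:C); nra.
have s2 y : D y -> s y ^+ 2 = 1.
  move=> Dy; have [yab yx] := Dy; rewrite /s exprMn S2 ?(introN eqP)//.
  rewrite !phi_zeta// -/r.
  have h0 := d0 y Dy.
  have e1 : y - x0%:C = r%:C * (1 - zeta x0%:C * zeta y) * (zeta x0%:C - zeta y) / (zeta x0%:C * zeta y).
    rewrite {1}(zeta_jk yab) {1}(zeta_jk xab) /jk.
    by field; rewrite zeta_neq0// zeta_neq0.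
  have e2 : zeta x0%:C - zeta y != 0.
    rewrite subr_eq0; apply/eqP => e; apply: yx.
    by rewrite (zeta_jk yab) (zeta_jk xab) e.
  rewrite e1 -/r rmorphXn/= -/r.
  move: (zeta y) (zeta x0%:C) (zeta_neq0 yab) (zeta_neq0 xab) e2 h0 => u v u0 v0 e2 h0.
  have e3 : r%:C / v * (r%:C / u) - r%:C ^+ 2 = r%:C ^+ 2 * (1 - v * u) / (v * u).
    by field; rewrite u0.
  rewrite e3; field.
  by rewrite h0 e2 u0 v0 rC0.
have pm y : D y -> s y = 1 \/ s y = -1.
  move=> /s2/eqP; rewrite -subr_eq0 subr_sqr_1 mulf_eq0 subr_eq0 addr_eq0 => /orP[]/eqP; tauto.
have Dz : D z by split.
suff : 0 < Re (s z).
  have [h|h] := pm z Dz; first by move=> _; apply: (mulIf (d0 z Dz)); rewrite -/(s z) h mulVf// d0.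
  by rewrite h /= ltr0N1.
have [sg sg1 hs] := vertical_ray zab zx.
apply: (@vertical_positivity R D (fun z => Re (s z)) z sg sg1 hs).
- move=> y Dy; have [yab yx] := Dy; apply: cts_Re; apply: continuousM.
    by apply: cts_of_derivable; exact: holS.
  apply: continuousB; first exact: cts_cst.
  apply: continuousM; first exact: cts_cst.
  apply: continuousM; first exact: cts_cst.
  by apply: continuousV; [exact: phi_neq0|exact: cts_phi].
- move=> y /pm[]->; first by rewrite /= oner_neq0.
  by rewrite /= oppr_eq0 oner_neq0.
move/cvg_cinftyP : limS => /(_ (1 / 4) ltac:(by rewrite divr_gt0)) [M1 h1].
have [M2 h2] := zeta_infty (e := 1 / 4) ltac:(by rewrite divr_gt0).
exists (Num.max M1 M2) => y; rewrite gt_max => /andP[/h1 hy1 /h2 hy2].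
have : normc (s y - 1) < 1.
  have -> : s y - 1 = (S y - 1) - ((S y - 1) + 1) * (zeta x0%:C * zeta y) by rewrite /s; ring.
  have hE : normc (zeta x0%:C * zeta y) <= 1 / 4.
    rewrite Normc.normcM -[leRHS]mul1r; apply: ler_pM; rewrite ?normc_ge0//; exact: ltW.
  have h3 := le_normcB (S y - 1) (((S y - 1) + 1) * (zeta x0%:C * zeta y)).
  have h4 := le_normcD (S y - 1) 1; rewrite Normc.normc1 in h4.
  apply: (le_lt_trans h3); rewrite Normc.normcM.
  have : normc (S y - 1 + 1) * normc (zeta x0%:C * zeta y) <= (1 / 4 + 1) * (1 / 4).
    by apply: ler_pM; rewrite ?normc_ge0//; move: hy1 h4; lra.
  by move: hy1; lra.
have := Re_le_normc (s y - 1); rewrite (_ : Re (s y - 1) = Re (s y) - 1); last by case: (s y).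
by rewrite ler_norml => /andP[h _]; lra.
Qed.

End branch.

(** * The Szego function *)

Section complex_integral.
Context {R : realType}.
Implicit Types (F G : R -> R[i]) (z k : R[i]) (t C : R) (l : R -> R).

Definition cJ F : R[i] := (Iab 0 pi (fun t => Re (F t))) +i* (Iab 0 pi (fun t => Im (F t))).
Definition cintble F := intble 0 pi (fun t => Re (F t)) /\ intble 0 pi (fun t => Im (F t)).

Lemma cJ_eq F G : (forall t, F t = G t) -> cJ F = cJ G.
Proof. by move=> FG; congr (cJ _); apply/funext. Qed.

Lemma cJD F G : cintble F -> cintble G -> cJ (fun t => F t + G t) = cJ F + cJ G.
Proof.
move=> [F1 F2] [G1 G2]; rewrite /cJ; apply/eqP; rewrite eq_complex/= -!IabD//.
by apply/andP; split; apply/eqP; apply: Iab_eq => t _; case: (F t) (G t) => ? ? [].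
Qed.

Lemma cintbleD F G : cintble F -> cintble G -> cintble (fun t => F t + G t).
Proof.
move=> [F1 F2] [G1 G2]; split.
  rewrite (_ : (fun t => Re (F t + G t)) = fun t => Re (F t) + Re (G t)); first exact: intbleD.
  by apply/funext => t; case: (F t) (G t) => ? ? [].
rewrite (_ : (fun t => Im (F t + G t)) = fun t => Im (F t) + Im (G t)); first exact: intbleD.
by apply/funext => t; case: (F t) (G t) => ? ? [].
Qed.

Lemma cintbleZ k F : cintble F -> cintble (fun t => k * F t).
Proof.
case: k => u v [F1 F2]; split.
  rewrite (_ : (fun t => _) = fun t => u * Re (F t) + (- v) * Im (F t)).
    by apply: intbleD; exact: intbleZ.
  by apply/funext => t; case: (F t) => ? ?/=; ring.
rewrite (_ : (fun t => _) = fun t => u * Im (F t) + v * Re (F t)).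
  by apply: intbleD; exact: intbleZ.
by apply/funext => t; case: (F t) => ? ?/=; ring.
Qed.

Lemma cJZ k F : cintble F -> cJ (fun t => k * F t) = k * cJ F.
Proof.
case: k => u v [F1 F2]; rewrite /cJ; apply/eqP; rewrite eq_complex; apply/andP; split; apply/eqP => /=.
  rewrite -mulNr -!IabZ// -IabD; [|exact: intbleZ..].
  by apply: Iab_eq => t _; case: (F t) => ? ?/=; ring.
rewrite -!IabZ// -IabD; [|exact: intbleZ..].
by apply: Iab_eq => t _; case: (F t) => ? ?/=; ring.
Qed.

Lemma cJB F G : cintble F -> cintble G -> cJ (fun t => F t - G t) = cJ F - cJ G.
Proof.
move=> iF iG; rewrite -[- cJ G]mulN1r -cJZ// -cJD//; last exact: cintbleZ.
by apply: cJ_eq => t; rewrite mulN1r.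
Qed.

Definition contC F := contR (fun t => Re (F t)) /\ contR (fun t => Im (F t)).

Lemma contC_M F G : contC F -> contC G -> contC (fun t => F t * G t).
Proof.
move=> [F1 F2] [G1 G2]; split.
  rewrite (_ : (fun t => Re _) = fun t => Re (F t) * Re (G t) + - (Im (F t) * Im (G t))); first by cont.
  by apply/funext => t; case: (F t) (G t) => ? ? [].
rewrite (_ : (fun t => Im _) = fun t => Re (F t) * Im (G t) + Im (F t) * Re (G t)); first by cont.
by apply/funext => t; case: (F t) (G t) => ? ? [].
Qed.

Lemma contC_D F G : contC F -> contC G -> contC (fun t => F t + G t).
Proof.
move=> [F1 F2] [G1 G2]; split.
  rewrite (_ : (fun t => Re _) = fun t => Re (F t) + Re (G t)); first by cont.
  by apply/funext => t; case: (F t) (G t) => ? ? [].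
rewrite (_ : (fun t => Im _) = fun t => Im (F t) + Im (G t)); first by cont.
by apply/funext => t; case: (F t) (G t) => ? ? [].
Qed.

Lemma contC_cst k : contC (fun=> k).
Proof. by split; exact: cont_cst. Qed.

Lemma contC_real l : contR l -> contC (fun t => (l t)%:C).
Proof. by move=> cl; split => //=; exact: cont_cst. Qed.

Lemma contC_inv (z : R[i]) l : contR l -> (forall t, z - (l t)%:C != 0) -> contC (fun t => (z - (l t)%:C)^-1).
Proof.
case: z => u v cl z0.
have n0 t : (u - l t) ^+ 2 + v ^+ 2 != 0.
  by move: (z0 t); rewrite -normc_eq0 -sqrf_eq0 sqr_normcE /= subr0.
have cV : contR (fun t => ((u + - l t) ^+ 2 + v ^+ 2)^-1) by apply: contV => //; cont.
split.
  rewrite (_ : (fun t => Re _) = fun t => (u + - l t) * ((u + - l t) ^+ 2 + v ^+ 2)^-1); first by cont.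
  by apply/funext => t /=; rewrite subr0.
rewrite (_ : (fun t => Im _) = fun t => - (v * ((u + - l t) ^+ 2 + v ^+ 2)^-1)); first by cont.
by apply/funext => t /=; rewrite subr0.
Qed.

Lemma contC_intble F : contC F -> cintble F.
Proof. by move=> [F1 F2]; split; exact: cont_intble. Qed.

Lemma contoo_M l (g : R -> R) : contoo l -> contR g -> contoo (fun t => l t * g t).
Proof. by move=> cl cg t ht; apply: catM; [exact: cl|exact: cg]. Qed.

(** The factor 32 is 16, the bound on the integral of [sinVh], for each of the real and imaginary
    parts. *)
Lemma cJ_dominated l F C : 0 <= C -> contoo l -> contC F ->
  (forall t, 0 < t < pi -> `|l t| * normc (F t) <= C * sinVh t) ->
  cintble (fun t => (l t)%:C * F t) /\ normc (cJ (fun t => (l t)%:C * F t)) <= 32 * C.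
Proof.
move=> C0 cl [F1 F2] h.
have eR : (fun t => Re ((l t)%:C * F t)) = fun t => l t * Re (F t).
  by apply/funext => t; case: (F t) => u v /=; rewrite mul0r subr0.
have eI : (fun t => Im ((l t)%:C * F t)) = fun t => l t * Im (F t).
  by apply/funext => t; case: (F t) => u v /=; rewrite mul0r addr0.
have c1 := contoo_M cl F1; have c2 := contoo_M cl F2.
have h1 t : 0 < t < pi -> `|l t * Re (F t)| <= C * sinVh t.
  by move=> /h; apply: le_trans; rewrite normrM ler_wpM2l// Re_le_normc.
have h2 t : 0 < t < pi -> `|l t * Im (F t)| <= C * sinVh t.
  by move=> /h; apply: le_trans; rewrite normrM ler_wpM2l// Im_le_normc.
split; first by split; rewrite ?eR ?eI; [exact: dominated_intble h1|exact: dominated_intble h2].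
rewrite (le_trans (le_normc_ReIm _))// /cJ [Re _]/= [Im _]/= eR eI.
have := dominated_Iab C0 c1 h1; have := dominated_Iab C0 c2 h2; lra.
Qed.

Lemma sinVh_ge1 t : 0 < t < pi -> 1 <= sinVh t.
Proof.
move=> /sin_gt0_pi s0; rewrite /sinVh invf_ge1 ?sqrtr_gt0//.
by rewrite -[leRHS]sqrtr1 ler_wsqrtr// sin_le1.
Qed.

End complex_integral.

(** * The Szego kernel in the disc coordinate *)

Section kernel.
Context {R : realType}.
Variables (a b : R) (w : R[i] -> R[i]).
Hypotheses (ab : a < b) (hw : is_wbranch a b w).
Implicit Types (z : R[i]) (t C rho : R) (l : R -> R) (T : {poly R}).

Let c : R := (b + a) / 2.
Let r : R := (b - a) / 4.
Let r0 : 0 < r. Proof. exact: quarter_gt0. Qed.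
Let rC0 : r%:C != 0 :> R[i].
Proof. by rewrite (fmorph_eq0 (real_complex R)) gt_eqF. Qed.
Local Notation ze := (zeta a b w).

Definition xt t : R := (b + a) / 2 + 2 * ((b - a) / 4) * cos t.

Lemma xt_in t : a <= xt t <= b.
Proof.
rewrite /xt; have := cos_le1 t; have := cos_geN1 t => h1 h2.
have h3 : 0 <= (b - a) / 4 * (1 - cos t) by rewrite mulr_ge0 ?(ltW (quarter_gt0 ab))// subr_ge0.
have h4 : 0 <= (b - a) / 4 * (1 + cos t) by rewrite mulr_ge0 ?(ltW (quarter_gt0 ab))//; lra.
have e1 : (b + a) / 2 + 2 * ((b - a) / 4) * cos t - a = 2 * ((b - a) / 4 * (1 + cos t)) by field.
have e2 : b - ((b + a) / 2 + 2 * ((b - a) / 4) * cos t) = 2 * ((b - a) / 4 * (1 - cos t)) by field.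
by apply/andP; split; rewrite -subr_ge0 ?e1 ?e2; apply: mulr_ge0.
Qed.

Lemma cont_xt : contR xt. Proof. by rewrite /xt; cont. Qed.

Lemma z_xt z t : ~ cseg a b z -> z - (xt t)%:C != 0.
Proof.
move=> zab; rewrite subr_eq0; apply/eqP => e; apply: zab; rewrite e.
by exists (xt t) => //=; rewrite in_itv/= xt_in.
Qed.

(** In terms of $\zeta$ this is $(1 - \zeta^2) / ((1 - \zeta e^{it})(1 - \zeta e^{-it}))$, the
    Poisson-type kernel with cosine expansion $1 + 2 \sum_{j \ge 1} \zeta^j \cos jt$. *)
Definition Kz z t : R[i] := w z * (z - (xt t)%:C)^-1.

Lemma contC_Kz z : ~ cseg a b z -> contC (Kz z).
Proof.
move=> zab; apply: contC_M; first exact: contC_cst.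
by apply: contC_inv; [exact: cont_xt|move=> t; exact: z_xt].
Qed.

Lemma jk_sub z t : z != 0 -> jk c r z - (xt t)%:C = r%:C * ((1 - z * ecirc t) * (1 - z * ecirc (- t))) / z.
Proof.
move=> z0; rewrite /jk /xt -/c -/r.
have -> : (c + 2 * r * cos t)%:C = c%:C + r%:C * (ecirc t + ecirc (- t)).
  by rewrite /ecirc cosN sinN; apply/eqP; rewrite eq_complex /=; apply/andP; split; apply/eqP; ring.
have := ecircD t (- t); rewrite subrr /ecirc cos0 sin0 -/(ecirc t) -/(ecirc (- t)).
move: (ecirc t) (ecirc (- t)) => u v /esym uv.
have uv1 : u * v = 1 by rewrite uv.
have -> : (1 - z * u) * (1 - z * v) = 1 - z * (u + v) + z ^+ 2 * (u * v) by ring.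
by rewrite uv1; field; rewrite z0.
Qed.

Lemma den_ge z t rho : normc z <= rho -> rho < 1 -> 1 - rho <= normc (1 - z * ecirc t).
Proof.
move=> zr r1; rewrite lerBlDr -[X in X <= _](Normc.normc1 R).
rewrite -{1}(subrK (z * ecirc t) 1) (le_trans (le_normcD _ _))// lerD2l.
by rewrite Normc.normcM ecirc_norm mulr1.
Qed.

Lemma Kz1_bound z t rho : ~ cseg a b z -> normc (ze z) <= rho -> rho < 1 ->
  normc (Kz z t - 1) <= 4 * normc (ze z) / (1 - rho) ^+ 2.
Proof.
move=> zab zr r1; have z0 := zeta_neq0 ab hw zab.
have n0 := normc_ge0 (ze z).
have d1 := den_ge t zr r1; have d2 := den_ge (- t) zr r1.
have p0 : 0 < 1 - rho by rewrite subr_gt0.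
have e1 : 1 - ze z * ecirc t != 0 by rewrite -normc_eq0 gt_eqF// (lt_le_trans p0).
have e2 : 1 - ze z * ecirc (- t) != 0 by rewrite -normc_eq0 gt_eqF// (lt_le_trans p0).
have -> : Kz z t - 1 = ze z * (ecirc t + ecirc (- t) - 2 * ze z) / ((1 - ze z * ecirc t) * (1 - ze z * ecirc (- t))).
  have ez : z - (xt t)%:C = r%:C * ((1 - ze z * ecirc t) * (1 - ze z * ecirc (- t))) / ze z.
    by rewrite {1}(zeta_jk ab hw zab) -/c -/r jk_sub.
  rewrite /Kz (w_zeta ab hw zab) ez -/r.
  have := ecircD t (- t); rewrite subrr [ecirc 0]/ecirc cos0 sin0.
  move: (ecirc t) (ecirc (- t)) e1 e2 => u v e1 e2 /esym uv.
  have uv1 : u * v = 1 by rewrite uv.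
  have -> : r%:C * ((ze z)^-1 - ze z) * (r%:C * ((1 - ze z * u) * (1 - ze z * v)) / ze z)^-1 - 1 =
    ((1 - ze z ^+ 2) - (1 - ze z * u) * (1 - ze z * v)) / ((1 - ze z * u) * (1 - ze z * v)).
    by field; rewrite rC0 z0 e1 e2.
  congr (_ / _).
  have -> : (1 - ze z * u) * (1 - ze z * v) = 1 - ze z * (u + v) + ze z ^+ 2 * (u * v) by ring.
  by rewrite uv1; ring.
rewrite (Normc.normcM (ze z * _)) (Normc.normcM (ze z)) Normc.normcV (Normc.normcM (1 - _)).
have hn : normc (ecirc t + ecirc (- t) - 2 * ze z) <= 4.
  rewrite (le_trans (le_normcB _ _))//.
  have := le_normcD (ecirc t) (ecirc (- t)); rewrite !ecirc_norm (Normc.normcM 2).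
  have -> : normc (2 : R[i]) = 2 by rewrite -(rmorph_nat (real_complex R)) normcR ger0_norm.
  by move: zr r1; lra.
rewrite [X in _ <= X / _]mulrC; apply: ler_pM.
- by rewrite mulr_ge0 ?normc_ge0.
- by rewrite invr_ge0 ?mulr_ge0 ?normc_ge0.
- by rewrite ler_wpM2l.
rewrite lef_pV2 ?posrE ?exprn_gt0// ?mulr_gt0 ?(lt_le_trans p0)//.
by rewrite expr2; apply: ler_pM => //; exact: ltW.
Qed.

(* The recurrence of the cosines yields a linear recurrence for the integrals
   whose characteristic roots are [zeta] and [1 / zeta]; the integrals are
   bounded in [j], which excludes the second root. *)
Lemma cJ_cos_Kz z j : ~ cseg a b z ->
  cJ (fun t => (cos (j%:R * t))%:C * Kz z t) = pi%:C * ze z ^+ j.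
Proof.
move=> zab; have z0 := zeta_neq0 ab hw zab; have z1 := zeta_lt1 ab hw zab.
have cK := contC_Kz zab.
pose F j t := (cos (j%:R * t))%:C * Kz z t.
have cF i : contC (F i) by apply: contC_M => //; apply: contC_real; cont.
have iF i := contC_intble (cF i).
pose A i := cJ (F i).
(* Since $2 \cos t = \zeta + 1/\zeta - (z - x)/r$, the last term cancels the denominator of the
   kernel and leaves a pure cosine, whose integral is zero. *)
have rel i t : (F i.+2 t + F i t) = (ze z + (ze z)^-1) * F i.+1 t - (w z / r%:C) * (cos (i.+1%:R * t))%:C.
  have e : cos (i.+2%:R * t) + cos (i%:R * t) = 2 * cos t * cos (i.+1%:R * t).
    rewrite -!natr1 !mulrDl !mul1r.
    have e' : cos (i%:R * t) = cos ((i%:R * t + t) - t) by rewrite addrK.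
    by rewrite e' cosB [cos (_ + t + t)]cosD; ring.
  rewrite /F -mulrDl -rmorphD/= e rmorphM/= /Kz.
  have d0 := z_xt t zab.
  have -> : (2 * cos t)%:C = (ze z + (ze z)^-1) - (z - (xt t)%:C) / r%:C.
    rewrite {3}(zeta_jk ab hw zab) -/c -/r /jk /xt -/c -/r.
    have -> : (c + 2 * r * cos t)%:C = c%:C + r%:C * (2 * cos t)%:C.
      by rewrite -rmorphM -rmorphD/=; congr (_%:C); ring.
    by field; rewrite ?rC0 ?z0.
  by field; rewrite rC0 d0.
have ccos i : contC (fun t => (cos (i%:R * t))%:C) by apply: contC_real; cont.
have Jcos i : cJ (fun t => (cos (i.+1%:R * t))%:C) = 0.
  by rewrite /cJ /= J_cos// Iab_cst ?pi_ge0// mul0r.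
have Jcos0 : cJ (fun t => (cos (0%:R * t))%:C) = pi%:C.
  rewrite /cJ /= (Iab_eq (g := fun=> 1)); last by move=> t _; rewrite mul0r cos0.
  by rewrite !Iab_cst ?pi_ge0// mul0r mul1r subr0.
have rec i : A i.+2 + A i = (ze z + (ze z)^-1) * A i.+1.
  rewrite /A -cJD// (cJ_eq (rel i)) cJB ?cJZ//; last 2 first.
  - exact: cintbleZ.
  - by apply: cintbleZ; exact: contC_intble.
  - by rewrite Jcos mulr0 subr0.
  - exact: contC_intble.
have [C C0 hC] : exists2 C, 0 <= C & forall i, normc (A i) <= C.
  pose B := 1 + 4 * normc (ze z) / (1 - normc (ze z)) ^+ 2.
  have B0 : 0 <= B by rewrite addr_ge0// divr_ge0 ?sqr_ge0// mulr_ge0// normc_ge0.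
  exists (32 * B); first by rewrite mulr_ge0.
  move=> i; have ci : contoo (fun t => cos (i%:R * t)).
    have : contR (fun t : R => cos (i%:R * t)) by cont.
    by move=> h t _; exact: h.
  have [] // := cJ_dominated B0 ci cK.
  move=> t ht; apply: (@le_trans _ _ (1 * B)).
    apply: ler_pM => //; rewrite ?normc_ge0 ?cos_max//.
    rewrite -[Kz z t](subrK 1) addrC (le_trans (le_normcD _ _))// Normc.normc1 lerD2l.
    exact: Kz1_bound.
  by rewrite mul1r ler_peMr// sinVh_ge1.
pose D i := A i.+1 - ze z * A i.
have Drec i : D i = ze z * D i.+1.
  rewrite /D; have -> : A i.+2 = (ze z + (ze z)^-1) * A i.+1 - A i by rewrite -rec addrK.
  by field.
have Dpow i : D 0%N = ze z ^+ i * D i.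
  by elim: i => [|i ->]; rewrite ?mul1r// exprSr -mulrA -Drec.
have D0 : D 0%N = 0.
  apply/Normc.eq0_normc/eqP; rewrite eq_le normc_ge0 andbT; apply/ler_addgt0Pr => e e0.
  rewrite add0r.
  have hz : 0 <= normc (ze z) < 1 by rewrite normc_ge0.
  have e1 : 0 < e / (2 * C + 1) by rewrite divr_gt0// ltr_wpDl// mulr_ge0.
  have [N hN] := expr_small hz e1.
  rewrite (Dpow N) (Normc.normcM (ze z ^+ N)) normcX.
  have hD : normc (D N) <= 2 * C + 1.
    rewrite /D (le_trans (le_normcB _ _))// (Normc.normcM (ze z)).
    have := hC N.+1; have := hC N; have := normc_ge0 (A N); have := normc_ge0 (ze z).
    by move: (normc (ze z)) z1 (normc (A N)) (normc (A N.+1)) => u u1 v v'; nra.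
  rewrite (le_trans (ler_pM _ _ (hN N (leqnn N)) hD))// ?exprn_ge0 ?normc_ge0//.
  by rewrite divfK// gt_eqF// ltr_wpDl// mulr_ge0.
have Dz i : A i.+1 = ze z * A i.
  have : D i = 0.
    have := Dpow i; rewrite D0 => /esym/eqP; rewrite mulf_eq0 expf_eq0 (negbTE z0) andbF/=.
    by move/eqP.
  by move/eqP; rewrite subr_eq0 => /eqP.
(* The recurrence centred at order zero, where the orders 1 and $-1$ coincide and the pure cosine is
   constant, fixes the initial value. *)
have A0 : A 0%N = pi%:C.
  have rel0 t : 2 * F 1%N t = (ze z + (ze z)^-1) * F 0%N t - (w z / r%:C) * (cos (0%:R * t))%:C.
    rewrite /F mul0r cos0 mul1r /Kz; have d0 := z_xt t zab.
    have -> : (cos t)%:C = 2^-1 * ((ze z + (ze z)^-1) - (z - (xt t)%:C) / r%:C).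
      rewrite {3}(zeta_jk ab hw zab) -/c -/r /jk /xt -/c -/r.
      have -> : (c + 2 * r * cos t)%:C = c%:C + r%:C * (2 * (cos t)%:C).
        by apply/eqP; rewrite eq_complex /=; apply/andP; split; apply/eqP; ring.
      by field; rewrite rC0 z0.
    by field; rewrite rC0 d0.
  have : 2 * A 1%N = (ze z + (ze z)^-1) * A 0%N - (w z / r%:C) * pi%:C.
    rewrite /A -cJZ// (cJ_eq rel0) cJB ?cJZ//; last 2 first.
    - exact: cintbleZ.
    - by apply: cintbleZ; exact: contC_intble.
    - by rewrite Jcos0.
    - exact: contC_intble.
  rewrite Dz (w_zeta ab hw zab) -/r.
  have n0 : 1 - ze z ^+ 2 != 0.
    rewrite subr_eq0; apply/eqP => e; have := Normc.normc1 R; rewrite e normcX.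
    by have := normc_ge0 (ze z); move: z1; nra.
  move=> h; apply: (mulfI n0).
  have -> : (1 - ze z ^+ 2) * A 0%N = ze z * ((ze z + (ze z)^-1) * A 0%N - 2 * (ze z * A 0%N)) by field.
  by rewrite h; field; rewrite rC0 z0.
have Aj i : A i = pi%:C * ze z ^+ i.
  by elim: i => [|i IH]; rewrite ?A0 ?mulr1// Dz IH exprS mulrCA.
exact: Aj.
Qed.

Lemma cJ_pc_Kz z T : ~ cseg a b z -> cJ (fun t => (pc T t)%:C * Kz z t) = pi%:C * ceval T (ze z).
Proof.
move=> zab; have cK := contC_Kz zab.
rewrite ceval_coef.
have -> : cJ (fun t => (pc T t)%:C * Kz z t) =
   cJ (fun t => \sum_(i < size T) (T`_i)%:C * ((cos (i%:R * t))%:C * Kz z t)).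
  apply: cJ_eq => t; rewrite pcE rmorph_sum mulr_suml; apply: eq_bigr => i _ /=.
  by rewrite rmorphM mulrA.
have ci i : cintble (fun t => (T`_i)%:C * ((cos (i%:R * t))%:C * Kz z t)).
  by apply/cintbleZ/contC_intble/contC_M => //; apply: contC_real; cont.
have H n : cJ (fun t => \sum_(i < n) (T`_i)%:C * ((cos (i%:R * t))%:C * Kz z t)) =
    pi%:C * \sum_(i < n) (T`_i)%:C * ze z ^+ i /\
    cintble (fun t => \sum_(i < n) (T`_i)%:C * ((cos (i%:R * t))%:C * Kz z t)).
  elim: n => [|n [IH1 IH2]].
    rewrite big_ord0 mulr0 (_ : (fun t => _) = fun=> 0); last by apply/funext => t; rewrite big_ord0.
    split; last exact/contC_intble/contC_cst.
    by rewrite /cJ /= Iab_cst ?pi_ge0// mul0r.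
  rewrite (_ : (fun t => _) = fun t => \sum_(i < n) (T`_i)%:C * ((cos (i%:R * t))%:C * Kz z t) +
    (T`_n)%:C * ((cos (n%:R * t))%:C * Kz z t)); last by apply/funext => t; rewrite big_ord_recr.
  split; last exact: cintbleD.
  rewrite cJD// IH1 cJZ ?cJ_cos_Kz// ?big_ord_recr ?mulrDr//=; first by rewrite mulrCA.
  by apply/contC_intble/contC_M => //; apply: contC_real; cont.
by have [] := H (size T).
Qed.

End kernel.

(** * The Szego function as a kernel integral over the angle *)

Section szego_function.
Context {R : realType}.
Variables (a b : R) (w : R[i] -> R[i]) (h dmu : R -> R) (m : R).
Hypotheses (ab : a < b) (hw : is_wbranch a b w).
Hypotheses (ch : contR h) (m0 : 0 < m) (mh : forall x, m <= h x).
Hypothesis dmuE : forall x, a <= x <= b -> dmu x = h x.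
Implicit Types (z : R[i]) (t C rho x e : R) (T : {poly R}).

Let r : R := (b - a) / 4.
Let r0 : 0 < r. Proof. exact: quarter_gt0. Qed.
Local Notation ze := (zeta a b w).
Local Notation xt := (xt a b).
Local Notation Kz := (Kz a b w).

Let h0 x : 0 < h x. Proof. exact: lt_le_trans (mh x). Qed.
Let pi0 : 0 < pi :> R. Proof. exact: pi_gt0. Qed.

(** Inside the segment, $\rho\, w_+$ at [xt t] is $2 \pi h$ times $2 r \sin t$. Its logarithm [LS]
    is split into the continuous part [lk] and the end singularity $\ln \sin t$. *)
Definition lk t : R := ln (2 * pi * h (xt t) * (2 * ((b - a) / 4))).
Definition LS t : R := lk t + ln (sin t).

Lemma lk_pos t : 0 < 2 * pi * h (xt t) * (2 * ((b - a) / 4)).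
Proof. by rewrite !mulr_gt0 ?quarter_gt0 ?invr_gt0 ?subr_gt0. Qed.

Lemma cont_lk : contR lk.
Proof.
apply: cont_ln; first exact: lk_pos.
have c1 := @cont_xt R a b; have c2 : contR (fun t => h (xt t)) by exact: cont_comp.
by cont.
Qed.

Lemma contoo_LS : contoo LS.
Proof. by move=> t ht; apply: catD; [exact: cont_lk|exact: contoo_ln_sin]. Qed.

Lemma LS_bound : exists2 C, 0 < C & forall t, 0 < t < pi -> `|LS t| <= C * sinVh t.
Proof.
have [C C0 hC] := bounded_segment 0 pi cont_lk.
exists (C + 2); first by rewrite addr_gt0.
move=> t ht; have /andP[l1 l2] := ln_sin_bound ht; have s1 := sinVh_ge1 ht.
rewrite /LS (le_trans (ler_normD _ _))// mulrDl; apply: lerD.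
  have : `|lk t| <= C by apply: hC; move/andP: ht => [/ltW -> /ltW ->].
  by move=> hl; rewrite (le_trans hl)// ler_peMr// ltW.
by rewrite -normrN ger0_norm.
Qed.

Let ysq x : R := Num.sqrt ((x - a) * (b - x)).

Let ysq_gt0 x : a < x < b -> 0 < ysq x.
Proof. by move=> /andP[? ?]; rewrite sqrtr_gt0 mulr_gt0// subr_gt0. Qed.

Let ysq_xt t : 0 < t < pi -> ysq (xt t) = 2 * r * sin t.
Proof.
move=> /sin_gt0_pi s0; rewrite /ysq /xt.
have -> : ((b + a) / 2 + 2 * ((b - a) / 4) * cos t - a) * (b - ((b + a) / 2 + 2 * ((b - a) / 4) * cos t)) =
  (2 * r * sin t) ^+ 2 by rewrite exprMn sin2cos2 /r; field.
rewrite sqrtr_sqr ger0_norm// mulr_ge0 ?(ltW s0)// mulr_ge0// ltW//.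
Qed.

(** The arcsine density turns into $dt$ under the cosine substitution. The formula for [f] is
    assumed only inside the interval because [wplusE] evaluates [wplus] only there. *)
Lemma Rint_arcsine (g f : R -> R) : contR g ->
  (forall x, a < x < b -> f x = ln (2 * pi * h x * Num.sqrt ((x - a) * (b - x))) /
     Num.sqrt ((x - a) * (b - x)) * g x) ->
  \int[leb]_(x in `[a, b]) f x = Iab 0 pi (fun t => LS t * g (xt t)).
Proof.
move=> cg hf.
pose u x := ln (2 * pi * h x * ysq x) * (ysq x)^-1 * g x.
have eab : ((b + a) / 2 - 2 * ((b - a) / 4) = a) /\ ((b + a) / 2 + 2 * ((b - a) / 4) = b).
  by split; field.
have cu : {in `]a, b[, continuous u}.
  move=> x; rewrite in_itv/= => hx; have y0 := ysq_gt0 hx.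
  have cy : {for x, continuous ysq}.
    apply: (@catC _ Num.sqrt (fun x => (x - a) * (b - x))); last exact: sqrt_continuous.
    by have c1 : contR (fun x => (x - a) * (b - x)); [cont|exact: c1].
  apply: (@catM _ (fun x => ln (2 * pi * h x * ysq x) * (ysq x)^-1) g); last exact: cg.
  apply: catM; last by apply: catV => //; rewrite gt_eqF.
  apply: (@catC _ (@ln R) (fun x => 2 * pi * h x * ysq x)).
    apply: (@catM _ (fun x => 2 * pi * h x) ysq) => //.
    by have c1 : contR (fun x => 2 * pi * h x); [cont|exact: c1].
  by apply: continuous_ln; rewrite !mulr_gt0.
have mu : measurable_fun `]a, b[ u.
  apply: open_continuous_measurable_fun; first exact: interval_open.
  by move=> x /set_mem /= hx; apply: cu.
have fu x : x \in `]a, b[%classic -> u x = f x.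
  by move=> /set_mem; rewrite /= in_itv/= => /hf ->.
have mf : measurable_fun `]a, b[ f by apply: eq_measurable_fun mu.
have -> : \int[leb]_(x in `[a, b]) f x = \int[leb]_(x in `[a, b]) u x.
  rewrite /Rintegral integral_itv_bndoo; last by apply/measurable_EFinP; exact: mf.
  rewrite [in RHS]integral_itv_bndoo; last by apply/measurable_EFinP; exact: mu.
  by congr fine; apply: eq_integral => x hx; rewrite fu.
have := @Rintegral_subst_open R u ((b + a) / 2) ((b - a) / 4) r0.
have [-> ->] := eab => /(_ cu) ->.
have eqv t : t \in `]0, pi[%classic -> u (xt t) * (2 * r * sin t) = LS t * g (xt t).
  move=> /set_mem; rewrite /= in_itv/= => ht.
  have s0 := sin_gt0_pi ht.
  rewrite /u ysq_xt// /LS /lk -/r -lnM ?posrE//; last exact: lk_pos.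
  rewrite (_ : 2 * pi * h (xt t) * (2 * r * sin t) = 2 * pi * h (xt t) * (2 * r) * sin t); last by ring.
  have y0 : 2 * r * sin t != 0 by rewrite gt_eqF//; apply: mulr_gt0 => //; exact: mulr_gt0.
  by rewrite mulrAC divfK.
have cv : contoo (fun t => LS t * g (xt t)).
  have c1 := @cont_xt R a b; have c2 : contR (fun t => g (xt t)) by exact: cont_comp.
  by apply: contoo_M => //; exact: contoo_LS.
rewrite (Iab_oo cv) /Iab /Rintegral integral_itv_bndoo; last first.
  apply/measurable_EFinP; apply: eq_measurable_fun (contoo_meas cv).
  by move=> t ht; rewrite -eqv.
by congr fine; apply: eq_integral => t ht; rewrite -eqv.
Qed.

Lemma szegoE z : ~ cseg a b z ->
  szego a b w dmu z = cexp (- ((2 * pi)^-1)%:C * cJ (fun t => (LS t)%:C * Kz z t)).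
Proof.
move=> zab; rewrite /szego; congr cexp.
pose k x : R[i] := (z - x%:C)^-1.
(* A real [z] outside the segment would be a pole of $1/(z - x)$; projecting $x$ onto the segment
   makes the kernel continuous on the whole line. *)
pose clp x : R := Num.max a (Num.min x b).
have cclp : contR clp.
  move=> x; apply: (@continuous_max _ _ (fun=> a) (fun x => Num.min x b)); first exact: cvg_cst.
  by apply: (@continuous_min _ _ (fun x => x) (fun=> b)); [exact: cvg_id|exact: cvg_cst].
have clpE x : a <= x <= b -> clp x = x.
  by move=> /andP[ax xb]; rewrite /clp; rewrite min_l// max_r.
have clpI x : a <= clp x <= b.
  by rewrite /clp le_max lexx /= ge_max (ltW ab) ge_min lexx orbT.
have zc x : z - (clp x)%:C != 0.
  rewrite subr_eq0; apply/eqP => e; apply: zab; rewrite e.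
  by exists (clp x) => //=; rewrite in_itv/= clpI.
have [ckr cki] := contC_inv cclp zc.
have ckin : contR (fun x => - Re (z - (clp x)%:C)^-1) by cont.
have fE x : a < x < b -> (ln (Re (rho dmu x * wplus w x)))%:C / (z - x%:C) / wplus w x =
   (ln (2 * pi * h x * ysq x) / ysq x)%:C * (Im (k x) +i* (- Re (k x))).
  move=> hx; have /andP[ax xb] := hx; have y0 := ysq_gt0 hx.
  rewrite (wplusE ab hw)// -/(ysq x) /rho dmuE ?(ltW ax) ?(ltW xb)//.
  have -> : Re (- (2 * pi)%:C * 'i%C * (h x)%:C * (0 +i* ysq x)) = 2 * pi * h x * ysq x by rewrite /=; ring.
  rewrite -/(k x); case: (k x) => u v.
  have -> : (0 +i* ysq x)^-1 = 0 +i* (- (ysq x)^-1).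
    apply/eqP; rewrite eq_complex /=; apply/andP; split; apply/eqP; first by rewrite mul0r.
    by field; rewrite gt_eqF.
  by apply/eqP; rewrite eq_complex /=; apply/andP; split; apply/eqP; ring.
have cI : cintegral `[a, b] (fun x => (ln (Re (rho dmu x * wplus w x)))%:C / (z - x%:C) / wplus w x) =
    - 'i%C * cJ (fun t => (LS t)%:C * (z - (xt t)%:C)^-1).
  have -> : - 'i%C * cJ (fun t => (LS t)%:C * (z - (xt t)%:C)^-1) =
     (Iab 0 pi (fun t => LS t * Im (k (xt t)))) +i* (- Iab 0 pi (fun t => LS t * Re (k (xt t)))).
    rewrite /cJ.
    have -> : (fun t => Re ((LS t)%:C * (z - (xt t)%:C)^-1)) = fun t => LS t * Re (k (xt t)).
      by apply/funext => t; rewrite -/(k _); case: (k _) => u v /=; rewrite mul0r subr0.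
    have -> : (fun t => Im ((LS t)%:C * (z - (xt t)%:C)^-1)) = fun t => LS t * Im (k (xt t)).
      by apply/funext => t; rewrite -/(k _); case: (k _) => u v /=; rewrite mul0r addr0.
    by apply/eqP; rewrite eq_complex /=; apply/andP; split; apply/eqP; ring.
  have xc t : clp (xt t) = xt t by rewrite clpE// xt_in.
  rewrite /cintegral (Rint_arcsine cki); last first.
    move=> x hx; rewrite fE// clpE; last by move/andP: hx => [/ltW -> /ltW ->].
    by rewrite -/(k x) -/(ysq x); case: (k x) => u v /=; ring.
  rewrite (Rint_arcsine ckin); last first.
    move=> x hx; rewrite fE// clpE; last by move/andP: hx => [/ltW -> /ltW ->].
    by rewrite -/(k x) -/(ysq x); case: (k x) => u v /=; ring.
  have [C C0 hC] := LS_bound.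
  have iR : intble 0 pi (fun t => LS t * Re (k (xt t))).
    have [D D0 hD] := bounded_segment a b ckr.
    have cg : contR (fun t => Re (z - (clp (xt t))%:C)^-1).
      by have c1 := @cont_xt R a b; apply: (cont_comp ckr).
    rewrite (_ : (fun t => _) = fun t => LS t * Re (z - (clp (xt t))%:C)^-1); last first.
      by apply/funext => t; rewrite xc.
    apply: (@dominated_intble _ _ (C * D)); first by apply: contoo_M => //; exact: contoo_LS.
    move=> t ht; rewrite normrM mulrAC; apply: ler_pM => //; first exact: hC.
    by apply: hD; exact: xt_in.
  apply/eqP; rewrite eq_complex /=; apply/andP; split; apply/eqP.
    by apply: Iab_eq => t _; rewrite xc.
  rewrite -mulN1r -IabZ//; apply: Iab_eq => t _; rewrite xc -/(k _); ring.
rewrite cI.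
have ck2 : contC (fun t => (z - (xt t)%:C)^-1).
  by apply: contC_inv; [exact: cont_xt|move=> t; exact: z_xt].
have [C C0 hC] := LS_bound.
have [D D0 hD] : exists2 D, 0 < D & forall t, 0 <= t <= pi -> normc ((z - (xt t)%:C)^-1) <= D.
  have [c1 c2] := ck2.
  have [D1 D10 h1] := bounded_segment 0 pi c1; have [D2 D20 h2] := bounded_segment 0 pi c2.
  exists (D1 + D2); first by rewrite addr_gt0.
  by move=> t ht; rewrite (le_trans (le_normc_ReIm _))// lerD ?h1 ?h2.
have CD : 0 <= C * D by rewrite mulr_ge0 ?(ltW C0) ?(ltW D0).
have [iF _] := @cJ_dominated _ LS _ _ CD contoo_LS ck2 (fun t ht =>
  le_trans (ler_pM (normr_ge0 _) (normc_ge0 _) (hC t ht)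
    (hD t (introT andP (conj (ltW (elimT andP ht).1) (ltW (elimT andP ht).2)))))
    (eq_ind _ (fun y => is_true (y <= _)) (lexx _) _ (mulrAC _ _ _))).
rewrite (_ : (fun t => (LS t)%:C * Kz z t) = (fun t => w z * ((LS t)%:C * (z - (xt t)%:C)^-1))); last first.
  by apply/funext => t; rewrite /Kz mulrCA.
rewrite cJZ//.
have p0 : (2 * pi)%:C != 0 :> R[i] by rewrite (fmorph_eq0 (real_complex R)) gt_eqF// mulr_gt0.
have i0 : 'i%C != 0 :> R[i] by rewrite eq_complex/= oner_eq0 andbF.
have -> : ((2 * pi)^-1)%:C = ((2 * pi)%:C)^-1 :> R[i] by rewrite fmorphV.
move: (cJ _) (w z) => J W; move: ((2 * pi)%:C) ('i%C : R[i]) p0 i0 => P I p0 i0.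
by field; rewrite p0 i0.
Qed.

(** The kernel tends to 1 at infinity. The factor 1 is written out so that the integrand has the
    shape of the one in [szegoE]. *)
Definition szinf : R[i] := cexp (- ((2 * pi)^-1)%:C * cJ (fun t => (LS t)%:C * 1)).

Let p2 : 0 < (2 * pi : R)^-1. Proof. by rewrite invr_gt0 mulr_gt0. Qed.

Lemma contC_Kz1 z : ~ cseg a b z -> contC (fun t => Kz z t - 1).
Proof.
move=> zab; apply: contC_D; [exact: contC_Kz|exact: contC_cst].
Qed.

Lemma LS_cint1 : cintble (fun t => (LS t)%:C * 1).
Proof.
have [C C0 hC] := LS_bound.
have [] // := @cJ_dominated _ LS (fun=> 1) C (ltW C0) contoo_LS (contC_cst 1).
by move=> t ht; rewrite Normc.normc1 mulr1; exact: hC.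
Qed.

(** [Kz - 1] is of order $\zeta$ uniformly in the angle; the factor $|\zeta|$ in the bound gives
    both the limit at infinity and the bounds on compact sets. *)
Lemma LS_kernel C : 0 < C -> (forall t, 0 < t < pi -> `|LS t| <= C * sinVh t) ->
  forall z rho, ~ cseg a b z -> normc (ze z) <= rho -> rho < 1 ->
  cintble (fun t => (LS t)%:C * (Kz z t - 1)) /\
  normc (cJ (fun t => (LS t)%:C * (Kz z t - 1))) <= 32 * (C * (4 * normc (ze z) / (1 - rho) ^+ 2)).
Proof.
move=> C0 hC z rho zab zr r1.
have B0 : 0 <= 4 * normc (ze z) / (1 - rho) ^+ 2.
  by rewrite divr_ge0 ?sqr_ge0// mulr_ge0// normc_ge0.
apply: cJ_dominated; [|exact: contoo_LS|exact: contC_Kz1|].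
  by rewrite mulr_ge0// ltW.
move=> t ht; rewrite mulrAC; apply: ler_pM => //; rewrite ?normc_ge0//; first exact: hC.
exact: Kz1_bound.
Qed.

Lemma szego_ratio z : ~ cseg a b z ->
  szego a b w dmu z = szinf * cexp (- ((2 * pi)^-1)%:C * cJ (fun t => (LS t)%:C * (Kz z t - 1))).
Proof.
move=> zab; rewrite szegoE// /szinf -cexpD -mulrDr; congr (cexp (_ * _)).
have [C C0 hC] := LS_bound.
have [iF _] := LS_kernel C0 hC zab (lexx _) (zeta_lt1 ab hw zab).
rewrite -cJD//; last exact: LS_cint1.
by apply: cJ_eq => t; ring.
Qed.

Lemma cexp_near1 (y : R[i]) : normc y <= 1 / 2 -> normc (cexp y - 1) <= 6 * normc y.
Proof.
move=> hy; have h1 := cexp_taylor hy.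
have := le_normcD (cexp y - 1 - y) y; rewrite subrK => h2.
apply: (le_trans h2); have := normc_ge0 y; nra.
Qed.

Lemma cseg_infty : exists M, forall z, M < normc z -> ~ cseg a b z.
Proof.
exists (`|a| + `|b|) => z hz /csegP[i0 /andP[h1 h2]].
move: hz; rewrite ltNge => /negP; apply.
rewrite (le_trans (le_normc_ReIm z))// i0 normr0 addr0.
rewrite ler_norml; have := ler_norm b; have := normr_ge0 b; have := normr_ge0 a.
by have := ler_norm (- a); rewrite normrN => ? ? ? ?; apply/andP; split; lra.
Qed.

Lemma szego_cvg e : 0 < e -> exists M, forall z, M < normc z -> normc (szego a b w dmu z / szinf - 1) < e.
Proof.
move=> e0; have [C C0 hC] := LS_bound.
pose d := Num.min (1 / 2) (e / 7).
have d0 : 0 < d by rewrite lt_min !divr_gt0.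
pose D := (2 * pi)^-1 * (32 * (C * (4 / (1 - 2^-1) ^+ 2))).
have D0 : 0 < D.
  have hh : 0 < 1 - 2^-1 :> R by lra.
  apply: mulr_gt0 => //; apply: mulr_gt0 => //; apply: mulr_gt0 => //; apply: divr_gt0 => //; exact: exprn_gt0.
have [M1 h1] := cseg_infty.
have [M2 h2] := @zeta_infty _ _ _ _ ab hw (Num.min (2^-1) (d / D)) ltac:(by rewrite lt_min invr_gt0 ltr0n divr_gt0).
exists (Num.max M1 M2) => z; rewrite gt_max => /andP[/h1 zab /h2].
rewrite lt_min => /andP[z2 zd].
have [_ hJ] := LS_kernel C0 hC zab (ltW z2) ltac:(by rewrite invf_lt1// ltr1n).
rewrite szego_ratio// mulrAC divff ?cexp_neq0// mul1r.
set y := _ * cJ _.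
have hy : normc y <= d.
  rewrite /y mulNr normcN Normc.normcM normcR gtr0_norm//.
  apply: (@le_trans _ _ (D * normc (ze z))).
    rewrite /D -[leRHS]mulrA ler_pM2l//; apply: le_trans hJ _.
    by rewrite le_eqVlt; apply/orP; left; apply/eqP; rewrite -!mulrA; do 3 congr (_ * _); rewrite mulrC.
  by rewrite mulrC -ler_pdivlMr// ltW.
have dle : d <= 1 / 2 by rewrite ge_min lexx.
have de : d <= e / 7 by rewrite ge_min lexx orbT.
rewrite (le_lt_trans (cexp_near1 (le_trans hy dle)))//; lra.
Qed.

Lemma szego_inftyE : szego_infty a b w dmu = szinf.
Proof.
rewrite /szego_infty; apply/cvg_lim; first exact: norm_hausdorff.
apply/cvg_cinftyP => e e0.
have n0 : 0 < normc szinf by rewrite lt_neqAle normc_ge0 andbT eq_sym normc_eq0 cexp_neq0.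
have [M hM] := szego_cvg (divr_gt0 e0 n0); exists M => z /hM.
rewrite ltr_pdivlMr// -Normc.normcM mulrBl divfK ?mul1r//.
exact: cexp_neq0.
Qed.

Lemma szego_ratio_bound rho : 0 <= rho < 1 -> exists2 B, 0 < B & forall z, ~ cseg a b z -> normc (ze z) <= rho ->
  normc (szego_infty a b w dmu / szego a b w dmu z) <= B.
Proof.
move=> /andP[rho0 rho1]; have [C C0 hC] := LS_bound.
pose Y := (2 * pi)^-1 * (32 * (C * (4 * rho / (1 - rho) ^+ 2))).
exists (expR Y); first exact: expR_gt0.
move=> z zab zr; have [_ hJ] := LS_kernel C0 hC zab zr rho1.
rewrite szego_inftyE szego_ratio// invfM mulrA divff ?cexp_neq0// mul1r -cexpN normc_cexp ler_expR.
rewrite (le_trans (ler_norm _))// (le_trans (Re_le_normc _))//.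
rewrite mulNr opprK Normc.normcM normcR gtr0_norm// ler_pM2l//.
apply: (le_trans hJ); rewrite ler_pM2l// ler_pM2l//.
by rewrite ler_wpM2r ?invr_ge0 ?sqr_ge0// ler_pM2l.
Qed.

(** Cosine polynomials are reproduced by the kernel, so $T(\zeta) - T_0$ is also an integral against
    [Kz - 1]. The quotient is thus the exponential of one such integral, whose density [l] is small
    relative to [sinVh]. *)
Lemma szego_compare rho e : 0 <= rho < 1 -> 0 < e -> exists2 d, 0 < d & forall s T,
  0 < s < 1 -> 1 - s <= d ->
  (forall t, `|2 * pc T t - (ln (h (xt t)) + 2^-1 * ln (qs s t))| <= d) ->
  forall z, ~ cseg a b z -> normc (ze z) <= rho ->
  normc (szego_infty a b w dmu / szego a b w dmu z * ((expR T`_0)%:C * cexp (- ceval T (ze z))) - 1) <= e.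
Proof.
move=> /andP[rho0 rho1] e0.
pose P := 4 / (1 - rho) ^+ 2.
have P0 : 0 < P by rewrite divr_gt0// exprn_gt0// subr_gt0.
pose Q := (2 * pi)^-1 * (32 * P).
have Q0 : 0 < Q by rewrite mulr_gt0// mulr_gt0.
pose d0 := Num.min (1 / 2) (e / 6).
have d00 : 0 < d0 by rewrite lt_min !divr_gt0.
pose d1 := Num.min 1 (d0 / (3 * Q)).
have d10 : 0 < d1 by rewrite lt_min ltr01 divr_gt0// mulr_gt0.
(* Squared because [qs_sin_bound] involves the square root of [1 - s]. *)
exists (d1 ^+ 2); first by rewrite exprn_gt0.
move=> s T s01 sd hT z zab zr; have /andP[s0 s1] := s01.
have hs : Num.sqrt (1 - s) <= d1.
  by rewrite -[leRHS]gtr0_norm// -sqrtr_sqr ler_wsqrtr.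
have d1e : d1 <= 1 by rewrite ge_min lexx.
have d12 : d1 ^+ 2 <= d1 by rewrite expr2 ler_piMr// ltW.
(* [Kz - 1] has mean zero, so any constant may be subtracted from the density; this one removes the
   scale factors and [ln (1 + s)]. *)
pose kap := ln (2 * pi * (2 * ((b - a) / 4))) - ln (1 + s).
pose l t := LS t - 2 * pc T t - kap.
have cl : contoo l.
  move=> t ht; apply: (@catD _ (fun t => LS t - 2 * pc T t) (fun=> - kap)); last exact: cvg_cst.
  apply: (@catD _ LS (fun t => - (2 * pc T t))); first exact: contoo_LS.
  have c1 := @cont_pc R T; have c2 : contR (fun t => - (2 * pc T t)) by cont.
  exact: c2.
have hl t : 0 < t < pi -> `|l t| <= 3 * d1 * sinVh t.
  move=> ht; have /andP[q1 q2] := qs_sin_bound s01 ht; have v1 := sinVh_ge1 ht.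
  have -> : l t = - (2 * pc T t - (ln (h (xt t)) + 2^-1 * ln (qs s t))) - (2^-1 * ln (qs s t) - ln (1 + s) - ln (sin t)).
    rewrite /l /LS /lk /kap.
    have -> : 2 * pi * h (xt t) * (2 * ((b - a) / 4)) = 2 * pi * (2 * ((b - a) / 4)) * h (xt t) by rewrite mulrAC.
    rewrite lnM ?posrE//; last by rewrite mulr_gt0// mulr_gt0 ?quarter_gt0.
    by ring.
  rewrite (le_trans (ler_normB _ _))// normrN (ger0_norm q1).
  have hT2 := hT t.
  apply: (@le_trans _ _ (d1 * sinVh t + 2 * d1 * sinVh t)).
    apply: lerD; first by rewrite (le_trans hT2)// (le_trans d12)// ler_peMr// ltW.
    rewrite (le_trans q2)// ler_wpM2r ?sinVh_ge0// ler_pM2l//.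
  by rewrite -mulrDl ler_wpM2r ?sinVh_ge0//; lra.
have z1 := zeta_lt1 ab hw zab.
have D0 : 0 <= 3 * d1 * P by rewrite mulr_ge0 ?(ltW P0)// mulr_ge0 ?(ltW d10).
have hKz t : normc (Kz z t - 1) <= P.
  rewrite (le_trans (Kz1_bound ab hw t zab zr rho1))// /P ler_wpM2r ?invr_ge0 ?sqr_ge0//.
  by rewrite ler_piMr// ltW.
have [il hJ] := cJ_dominated D0 cl (contC_Kz1 zab) (fun t ht =>
  le_trans (ler_pM (normr_ge0 _) (normc_ge0 _) (hl t ht) (hKz t))
    (eq_ind _ (fun y => is_true (y <= _)) (lexx _) _ (mulrAC _ _ _))).
have -> : szego_infty a b w dmu / szego a b w dmu z * ((expR T`_0)%:C * cexp (- ceval T (ze z))) =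
   cexp (((2 * pi)^-1)%:C * cJ (fun t => (l t)%:C * (Kz z t - 1))).
  rewrite szego_inftyE szego_ratio// invfM [szinf * _]mulrA divff ?cexp_neq0// mul1r.
  rewrite -cexpN -cexp_real -!cexpD; congr cexp; rewrite mulNr opprK.
  have [C C0 hC] := LS_bound.
  have [iL _] := LS_kernel C0 hC zab zr rho1.
  have cK1 := contC_Kz1 zab.
  have iT : cintble (fun t => (pc T t)%:C * (Kz z t - 1)).
    by apply/contC_intble/contC_M => //; apply/contC_real/cont_pc.
  have iK : cintble (fun t => (Kz z t - 1)) by exact: contC_intble.
  have -> : cJ (fun t => (l t)%:C * (Kz z t - 1)) =
     cJ (fun t => (LS t)%:C * (Kz z t - 1)) - 2 * cJ (fun t => (pc T t)%:C * (Kz z t - 1)) - kap%:C * cJ (fun t => Kz z t - 1).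
    rewrite -!cJZ// -cJB//; last exact: cintbleZ.
    rewrite -cJB; [|apply: cintbleD => //|exact: cintbleZ].
      apply: cJ_eq => t; rewrite /l !rmorphB rmorphM rmorph_nat; ring.
    have := cintbleZ (-2) iT; rewrite (_ : (fun t => -2 * _) = fun t => - (2 * ((pc T t)%:C * (Kz z t - 1))))//.
    by apply/funext => t; rewrite mulNr.
  have iKz : cintble (Kz z) by apply: contC_intble; exact: contC_Kz.
  have i1 : cintble (fun=> 1 : R[i]) by apply: contC_intble; exact: contC_cst.
  have E1 : cJ (fun t => Kz z t - 1) = 0.
    rewrite cJB//.
    have := cJ_pc_Kz ab hw 1%:P zab; rewrite cevalC mulr1.
    rewrite (cJ_eq (G := Kz z)) => [->|t]; last by rewrite pcC mul1r.
    rewrite /cJ /= !Iab_cst ?pi_ge0// mul0r mul1r subr0; exact: subrr.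
  have E2 : cJ (fun t => (pc T t)%:C * (Kz z t - 1)) = pi%:C * (ceval T (ze z) - (T`_0)%:C).
    rewrite mulrBr -(cJ_pc_Kz ab hw)//.
    have -> : pi%:C * (T`_0)%:C = cJ (fun t => (pc T t)%:C * 1).
      rewrite /cJ; apply/eqP; rewrite eq_complex /=; apply/andP; split; apply/eqP.
        rewrite mul0r subr0 -J_pc; apply: Iab_eq => t _; ring.
      rewrite (Iab_eq (g := fun=> 0)) ?Iab_cst ?pi_ge0//; first by ring.
      by move=> t _; ring.
    rewrite -cJB; [by apply: cJ_eq => t; ring| |].
      by apply/contC_intble/contC_M; [exact/contC_real/cont_pc|exact: contC_Kz].
    by apply/contC_intble/contC_M; [exact/contC_real/cont_pc|exact: contC_cst].
  rewrite E1 E2 mulr0 subr0.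
  have -> : ((2 * pi)^-1)%:C = (2 * pi%:C)^-1 :> R[i] by rewrite fmorphV rmorphM rmorph_nat.
  have pn0 : pi%:C != 0 :> R[i] by rewrite (fmorph_eq0 (real_complex R)) gt_eqF.
  by move: (cJ _) (pi%:C) pn0 => J p pn0; field.
set y := _ * cJ _.
have hy : normc y <= d0.
  rewrite /y Normc.normcM normcR gtr0_norm//.
  apply: (@le_trans _ _ (d1 * (3 * Q))).
    apply: (le_trans (ler_wpM2l (ltW p2) hJ)).
    by rewrite le_eqVlt; apply/orP; left; apply/eqP; rewrite /Q; move: (2 * pi)^-1 => p; ring.
  have q3 : 0 < 3 * Q by exact: mulr_gt0.
  by rewrite -ler_pdivlMr// /d1 ge_min lexx orbT.
have dle : d0 <= 1 / 2 by rewrite ge_min lexx.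
have de : d0 <= e / 6 by rewrite ge_min lexx orbT.
rewrite (le_trans (cexp_near1 (le_trans hy dle)))//; lra.
Qed.

End szego_function.

(** * Exterior asymptotics for a nearly polynomial weight *)

Section exterior_asymptotics.
Context {R : realType}.
Variables (a b : R) (w : R[i] -> R[i]) (h dmu : R -> R) (m M x0 : R) (k : nat).
Hypotheses (ab : a < b) (hw : is_wbranch a b w).
Hypotheses (ch : contR h) (m0 : 0 < m) (hmM : forall x, m <= h x <= M).
Hypothesis dmuE : forall x, a <= x <= b -> dmu x = h x.
Hypothesis x0ab : ~ cseg a b x0%:C.
Implicit Types (z : R[i]) (t x rho e d sg : R) (p q u : {poly R}).

Let r : R := (b - a) / 4.
Let r0 : 0 < r. Proof. exact: quarter_gt0. Qed.
Local Notation ze := (zeta a b w).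
Local Notation xt := (xt a b).

(** This brings $|x - x_0|^k$ to the form of a power of $|1 - a_0 z|^2$ on the circle, as the model
    weight [fi] requires. *)
Lemma dist_xt (a0 : R) : ze x0%:C = a0%:C -> a0 != 0 -> forall t,
  `|xt t - x0| = (b - a) / 4 / `|a0| * pn (1 - a0%:P * 'X) t.
Proof.
move=> hz a00 t; have e := zeta_jk ab hw x0ab.
have zC0 : a0%:C != 0 :> R[i] by rewrite (fmorph_eq0 (real_complex R)).
have := jk_sub a b t zC0; rewrite -{1}hz -e -rmorphB => hj.
have ev : (x0 - xt t)%:C = ((b - a) / 4)%:C * ((1 - a0%:C * ecirc t) * (1 - a0%:C * ecirc (- t))) / a0%:C by exact: hj.
have := congr1 (@Normc.normc R) ev; rewrite normcR distrC => ->.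
rewrite Normc.normcM Normc.normcV (Normc.normcM ((b - a) / 4)%:C) !normcR (Normc.normcM (1 - _)) (gtr0_norm r0).
have -> : normc (1 - a0%:C * ecirc (- t)) = normc (1 - a0%:C * ecirc t).
  have -> : 1 - a0%:C * ecirc (- t) = (1 - a0%:C * ecirc t)^*.
    by rewrite /ecirc cosN sinN; apply/eqP; rewrite eq_complex /=; apply/andP; split; apply/eqP; ring.
  by case: (1 - _) => u v /=; rewrite sqrrN.
by rewrite pnE cevalB cevalM !cevalC cevalX -expr2 mulrAC.
Qed.

Lemma pn_lower (a0 : R) t : `|a0| < 1 -> (1 - `|a0|) ^+ 2 <= pn (1 - a0%:P * 'X) t.
Proof.
move=> a01; rewrite pnE lerXn2r ?nnegrE ?normc_ge0 ?subr_ge0 ?(ltW a01)//.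
rewrite cevalB cevalM !cevalC cevalX; apply: den_ge => //.
by rewrite normcR.
Qed.

Lemma orth_poly n (v : R -> R) q : contR v ->
  (forall l, (l < n)%N -> Iab a b (fun x => q.[x] * x ^+ l * v x) = 0) ->
  forall u, (size u <= n)%N -> Iab a b (fun x => u.[x] * q.[x] * v x) = 0.
Proof.
move=> cv orth u un.
rewrite (Iab_eq (g := fun x => \sum_(i < size u) u`_i * (q.[x] * x ^+ i * v x))).
  rewrite (@Iab_sum _ _ _ _ (fun i x => u`_i * (q.[x] * x ^+ i * v x))).
    apply: big1 => i _; rewrite IabZ ?orth ?mulr0 ?(leq_trans _ un)//.
    by apply: cont_intble; cont.
  by move=> i; apply: cont_intble; cont.
move=> x _; rewrite horner_coef !mulr_suml; apply: eq_bigr => i _; ring.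
Qed.

(** [d] and [N] are chosen from the limit weight $|x - x_0|^k h$ before [p] and [q] are given; [sg]
    is the constant sign of [p] on the segment. The factor $(1 - \zeta_0 \zeta)^k$ accounts for $|x
    - x_0|^k$ in the Szego function of the limit weight. *)
Lemma exterior_asymptotics rho e : 0 <= rho < 1 -> 0 < e ->
  exists2 d, 0 < d & exists N : nat, forall n p q sg, (N <= n)%N ->
  q \is monic -> size q = n.+1 -> `|sg| = 1 ->
  (forall x, a <= x <= b -> [/\ 0 < sg * p.[x],
     sg * p.[x] <= (1 + d) * `|x - x0| ^+ k & `|x - x0| ^+ k <= (1 + d) * (sg * p.[x])]) ->
  (forall l, (l < n)%N -> Iab a b (fun x => q.[x] * x ^+ l * (p.[x] * h x)) = 0) ->
  forall z, ~ cseg a b z -> normc (ze z) <= rho ->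
  normc (ceval q z / phi a b w z ^+ n * (szego_infty a b w dmu / szego a b w dmu z) *
     (1 - ze x0%:C * ze z) ^+ k - 1) <= e.
Proof.
move=> rho01 e0; have /andP[rho0 rho1] := rho01.
have mh x : m <= h x by have /andP[] := hmM x.
have h0 x : 0 < h x by exact: lt_le_trans (mh x).
have pi0 := pi_gt0 R.
have [a0 [hz a01 a00]] := zeta_real ab hw x0ab.
have na0 : 0 < `|a0| by rewrite normr_gt0.
have dE := dist_xt hz a00.
pose C0 := ((b - a) / 4 / `|a0|) ^+ k.
have C00 : 0 < C0 by rewrite exprn_gt0// divr_gt0.
(* A lower bound for every admissible weight; the 2 comes from capping [d] at 1 below, so that
   [1 + d <= 2]. *)
pose m1 := C0 * (1 - `|a0|) ^+ 2 ^+ k * m / 2.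
have a02 : 0 < (1 - `|a0|) ^+ 2 by rewrite exprn_gt0// subr_gt0.
have m10 : 0 < m1.
  by rewrite /m1 divr_gt0// mulr_gt0// mulr_gt0// exprn_gt0.
have [B B0 hB] := szego_ratio_bound ab hw ch m0 mh dmuE rho01.
have e2 : 0 < e / 2 by rewrite divr_gt0.
have [d1 d10 hcmp] := szego_compare ab hw ch m0 mh dmuE rho01 e2.
pose W := B * 2 ^+ k.
have W0 : 0 < W by rewrite mulr_gt0// exprn_gt0.
(* Three errors of size [nu] separate the normalized [q] from the ideal [g], and [W] amplifies them;
   together they use up [e / 2]. *)
pose nu := e / (6 * W).
have nu0 : 0 < nu by rewrite divr_gt0// mulr_gt0.
have r2 : 0 < 1 - rho ^+ 2 by rewrite subr_gt0 expr_lt1.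
pose e1 := Num.min d1 (Num.min nu (nu ^+ 2 * (pi * m1) * (1 - rho ^+ 2) ^+ 3 / 16)).
have e10 : 0 < e1.
  rewrite !lt_min d10 nu0 /= divr_gt0// mulr_gt0 ?exprn_gt0// mulr_gt0 ?exprn_gt0//.
  exact: mulr_gt0.
have [s [T [g [H [d [s01 sd hT g0 [hg d0 hdef]]]]]]] :=
  @exists_small_defect R h m M ((b + a) / 2) ((b - a) / 4) a0 k C0 e1 ch m0 hmM r0 a01 C00 e10.
have e1d : e1 <= d1 by rewrite ge_min lexx.
have e1n : e1 <= nu by rewrite !ge_min lexx orbT.
have e1m : e1 <= nu ^+ 2 * (pi * m1) * (1 - rho ^+ 2) ^+ 3 / 16 by rewrite !ge_min lexx !orbT.
have cn0 : 0 <= coef_norm g by apply: sumr_ge0 => i _.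
have cn1 : 0 < coef_norm g + 1 by rewrite ltr_wpDl.
have [N1 hN1] := expr_small rho01 (divr_gt0 nu0 cn1).
exists (Num.min d 1); first by rewrite lt_min d0 ltr01.
exists (maxn N1 (size g)) => n p q sg; rewrite geq_max => /andP[nN ng] mq sq sg1 hp orth z zab zr.
set d' := Num.min d 1 in hp.
have dd : d' <= d by rewrite ge_min lexx.
have d'1 : d' <= 1 by rewrite ge_min lexx orbT.
pose f t := sg * p.[xt t] * h (xt t).
have cx := @cont_xt R a b.
have cf : contR f by have c1 := cont_comp ch cx; rewrite /f; cont.
have hpx t := hp (xt t) (xt_in ab t).
have dk t : `|xt t - x0| ^+ k = C0 * pn (1 - a0%:P * 'X) t ^+ k by rewrite dE exprMn.
have f0 t : 0 < f t by have [p0 _ _] := hpx t; exact: mulr_gt0.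
have fm t : m1 <= f t.
  have [p0 p1 p2] := hpx t.
  have h1 : C0 * (1 - `|a0|) ^+ 2 ^+ k <= 2 * (sg * p.[xt t]).
    apply: (@le_trans _ _ (`|xt t - x0| ^+ k)).
      rewrite dk ler_pM2l// lerXn2r ?nnegrE ?pn_ge0 ?(ltW a02)//; exact: pn_lower.
    by apply: (le_trans p2); rewrite ler_pM2r//; lra.
  rewrite /m1 /f mulrAC; apply: ler_pM => //.
  - by rewrite divr_ge0// mulr_ge0 ?(ltW C00)// exprn_ge0// ltW.
  - exact: ltW.
  - by rewrite ler_pdivrMr// [leRHS]mulrC.
have hf t : f t <= (1 + d) * (C0 * pn (1 - a0%:P * 'X) t ^+ k * h (xt t)) /\
    C0 * pn (1 - a0%:P * 'X) t ^+ k * h (xt t) <= (1 + d) * f t.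
  have [p0 p1 p2] := hpx t; rewrite -dk /f !mulrA; split.
    rewrite ler_pM2r//; apply: (le_trans p1); rewrite ler_wpM2r ?exprn_ge0// lerD2l//.
  rewrite -[(1 + d) * sg * _]mulrA ler_pM2r//; apply: (le_trans p2).
  by rewrite ler_pM2r// lerD2l.
have hdef1 := hdef f cf f0 hf.
have orthT u : (size u <= n)%N -> Iab 0 pi (fun t => u.[(b + a) / 2 + 2 * ((b - a) / 4) * cos t] *
    q.[(b + a) / 2 + 2 * ((b - a) / 4) * cos t] * (f t * sin t)) = 0.
  move=> un.
  have cv : contR (fun x => p.[x] * h x) by have c1 := @cont_id R; cont.
  have := orth_poly cv orth un.
  have eab : ((b + a) / 2 - 2 * ((b - a) / 4) = a) /\ ((b + a) / 2 + 2 * ((b - a) / 4) = b) by split; field.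
  have cU : contR (fun x => u.[x] * q.[x] * (p.[x] * h x)) by have c1 := @cont_id R; cont.
  have := Iab_subst ((b + a) / 2) r0 cU; have [-> ->] := eab => -> hI.
  have r2n : 2 * r != 0 by rewrite gt_eqF// mulr_gt0.
  apply: (mulfI r2n); rewrite mulr0 -IabZ; last first.
    by apply: cont_intble; have c1 := @cont_sin R _ (@cont_id R); cont.
  rewrite -[RHS](mulr0 sg) -[in RHS]hI -IabZ; last first.
    by apply: cont_intble; have c1 := cont_comp ch cx; rewrite /xt in c1; cont.
  apply: Iab_eq => t _; rewrite /f /xt -/r; ring.
have z0 := zeta_neq0 ab hw zab.
have hdn : 16 * core_defect f g H <= nu ^+ 2 * (pi * m1) * (1 - rho ^+ 2) ^+ 3.
  rewrite mulrC -ler_pdivlMr//; exact: le_trans e1m.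
have := core_asymptotics r0 ng g0 cf m10 fm mq sq orthT rho1 (ltW nu0) hdn z0 zr.
rewrite -(zeta_jk ab hw zab) => hX.
have phE : ceval q z * (ze z / ((b - a) / 4)%:C) ^+ n = ceval q z / phi a b w z ^+ n.
  by rewrite (phi_zeta w ab zab) -/r -exprVn invf_div.
rewrite phE in hX; rewrite hz.
have zl1 : normc (ze z) <= 1 by exact/ltW/zeta_lt1.
have hG := hg _ zl1.
set X := ceval q z / _ in hX *.
set V := szego_infty a b w dmu / _.
pose A := (1 - a0%:C * ze z) ^+ k.
set G := _ * _ ^+ k in hG.
have A0 : 1 - a0%:C * ze z != 0.
  rewrite subr_eq0; apply/eqP => ee; have := Normc.normc1 R; rewrite ee Normc.normcM normcR.
  have := zeta_lt1 ab hw zab; have := normc_ge0 (ze z); have := normr_ge0 a0; nra.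
have GA : G * A = (expR T`_0)%:C * cexp (- ceval T (ze z)).
  by rewrite /G /A -mulrA -exprMn mulVf// expr1n mulr1.
have -> : X * V * A - 1 = (X - G) * (V * A) + (V * (G * A) - 1) by ring.
rewrite GA.
have h1 := hcmp s T s01 (le_trans sd e1d) (fun t => le_trans (hT t) e1d) z zab zr.
have nA : normc A <= 2 ^+ k.
  rewrite /A normcX lerXn2r ?nnegrE ?normc_ge0//.
  rewrite (le_trans (le_normcB _ _))// Normc.normc1 Normc.normcM normcR.
  have := normr_ge0 a0; have := normc_ge0 (ze z); nra.
have nVA : normc (V * A) <= W.
  by rewrite Normc.normcM; apply: ler_pM; rewrite ?normc_ge0//; exact: hB.
have nXG : normc (X - G) <= 3 * nu.
  have -> : X - G = (X - ceval g (ze z)) + (ceval g (ze z) - G) by ring.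
  rewrite (le_trans (le_normcD _ _))//.
  have : rho ^+ n * coef_norm g <= nu.
    apply: (@le_trans _ _ (nu / (coef_norm g + 1) * (coef_norm g + 1))).
      by apply: ler_pM => //; [exact: exprn_ge0|exact: hN1|rewrite lerDl].
    by rewrite divfK// gt_eqF.
  by move: hX hG e1n; lra.
rewrite (le_trans (le_normcD _ _))//.
have : normc ((X - G) * (V * A)) <= 3 * nu * W.
  by rewrite Normc.normcM; apply: ler_pM; rewrite ?normc_ge0.
have : 3 * nu * W = e / 2 by rewrite /nu; field; rewrite gt_eqF.
by move: h1; rewrite -/V; lra.
Qed.

End exterior_asymptotics.

(** * From measures to integrals *)

Section density.
Context {R : realType}.
Variables (mu : {measure set (measurableTypeR R) -> \bar R}) (dmu : R -> R).
Hypothesis dens : is_density mu dmu.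
Implicit Types (a b x : R).

Import HBNNSimple.

Lemma ge0_integral_density (f : R -> \bar R) (E : set (measurableTypeR R)) : (forall x, 0 <= f x)%E ->
  measurable E -> measurable_fun E f ->
  (\int[mu]_(x in E) f x = \int[leb]_(x in E) (f x * (dmu x)%:E))%E.
Proof.
have [md d0 muE] := dens.
move=> f0 mE mf; pose g := EFin \o dmu.
have mg : measurable_fun setT g by exact/measurable_EFinP.
have g0 x : (0 <= g x)%E by rewrite lee_fin.
pose h := nnsfun_approx mE mf.
have -> : (\int[mu]_(x in E) f x =
    lim (\int[mu]_(x in E) (EFin \o h n) x @[n --> \oo]))%E.
  have fE x : E x -> f x = lim ((EFin \o h n) x @[n --> \oo]).
    by move=> Ex; apply/esym/cvg_lim => //; exact: cvg_nnsfun_approx.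
  under eq_integral => x /[!inE] /fE -> //.
  apply: monotone_convergence => //.
  - move=> n; apply/measurable_EFinP.
    by apply: (measurable_funS measurableT) => //; exact/measurable_funP.
  - by move=> n x Ex //=; rewrite lee_fin.
  - by move=> x Ex i j ij; rewrite lee_fin; exact/lefP/nd_nnsfun_approx.
have -> : (\int[leb]_(x in E) (f \* g) x =
    lim (\int[leb]_(x in E) ((EFin \o h n) \* g) x @[n --> \oo]))%E.
  have fg x : E x -> (f x * g x = lim (((EFin \o h n) \* g) x @[n --> \oo]))%E.
    by move=> Ex; apply/esym/cvg_lim => //; apply: cvgeZr => //; exact: cvg_nnsfun_approx.
  under eq_integral => x /[!inE] /fg -> //.
  apply: monotone_convergence => [//| | |].
  - move=> n; apply/emeasurable_funM; apply/measurable_funTS => //.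
    exact/measurable_EFinP.
  - by move=> n x Ex /=; rewrite mule_ge0 ?lee_fin.
  - by move=> x Ex i j ij /=; rewrite lee_wpmul2r//; rewrite lee_fin; exact/lefP/nd_nnsfun_approx.
suff suf n : (\int[mu]_(x in E) (EFin \o h n) x =
    \int[leb]_(x in E) ((EFin \o h n) x * g x))%E.
  by under eq_fun do rewrite suf.
have indich r : measurable_fun E (fun x => (r * \1_(h n @^-1` [set r]) x)%:E).
  apply/measurable_EFinP; apply: measurable_funM; first exact: measurable_cst.
  have mA : measurable (h n @^-1` [set r]) by []. exact: (@measurable_indic _ (measurableTypeR R) R E _ mA).
transitivity (\int[mu]_(x in E)
   (\sum_(y \in range (h n)) (y * \1_(h n @^-1` [set y]) x)%:E))%E.
  by apply: eq_integral => t tE; rewrite /= fimfunE -fsumEFin.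
rewrite ge0_integral_fsum//; last by move=> m y Ey; exact: nnfun_muleindic_ge0.
transitivity (\int[leb]_(x in E) (\sum_(y \in range (h n))
    ((y * \1_(h n @^-1` [set y]) x)%:E * g x)))%E; last first.
  apply: eq_integral => x xE.
  rewrite -ge0_mule_fsuml => [|y]; last exact: nnfun_muleindic_ge0.
  by rewrite fsumEFin // -(fimfunE _ x).
rewrite ge0_integral_fsum//; last 2 first.
  - by move=> y; apply: emeasurable_funM => //; exact: measurable_funTS.
  - by move=> m y Ey; rewrite mule_ge0// nnfun_muleindic_ge0.
apply: eq_fsbigr => r rhn.
under eq_integral do rewrite EFinM.
rewrite integralZl_indic_nnsfun//.
under [RHS]eq_integral do rewrite EFinM -muleA.
rewrite ge0_integralZl//; last 3 first.
- apply: emeasurable_funM; last exact/measurable_funTS.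
  by apply/measurable_EFinP; exact: (@measurable_indic _ (measurableTypeR R)).
- by move=> t Et; rewrite mule_ge0 ?lee_fin.
- by move: rhn; rewrite inE => -[t _ <-]; rewrite lee_fin.
congr (_ * _)%E; transitivity (\int[leb]_(x in E) ((g \_ (h n @^-1` [set r])) x))%E; last first.
  by apply: eq_integral => x xE; rewrite epatch_indic/= muleC.
rewrite -integral_mkcondr -muE; last exact: measurableI.
by rewrite integral_indic// setIC.
Qed.

Variables (a b : R).
Hypothesis supp : msupp mu = `[a, b]%classic.

(** A point off the support has a null neighbourhood, which contains a rational interval around it;
    there are countably many of these. *)
Lemma msupp_compl_null : mu (~` `[a, b]%classic) = 0%E.
Proof.
apply/negligibleP; first exact: measurableC.
pose F n : set (measurableTypeR R) := if (unpickle n : option (rat * rat)) is Some pq then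
  if mu `]ratr pq.1, ratr pq.2[%classic == 0%E then `]ratr pq.1, ratr pq.2[%classic else set0 else set0.
suff hF : mu.-negligible (\bigcup_n F n); last first.
  apply: negligible_bigcup => n; rewrite /F.
  case: (unpickle n) => [pq|]; last exact: negligible_set0.
  case: ifPn => [/eqP h|_]; last exact: negligible_set0.
  exact/negligibleP.
apply: negligibleS hF; rewrite -supp => x /existsNP[U] /not_implyP[oU] /not_implyP[Ux].
move=> /negP; rewrite -leNgt => mU.
have [e e0 eU] := (nbhs_ballP x U).1 (open_nbhs_nbhs (conj oU Ux)).
have xe : x - e < x by rewrite ltrBlDr ltrDl.
have ex : x < x + e by rewrite ltrDl.
have [p] := rat_in_itvoo xe; rewrite in_itv/= => /andP[p1 p2].
have [q] := rat_in_itvoo ex; rewrite in_itv/= => /andP[q1 q2].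
have I0 : mu `]ratr p, ratr q[%classic = 0%E.
  apply/eqP; rewrite eq_le measure_ge0 andbT; apply: le_trans mU.
  apply: le_measure; rewrite ?inE//; first exact: open_measurable.
  move=> y /=; rewrite in_itv/= => /andP[y1 y2]; apply: eU.
  by rewrite /ball/= ltr_norml; lra.
exists (pickle (p, q)); first exact: Logic.I.
by rewrite /F pickleK [_.1]/= [_.2]/= I0 eqxx /= in_itv/= p2.
Qed.

Lemma integral_density_Iab (h p : R -> R) : contR h -> (forall x, a <= x <= b -> dmu x = h x) ->
  contR p -> (\int[mu]_x (p x)%:E = 0)%E -> Iab a b (fun x => p x * h x) = 0.
Proof.
move=> ch dh cp.
have [md d0 _] := dens.
have mp : measurable_fun setT (EFin \o p).
  by apply/measurable_EFinP; exact: continuous_measurable_fun.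
have red (f : R -> \bar R) : (forall x, 0 <= f x)%E -> measurable_fun setT f ->
    (\int[mu]_x f x = \int[leb]_(x in `[a, b]) (f x * (h x)%:E))%E.
  move=> f0 mf; rewrite (@ge0_negligible_integral _ (measurableTypeR R) R mu setT _ f _ _ mf _ msupp_compl_null)//; last first.
    exact: measurableC.
  rewrite setTD setCK ge0_integral_density//; last exact: measurable_funTS.
  by apply: eq_integral => x; rewrite inE/= in_itv/= => /dh ->.
rewrite integralE red; [|by move=> x; exact: funepos_ge0|exact: measurable_funepos].
rewrite red; [|by move=> x; exact: funeneg_ge0|exact: measurable_funeneg].
move=> h0; rewrite /Iab /Rintegral.
suff -> : (\int[leb]_(x in `[a, b]) (p x * h x)%:E = 0)%E by [].
rewrite integralE -[RHS]h0; congr (_ - _)%E; apply: eq_integral => x;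
  rewrite inE/= in_itv/= => xab.
- rewrite !funeposE/= maxe_pMl ?mul0e ?EFinM//.
  by rewrite lee_fin -(dh _ xab).
- rewrite !funenegE maxe_pMl//; last by rewrite lee_fin -(dh _ xab).
  by rewrite mul0e EFinM mulNe.
Qed.

End density.

(** * Continuous weights and positive integrals *)

Section weight.
Context {R : realType}.
Implicit Types (a b x y c d L : R) (f h dmu : R -> R) (P T u : {poly R}) (s : seq R).

(** Composing the density with the projection onto the segment extends it continuously to the line.
    Nonnegativity and the nonvanishing extension make it positive, hence bounded below by its
    minimum. *)
Lemma continuous_weight a b dmu : a < b -> (forall x, 0 <= dmu x) ->
  holomorphic_nonvanishing_extension a b dmu ->
  exists h m M, [/\ contR h, 0 < m, forall x, m <= h x <= M & forall x, a <= x <= b -> dmu x = h x].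
Proof.
move=> ab d0 [U [H [_ sU hH H0 HE]]].
pose clp x : R := Num.max a (Num.min x b).
have cclp : contR clp.
  move=> x; apply: (@continuous_max _ _ (fun=> a) (fun x => Num.min x b)); first exact: cvg_cst.
  by apply: (@continuous_min _ _ (fun x => x) (fun=> b)); [exact: cvg_id|exact: cvg_cst].
have clpE x : a <= x <= b -> clp x = x.
  by move=> /andP[ax xb]; rewrite /clp; rewrite min_l// max_r.
have clpI x : a <= clp x <= b.
  by rewrite /clp le_max lexx /= ge_max (ltW ab) ge_min lexx orbT.
have cU x : U (clp x)%:C by apply: sU; exists (clp x) => //=; rewrite in_itv/= clpI.
have hE x : H (clp x)%:C = (dmu (clp x))%:C by apply: HE; rewrite in_itv/= clpI.
pose h x := dmu (clp x).
have ch : contR h.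
  move=> x; have /ctsP cH := cts_of_derivable (hH _ (cU x)).
  apply/cvgrPdist_lt => e e0; have [d dd hd] := cH e e0.
  have /cvgrPdist_lt/(_ d dd) := cclp x; apply: filterS => y hy.
  have := hd (clp y)%:C; rewrite -rmorphB normcR distrC => /(_ hy).
  by rewrite !hE -rmorphB normcR distrC.
have hp x : 0 < h x.
  rewrite lt_neqAle d0 andbT eq_sym; have := H0 _ (cU x).
  by rewrite hE; apply: contra => /eqP; rewrite /h => ->.
have hh x : h x = h (clp x) by rewrite /h [clp (clp x)]clpE.
have [c _ hc] := EVT_min (ltW ab) (continuous_subspaceT ch).
have [d _ hd] := EVT_max (ltW ab) (continuous_subspaceT ch).
exists h, (h c), (h d); split => // [x|x /clpE]; last by rewrite /h => ->.
by rewrite (hh x) hc ?hd// in_itv/= clpI.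
Qed.

Lemma Iab_lower a b c d L f : contR f -> (forall x, a <= x <= b -> 0 <= f x) ->
  a <= c -> c <= d -> d <= b -> (forall x, c <= x <= d -> L <= f x) -> L * (d - c) <= Iab a b f.
Proof.
move=> cf f0 ac cd db Lf.
apply: (@le_trans _ _ (Iab c d f)).
  rewrite -Iab_cst//; apply: Iab_le => //; apply: cont_intble => //; exact: cont_cst.
have sub : `[c, d]%classic `<=` `[a, b]%classic.
  by apply: subset_itv; rewrite bnd_simp.
have mf : measurable_fun `[a, b]%classic (EFin \o f).
  by apply/measurable_EFinP/measurable_funTS; exact: continuous_measurable_fun.
have h : (\int[leb]_(x in `[c, d]) (f x)%:E <= \int[leb]_(x in `[a, b]) (f x)%:E)%E.
  by apply: ge0_subset_integral => //= x; rewrite /= in_itv/= lee_fin => /f0.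
rewrite /Iab /Rintegral; apply: fine_le => //.
- exact: (integrable_fin_num _ (cont_intble c d cf)).
- exact: (integrable_fin_num _ (cont_intble a b cf)).
Qed.

Lemma Iab_eq0 a b f : a < b -> contR f -> (forall x, a <= x <= b -> 0 <= f x) ->
  Iab a b f = 0 -> forall x, a <= x <= b -> f x = 0.
Proof.
move=> ab cf f0 I0 x xab; apply/eqP; rewrite eq_le f0// andbT leNgt; apply/negP => fx.
have [d d0 hd] := @unif_cont_segment R f a b (f x / 2) cf ltac:(by rewrite divr_gt0).
have /andP[ax xb] := xab.
pose c := Num.max a (x - d / 2); pose e := Num.min b (x + d / 2).
have d2 : 0 < d / 2 by rewrite divr_gt0.
have cx : c <= x by rewrite ge_max ax gerBl ltW.
have xe : x <= e by rewrite le_min xb lerDl ltW.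
have ce : c < e by rewrite lt_min !gt_max ab; apply/andP; split; apply/andP; split; lra.
have ac : a <= c by rewrite le_max lexx.
have eb : e <= b by rewrite ge_min lexx.
have := @Iab_lower a b c e (f x / 2) f cf f0 ac (ltW ce) eb.
have hx y : c <= y <= e -> f x / 2 <= f y.
  move=> /andP[cy ye]; have c1 : x - d / 2 <= c by rewrite le_max lexx orbT.
  have e1 : e <= x + d / 2 by rewrite ge_min lexx orbT.
  have := hd x y xab; rewrite ltr_norml => /(_ ltac:(apply/andP; split; lra)).
  by rewrite ltr_norml => /andP[_]; lra.
move=> /(_ hx); rewrite I0 => h; move: h; rewrite leNgt => /negP; apply.
by rewrite mulr_gt0 ?divr_gt0// subr_gt0.
Qed.

End weight.

(** * Zeros of the multiple orthogonal polynomials *)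

Section zeros.
Context {R : realType}.
Implicit Types (a b x y c d L : R) (f h dmu : R -> R) (P T u : {poly R}) (s : seq R).

Local Notation XC s := (\prod_(y <- s) ('X - y%:P)).

(* Collect the roots in [[a, b]] one at a time, keeping those of odd
   multiplicity. *)
Lemma sign_changes a b P : a < b -> P != 0 ->
  exists s, [/\ uniq s, {in s, forall y, a <= y <= b}, XC s %| P &
    exists2 sg : R, `|sg| = 1 & forall x, a <= x <= b -> 0 <= sg * (P * XC s).[x]].
Proof.
move=> ab; have [n] := ubnP (size P); elim: n P => // n IH P /ltnSE Pn P0.
have [hp|/existsNP[x /not_implyP[xab /negP]]] := pselect (forall x, a <= x <= b -> 0 <= P.[x]).
  exists [::]; split => //; first by rewrite big_nil dvd1p.
  by exists 1; rewrite ?normr1// => x /hp; rewrite big_nil mulr1 mul1r.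
rewrite -ltNge => Px.
have [hp|/existsNP[y /not_implyP[yab /negP]]] := pselect (forall x, a <= x <= b -> P.[x] <= 0).
  exists [::]; split => //; first by rewrite big_nil dvd1p.
  by exists (-1); rewrite ?normrN1// => z /hp; rewrite big_nil mulr1 mulN1r oppr_ge0.
rewrite -ltNge => Py.
have [c cab] : exists2 c, a <= c <= b & root P c.
  have /andP[ax xb] := xab; have /andP[ay yb] := yab.
  have [xy|yx] := leP x y.
    have [c /andP[c1 c2] rc] := @poly_ivt R P x y xy ltac:(by rewrite (ltW Px) (ltW Py)).
    by exists c => //; rewrite (le_trans ax)// (le_trans c2).
  have [|c /andP[c1 c2] rc] := @poly_ivt R (- P) y x (ltW yx).
    by rewrite !hornerN oppr_le0 oppr_ge0 (ltW Px) (ltW Py).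
  by exists c; [rewrite (le_trans ay)// (le_trans c2)|rewrite -rootN].
move=> /factor_theorem[T PT].
have T0 : T != 0 by apply: contra_neq P0; rewrite PT => ->; rewrite mul0r.
have Tn : (size T < n)%N.
  by move: Pn; rewrite PT size_Mmonic ?monicXsubC// size_XsubC addn2.
have [s [us sab /dvdpP[T1 TT] [sg sg1 hs]]] := IH T Tn T0.
(* The factor ['X - c%:P] flips the parity of the multiplicity at [c], so membership of [c] in the
   list found for [T] is toggled. *)
have [cs|cs] := boolP (c \in s); last first.
  exists (c :: s); split.
  - by rewrite /= cs.
  - by move=> y0; rewrite inE => /orP[/eqP ->//|/sab].
  - by rewrite big_cons PT TT; apply/dvdpP; exists T1; rewrite mulrAC -mulrA.
  - exists sg => // z zab; rewrite big_cons PT.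
    have -> : (T * ('X - c%:P) * (('X - c%:P) * XC s)) = ('X - c%:P) ^+ 2 * (T * XC s) by ring.
    by rewrite hornerM mulrCA mulr_ge0 ?hs// horner_exp sqr_ge0.
have e : XC s = ('X - c%:P) * XC (rem c s).
  by rewrite (perm_big _ (perm_to_rem cs)) big_cons.
exists (rem c s); split.
- exact: rem_uniq.
- by move=> y0 /mem_rem /sab.
- apply/dvdpP; exists (T1 * ('X - c%:P) ^+ 2); rewrite PT TT e; ring.
- by exists sg => // z zab; rewrite PT -mulrA -e hs.
Qed.

(** With fewer than [n] sign changes, [XC s] would be an admissible test polynomial. The integral of
    a function of constant sign would vanish, and [P * XC s] would be zero on the whole segment. *)
Lemma orthogonal_zeros a b h P n : a < b -> contR h -> (forall x, 0 < h x) -> P != 0 ->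
  (forall l, (l < n)%N -> Iab a b (fun x => P.[x] * x ^+ l * h x) = 0) ->
  exists s, [/\ uniq s, {in s, forall y, a <= y <= b}, {in s, forall y, root P y} & (n <= size s)%N].
Proof.
move=> ab ch h0 P0 orth; have [s [us sab sP [sg sg1 hs]]] := sign_changes ab P0.
exists s; split => //.
  by move=> y ys; move/dvdpP: sP => [T ->]; rewrite rootM root_prod_XsubC ys orbT.
rewrite leqNgt; apply/negP => sn.
have c1 := @cont_id R.
have := @orth_poly R a b n h P ch orth (XC s); rewrite size_prod_XsubC => /(_ sn) I0.
have sg0 : sg != 0 by rewrite -normr_eq0 sg1 oner_neq0.
have Z x : a <= x <= b -> sg * ((P * XC s).[x] * h x) = 0.
  move=> xab; apply: (@Iab_eq0 R a b (fun x => sg * ((P * XC s).[x] * h x))) => //.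
  - by cont.
  - by move=> z zab; rewrite mulrA mulr_ge0 ?hs// ltW.
  - rewrite IabZ; last by apply: cont_intble; cont.
    rewrite (Iab_eq (g := fun x => (XC s).[x] * P.[x] * h x)) ?I0 ?mulr0//.
    by move=> z _; rewrite hornerM [(P.[z] * _)]mulrC.
have PX0 : P * XC s != 0 by rewrite mulf_neq0// -size_poly_eq0 size_prod_XsubC.
pose k := size (P * XC s).
(* [k.+1] distinct points of the segment, more than a nonzero polynomial of size [k] has roots. *)
pose rs := [seq a + i%:R / k.+1%:R * (b - a) | i <- iota 0 k.+1].
have rsu : uniq rs.
  rewrite map_inj_uniq ?iota_uniq// => i j /addrI /mulIf; rewrite subr_eq0 gt_eqF// => /(_ isT).
  by move=> /mulIf; rewrite invr_eq0 pnatr_eq0 => /(_ isT)/eqP; rewrite eqr_nat => /eqP.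
have : all (root (P * XC s)) rs.
  apply/allP => _ /mapP[i + ->]; rewrite mem_iota add0n => /andP[_ ik].
  set z := a + _.
  have i01 : 0 <= (i%:R / k.+1%:R : R) <= 1.
    by rewrite divr_ge0//= ler_pdivrMr ?ltr0n// mul1r ler_nat ltnW.
  have zab : a <= z <= b.
    have /andP[h1 h2] := i01; have ba : 0 <= b - a by rewrite subr_ge0 ltW.
    have := ler_wpM2r ba h2; have := mulr_ge0 h1 ba; rewrite /z mul1r.
    move: (_ / _ * _) => v ? ?; by apply/andP; split; lra.
  have /eqP := Z z zab; rewrite !mulf_eq0 (negbTE sg0) (gt_eqF (h0 z)) orbF /=.
  by [].
move=> /(max_poly_roots PX0)/(_ rsu); rewrite size_map size_iota.
by rewrite ltnNge leqW.
Qed.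

(** The segments are disjoint and the two zero counts add up to at least the degree, so both counts
    are exact and these are all the zeros. *)
Lemma root_splitting (a1 b1 a2 b2 : R) h1 h2 P n1 n2 : a1 < b1 -> a2 < b2 ->
  (forall x, a1 <= x <= b1 -> ~~ (a2 <= x <= b2)) ->
  contR h1 -> contR h2 -> (forall x, 0 < h1 x) -> (forall x, 0 < h2 x) ->
  P \is monic -> size P = (n1 + n2).+1 ->
  (forall l, (l < n1)%N -> Iab a1 b1 (fun x => P.[x] * x ^+ l * h1 x) = 0) ->
  (forall l, (l < n2)%N -> Iab a2 b2 (fun x => P.[x] * x ^+ l * h2 x) = 0) ->
  exists s1 s2, [/\ P = XC s1 * XC s2, size s1 = n1, size s2 = n2,
     {in s1, forall y, a1 <= y <= b1} & {in s2, forall y, a2 <= y <= b2}].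
Proof.
move=> ab1 ab2 dis ch1 ch2 h10 h20 mP sP o1 o2; have P0 := monic_neq0 mP.
have [s1 [u1 i1 r1 z1]] := orthogonal_zeros ab1 ch1 h10 P0 o1.
have [s2 [u2 i2 r2 z2]] := orthogonal_zeros ab2 ch2 h20 P0 o2.
have us : uniq (s1 ++ s2).
  rewrite cat_uniq u1 u2 andbT /=; apply/hasPn => y /i2 y2; apply/negP => /i1 /dis.
  by rewrite y2.
have rs : all (root P) (s1 ++ s2).
  by rewrite all_cat; apply/andP; split; apply/allP.
have := max_poly_roots P0 rs us; rewrite sP size_cat ltnS => ss.
have e1 : size s1 = n1.
  by apply/eqP; rewrite eqn_leq z1 andbT -(leq_add2r n2); apply: leq_trans ss; rewrite leq_add2l.
have e2 : size s2 = n2 by apply/eqP; rewrite eqn_leq z2 andbT -(leq_add2l n1) -{1}e1.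
exists s1, s2; split => //.
rewrite (@all_roots_prod_XsubC _ P (s1 ++ s2)) ?uniq_rootsE//; last by rewrite sP size_cat e1 e2.
by rewrite (monicP mP) scale1r big_cat.
Qed.

End zeros.

(** * Products over the zeros *)

Section products.
Context {R : realType}.
Implicit Types (x y c l v U : R) (s : seq R).

Local Notation XC s := (\prod_(y <- s) ('X - y%:P)).

Lemma prod_geometric s (F G : R -> R) c : 0 <= c ->
  {in s, forall y, 0 <= F y <= c * G y} ->
  \prod_(y <- s) F y <= c ^+ size s * \prod_(y <- s) G y.
Proof.
move=> c0 H; suff /andP[] : 0 <= \prod_(y <- s) F y <= c ^+ size s * \prod_(y <- s) G y by [].
elim: s H => [|y s IH] H; first by rewrite !big_nil expr0 mulr1 ler01 lexx.
have /andP[h1 h2] := H y (mem_head y s).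
have /andP[h3 h4] := IH (fun z zs => H z (mem_behead (s := y :: s) zs)).
rewrite !big_cons mulr_ge0//= exprS mulrACA; exact: ler_pM.
Qed.

Lemma prod_cst s c : \prod_(y <- s) c = c ^+ size s.
Proof. by elim: s => [|y s IH]; rewrite ?big_nil// big_cons IH exprS. Qed.

Lemma normr_prodXC s x : `|(XC s).[x]| = \prod_(y <- s) `|x - y|.
Proof. by rewrite horner_prod normr_prod; apply: eq_bigr => y _; rewrite hornerXsubC. Qed.

Lemma prodXC_le s x U : 0 <= U -> {in s, forall y, `|x - y| <= U} -> `|(XC s).[x]| <= U ^+ size s.
Proof.
move=> U0 H; have H' : {in s, forall y, 0 <= `|x - y| <= U * 1} by move=> y ys; rewrite mulr1 normr_ge0 H.
by have := @prod_geometric s (fun y => `|x - y|) (fun=> 1) U U0 H'; rewrite big1_eq mulr1 normr_prodXC.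
Qed.

Lemma prodXC_ge s x v : 0 <= v -> {in s, forall y, v <= `|x - y|} -> v ^+ size s <= `|(XC s).[x]|.
Proof.
move=> v0 H; have H' : {in s, forall y, 0 <= v <= 1 * `|x - y|} by move=> y ys; rewrite mul1r v0 H.
by have := @prod_geometric s (fun=> v) (fun y => `|x - y|) 1 ler01 H'; rewrite expr1n mul1r normr_prodXC prod_cst.
Qed.

(** Each point [y] costs a factor 6: the first or the last sixth, whichever is on the far side of
    the midpoint from [y], stays at distance at least [l / 6] from it. *)
Lemma subinterval_avoiding s c l : 0 < l ->
  exists c', [/\ c <= c', c' + l / 6 ^+ size s <= c + l &
    forall x, c' <= x <= c' + l / 6 ^+ size s -> {in s, forall y, l / 6 ^+ size s <= `|x - y|}].
Proof.
elim: s c l => [|y s IH] c l l0; first by exists c; split; rewrite ?divr1.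
have l6 : 0 < l / 6 by rewrite divr_gt0.
pose c1 := if y <= c + l / 2 then c + 5 * (l / 6) else c.
have [c' [h1 h2 h3]] := IH c1 (l / 6) l6.
have e6 : l / 6 ^+ (size s).+1 = l / 6 / 6 ^+ size s by rewrite exprS invfM mulrA.
exists c'; rewrite /= e6; split.
- by move: h1; rewrite /c1; case: ifP; lra.
- by move: h2; rewrite /c1; case: ifP; lra.
move=> x xc y'; rewrite inE => /orP[/eqP ->|]; last exact: h3.
apply: (@le_trans _ _ (l / 6)).
  by rewrite ler_pdivrMr ?exprn_gt0// ler_peMr ?(ltW l6)// exprn_ege1// ler1n.
have /andP[x1 x2] := xc; rewrite ler_normr; apply/orP.
by move: h1 h2; rewrite /c1; case: (leP y) => hy; [left|right]; lra.
Qed.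

Lemma expD1_le (t : R) k : 0 <= t <= 1 -> (1 + t) ^+ k <= 1 + 2 ^+ k * t.
Proof.
move=> t01; have /andP[t0 t1] := t01.
(* The chord of a convex function on $[0, 1]$; the induction requires its exact slope $2^k - 1$. *)
suff : (1 + t) ^+ k <= 1 + (2 ^+ k - 1) * t by move=> h; apply: (le_trans h); rewrite lerD2l ler_wpM2r// gerBl.
elim: k => [|k IH]; first by rewrite !expr0 subrr mul0r addr0.
rewrite !exprS; have k1 : 1 <= 2 ^+ k :> R by rewrite exprn_ege1// ler1n.
have h : (1 + t) * (1 + t) ^+ k <= (1 + t) * (1 + (2 ^+ k - 1) * t) by rewrite ler_wpM2l// addr_ge0.
apply: (le_trans h); have : 0 <= (2 ^+ k - 1) * (t * (1 - t)).
  by rewrite mulr_ge0 ?mulr_ge0// subr_ge0.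
lra.
Qed.

Lemma prod_near1 (I : eqType) (s : seq I) (F : I -> R[i]) (t : R) : 0 <= t ->
  {in s, forall j, normc (F j - 1) <= t} -> normc (\prod_(j <- s) F j - 1) <= (1 + t) ^+ size s - 1.
Proof.
move=> t0; elim: s => [|j s IH] H; first by rewrite big_nil !subrr Normc.normc0.
have h1 := H j (mem_head j s).
have h2 := IH (fun z zs => H z (mem_behead (s := j :: s) zs)).
rewrite big_cons /= exprS; set p := \prod_(_ <- _) _ in h2 *.
have -> : F j * p - 1 = (F j - 1) * p + (p - 1) by ring.
have h3 : normc p <= (1 + t) ^+ size s.
  have -> : p = (p - 1) + 1 by ring.
  by rewrite (le_trans (le_normcD _ _))// Normc.normc1 -lerBrDr.
rewrite (le_trans (le_normcD _ _))//.
have : normc ((F j - 1) * p) <= t * (1 + t) ^+ size s.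
  by rewrite Normc.normcM ler_pM ?normc_ge0.
by move: h2; lra.
Qed.

End products.

(* [tau (x - x0)] is the distance of [x] to the end [x0] of [[a', b']] farthest
   from [[a, b]]. *)
Section localisation.
Context {R : realType}.
Variables (a b a' b' x0 tau D gam : R) (h' : R -> R) (m' M' : R) (k : nat).
Hypotheses (ab' : a' < b') (tauE : (tau = 1 /\ x0 = a') \/ (tau = -1 /\ x0 = b')).
Hypotheses (gam0 : 0 < gam)
  (sep : forall s, a <= s <= b -> b' - a' + gam <= tau * (s - x0) <= D).
Hypotheses (ch' : contR h') (m0' : 0 < m') (hmM' : forall x, m' <= h' x <= M').
Implicit Types (x y d : R) (s : seq R).

Local Notation XC s := (\prod_(y <- s) ('X - y%:P)).
Let L := b' - a'.
Let L0 : 0 < L. Proof. by rewrite subr_gt0. Qed.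

Lemma tau_sqr : tau * tau = 1.
Proof. by case: tauE => -[-> _]; rewrite ?mulrNN mulr1. Qed.

Lemma tau_norm : `|tau| = 1.
Proof. by case: tauE => -[-> _]; rewrite ?normrN normr1. Qed.

Lemma tau_range x : (a' <= x <= b') = (0 <= tau * (x - x0) <= L).
Proof.
by case: tauE => -[-> ->]; rewrite /L; apply/idP/idP => /andP[? ?]; apply/andP; split; lra.
Qed.

(* Testing against the remaining zeros [x_j], the integral of
   [(x - y) prod_j (x - x_j)^2 q h'] vanishes.  The part of [[a', b']] near [x0]
   and the part beyond [y] contribute with opposite signs, but [q] is
   geometrically smaller on the latter if [y] stays away from [x0]. *)
Lemma zeros_localized d : 0 < d -> d <= L -> exists N : nat, forall n s s', (N <= n)%N ->
  size s = n -> size s' = k -> {in s, forall y, a <= y <= b} -> {in s', forall y, a' <= y <= b'} ->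
  (forall l, (l < k)%N -> Iab a' b' (fun x => (XC s' * XC s).[x] * x ^+ l * h' x) = 0) ->
  {in s', forall y, tau * (y - x0) <= 2 * d}.
Proof.
move=> d0 dL; have M0 : 0 < M' by have /andP[h1 h2] := hmM' 0; exact/(lt_le_trans m0')/(le_trans h1).
have h0 x : 0 < h' x by have /andP[h1 _] := hmM' x; exact: lt_le_trans h1.
have [->|k0] := posnP k; first by exists 0%N => n s s' _ _ /size0nil ->.
pose k1 := k.-1; have kE : k = k1.+1 by rewrite prednK.
(* The length of a subinterval near [x0] whose points keep distance [v] from the [k1] other zeros,
   as provided by [subinterval_avoiding]. *)
pose v := d / 6 ^+ k1; have v0 : 0 < v by rewrite divr_gt0 ?exprn_gt0.
pose A := d * (v ^+ k1 ^+ 2) * m' * v; pose B := L * (L ^+ k1 ^+ 2) * M' * L.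
have A0 : 0 < A by rewrite !mulr_gt0// !exprn_gt0.
have B0 : 0 < B by rewrite !mulr_gt0// !exprn_gt0.
pose E := Num.max D d * 2; have E0 : 0 < E by rewrite mulr_gt0// lt_max d0 orbT.
have DE : D <= E.
  have h1 : D <= Num.max D d by rewrite le_max lexx.
  have h2 : d <= Num.max D d by rewrite le_max lexx orbT.
  by rewrite /E; lra.
have dE : d <= E / 2 by rewrite /E mulfK// le_max lexx orbT.
(* A factor of [G] is $X - t$ with $X \le D \le E$. From $t = d$ to $t > 2d$ it loses more than [d],
   hence shrinks at least by the ratio [th]. *)
pose th := 1 - d / E.
have th01 : 0 <= th < 1.
  have h1 : 0 < d / E by rewrite divr_gt0.
  have h2 : d / E <= 1 by rewrite ler_pdivrMr//; lra.
  by rewrite /th; apply/andP; split; lra.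
have [N hN] := expr_small th01 (divr_gt0 A0 (mulr_gt0 (ltr0n _ 2 : 0 < (2 : R)) B0)).
exists N => n s s' Nn sn sk sab sab' orth y ys; rewrite leNgt; apply/negP => yd.
pose u := XC (rem y s'); pose sg x := tau * (x - x0); pose G t := \prod_(z <- s) (tau * (z - x0) - t).
set et := tau * (y - x0) in yd.
have et0L : 0 <= et <= L by rewrite /et -tau_range sab'.
have sru : size (rem y s') = k1 by rewrite size_rem// sk.
have e' : XC s' = ('X - y%:P) * u by rewrite (perm_big _ (perm_to_rem ys)) big_cons.
have qE x : (XC s).[x] = (- tau) ^+ n * G (sg x).
  rewrite /G -sn -prod_cst -big_split horner_prod; apply: eq_bigr => z _.
  rewrite hornerXsubC /sg /=; transitivity (tau * tau * (x - z)); last by ring.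
  by rewrite tau_sqr mul1r.
have G0 t : t <= L -> 0 < G t.
  move=> tL; rewrite /G big_seq; apply: prodr_gt0 => z /sab /sep /andP[h1 _].
  by move: h1 tL gam0; rewrite -/L; lra.
have Gle t1 t2 : t1 <= t2 -> t2 <= L -> G t2 <= G t1.
  move=> t12 t2L; rewrite -[leRHS]mul1r -[in leRHS](expr1n _ (size s)).
  apply: prod_geometric => // z /sab /sep /andP[h1 _].
  by move: h1 t2L t12 gam0; rewrite -/L; lra.
have Gth : G et <= th ^+ n * G d.
  have /andP[th0 _] := th01.
  rewrite -sn; apply: prod_geometric => // z /sab /sep /andP[h1 h2].
  apply/andP; split; first by move: h1 et0L gam0; rewrite -/L => ? /andP[]; lra.
  rewrite /th mulrBl mul1r; have : d / E * (tau * (z - x0) - d) <= d.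
    by rewrite mulrAC ler_pdivrMr// ler_pM2l//; lra.
  by move: yd; lra.
have ul x : a' <= x <= b' -> u.[x] ^+ 2 <= L ^+ k1 ^+ 2.
  move=> /andP[x1 x2]; rewrite -real_normK ?num_real// lerXn2r ?nnegrE ?exprn_ge0 ?(ltW L0)//.
  rewrite -sru; apply: prodXC_le; first exact: ltW.
  by move=> z /mem_rem /sab' /andP[z1 z2]; rewrite ler_norml /L; apply/andP; split; lra.
(* [c] fixes the sign of the integrand: it is nonnegative on the side of [x0], and beyond [y] it is
   at least [- C]. Adding [C] gives a nonnegative function of integral exactly [C * L], which bounds
   the contribution of any subinterval. *)
pose c := - tau * (- tau) ^+ n; pose C := L * (L ^+ k1 ^+ 2) * M' * G et.
pose P := XC s' * XC s.
have FE x : c * (u.[x] * P.[x] * h' x) = (et - sg x) * u.[x] ^+ 2 * G (sg x) * h' x.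
  rewrite /P e' !hornerM qE hornerXsubC /c.
  have -> : et - sg x = tau * (y - x) by rewrite /et /sg; ring.
  have nn : (- tau) ^+ n * (- tau) ^+ n = 1.
    by rewrite -exprMn mulrNN tau_sqr expr1n.
  transitivity (((- tau) ^+ n * (- tau) ^+ n) * (tau * (y - x) * u.[x] ^+ 2 * G (sg x) * h' x)); first by ring.
  by rewrite nn mul1r.
pose F x := c * (u.[x] * P.[x] * h' x) + C.
have c1 := @cont_id R.
have cF : contR F by rewrite /F; cont.
have GL : 0 < G et by apply: G0; case/andP: et0L.
have C0 : 0 <= C by rewrite /C !mulr_ge0 ?exprn_ge0 ?(ltW L0) ?(ltW M0) ?(ltW GL).
have F0 x : a' <= x <= b' -> 0 <= F x.
  move=> xab; have := xab; rewrite tau_range -/(sg x) => /andP[s1 s2].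
  have /andP[e1 e2] := et0L.
  have /andP[hh1 hh2] := hmM' x.
  have gx := G0 _ s2.
  rewrite /F FE; have [xe|xe] := leP (sg x) et.
    by rewrite addr_ge0// mulr_ge0 ?(ltW (h0 x))// mulr_ge0 ?(ltW gx)// mulr_ge0 ?sqr_ge0// subr_ge0.
  suff : (sg x - et) * u.[x] ^+ 2 * G (sg x) * h' x <= C by lra.
  have -> : C = L * L ^+ k1 ^+ 2 * G et * M' by rewrite /C mulrAC.
  have i1 : 0 <= (sg x - et) by lra.
  apply: ler_pM => //; [by rewrite mulr_ge0 ?(ltW gx)// mulr_ge0 ?sqr_ge0|exact/ltW|].
  apply: ler_pM => //; [by rewrite mulr_ge0 ?sqr_ge0|exact/ltW| |by apply: Gle => //; exact: ltW].
  by apply: ler_pM; rewrite ?sqr_ge0 ?ul//; lra.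
have IF : Iab a' b' F = C * L.
  rewrite IabD; [|by apply: cont_intble; cont|by apply: cont_intble; cont].
  rewrite IabZ; last by apply: cont_intble; cont.
  have := @orth_poly R a' b' k h' P ch' orth u; rewrite size_prod_XsubC sru kE => /(_ (leqnn _)) ->.
  by rewrite mulr0 add0r Iab_cst// ltW.
(* The left end of the interval of length [d] at [x0] inside $[a', b']$: it is [x0] for [tau = 1]
   and [x0 - d] for [tau = -1]. *)
pose c0 := x0 + (tau - 1) / 2 * d.
have [cc [c01 c02 hc]] := subinterval_avoiding (rem y s') c0 d0.
rewrite sru -/v in c02 hc.
have rg x : c0 <= x <= c0 + d -> [/\ a' <= x <= b' & 0 <= sg x <= d].
  rewrite tau_range /c0 /sg; case: tauE => -[-> _] /andP[h1 h2].
    by split; apply/andP; split; lra.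
  by split; apply/andP; split; lra.
have lo x : cc <= x <= cc + v -> d * v ^+ k1 ^+ 2 * m' * G d <= F x.
  move=> xc; have /andP[x1 x2] := xc.
  have [xab' /andP[s1 s2]] : [/\ a' <= x <= b' & 0 <= sg x <= d].
    by apply: rg; apply/andP; split; lra.
  have /andP[hh1 hh2] := hmM' x.
  have Gd : 0 < G d by exact: G0.
  rewrite /F FE -[leLHS]addr0; apply: lerD; last first.
    by rewrite /C !mulr_ge0 ?exprn_ge0 ?(ltW L0) ?(ltW M0) ?(ltW GL)//.
  have -> : d * v ^+ k1 ^+ 2 * m' * G d = d * v ^+ k1 ^+ 2 * G d * m' by rewrite mulrAC.
  have k20 : 0 <= v ^+ k1 ^+ 2 by rewrite !exprn_ge0 ?(ltW v0).
  apply: ler_pM => //; [by rewrite mulr_ge0 ?(ltW Gd)// mulr_ge0 ?(ltW d0)|exact: ltW|].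
  apply: ler_pM => //; [by rewrite mulr_ge0 ?(ltW d0)|exact: ltW| |exact: Gle].
  apply: ler_pM => //; [exact: ltW|by lra|].
  rewrite -[leRHS]real_normK ?num_real// lerXn2r ?nnegrE ?exprn_ge0 ?(ltW v0)//.
  by rewrite -sru; apply: prodXC_ge; [exact: ltW|exact: hc].
have cl : a' <= cc by have [/andP[]] := rg cc ltac:(apply/andP; split; lra).
have cr : cc + v <= b' by have [/andP[]] := rg (cc + v) ltac:(apply/andP; split; lra).
have := Iab_lower cF F0 cl (_ : cc <= cc + v) cr lo; rewrite lerDl (ltW v0) => /(_ isT).
rewrite IF [cc + v]addrC addrK => hfin.
have Gd : 0 < G d by exact: G0.
have : A * G d <= B * th ^+ n * G d.
  apply: (@le_trans _ _ (C * L)); first by move: hfin; rewrite /A mulrAC.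
  have -> : C * L = B * G et by rewrite /C /B; ring.
  by rewrite -mulrA ler_pM2l.
rewrite ler_pM2r// => h1.
have B2 : 0 < 2 * B by exact: mulr_gt0.
have := hN n Nn; rewrite (ler_pdivlMr _ _ B2) => h2.
by move: h1 h2 A0; lra.
Qed.

End localisation.

(** * Asymptotics for a fixed number of outer zeros *)

Section fixed_number_of_outer_zeros.
Context {R : realType}.
Variables (a b : R) (w S : R[i] -> R[i]) (h dmu : R -> R) (m M : R).
Variables (a' b' x0 tau D gam : R) (h' : R -> R) (m' M' : R) (k : nat).
Hypotheses (ab : a < b) (hw : is_wbranch a b w).
Hypotheses (ch : contR h) (m0 : 0 < m) (hmM : forall x, m <= h x <= M).
Hypothesis dmuE : forall x, a <= x <= b -> dmu x = h x.
Hypotheses (ab' : a' < b') (tauE : (tau = 1 /\ x0 = a') \/ (tau = -1 /\ x0 = b')).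
Hypotheses (gam0 : 0 < gam)
  (sep : forall s, a <= s <= b -> b' - a' + gam <= tau * (s - x0) <= D).
Hypotheses (ch' : contR h') (m0' : 0 < m') (hmM' : forall x, m' <= h' x <= M').
Hypothesis hS : is_szego_factor a b w x0 S.
Implicit Types (x y : R) (z : R[i]) (P : {poly R}).

Local Notation XC s := (\prod_(y <- s) ('X - y%:P)).

Lemma x0_notin : ~ cseg a b x0%:C.
Proof.
move=> /csegP[_ /= /sep]; rewrite subrr mulr0 => /andP[h1 _].
by move: ab' gam0 h1; lra.
Qed.

(** Localization of the zeros of [XC s'] is used twice: on $[a, b]$ it makes [XC s'] close to $|x -
    x_0|^k$ up to sign, so [exterior_asymptotics] applies to [XC s]; away from [x0] it makes the
    quotient [Y] of [XC s'] by $(z - x_0)^k$ close to 1. *)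
Lemma asymptotics_fixed_k rho r0 e : 0 <= rho < 1 -> 0 < r0 -> 0 < e ->
  exists N : nat, forall n P, (N <= n)%N -> P \is monic -> size P = (k + n).+1 ->
  (forall l, (l < k)%N -> Iab a' b' (fun x => P.[x] * x ^+ l * h' x) = 0) ->
  (forall l, (l < n)%N -> Iab a b (fun x => P.[x] * x ^+ l * h x) = 0) ->
  forall z, ~ cseg a b z -> normc (zeta a b w z) <= rho -> r0 <= normc (z - x0%:C) ->
  normc (ceval P z / (szego a b w dmu z / szego_infty a b w dmu * S z ^+ k *
     (z - x0%:C) ^+ k * phi a b w z ^+ n) - 1) <= e.
Proof.
move=> rho01 r00 e0.
have h0 x : 0 < h x by have /andP[h1 _] := hmM x; exact: lt_le_trans h1.
have h0' x : 0 < h' x by have /andP[h1 _] := hmM' x; exact: lt_le_trans h1.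
pose e1 := Num.min e 1 / 3.
have me0 : 0 < Num.min e 1 by rewrite lt_min e0 ltr01.
have e10 : 0 < e1 by rewrite divr_gt0.
have e1e : 3 * e1 <= e by rewrite /e1 mulrCA divff// mulr1 ge_min lexx.
have e11 : 3 * e1 <= 1 by rewrite /e1 mulrCA divff// mulr1 ge_min lexx orbT.
have [d d0 [N1 hN1]] := exterior_asymptotics k ab hw ch m0 hmM dmuE x0_notin rho01 e10.
have k20 : 0 < 2 ^+ k :> R by exact: exprn_gt0.
pose t := Num.min 1 (Num.min d e1 / 2 ^+ k).
have mde : 0 < Num.min d e1 by rewrite lt_min d0.
have t0 : 0 < t by rewrite lt_min ltr01 divr_gt0.
have t1 : t <= 1 by rewrite ge_min lexx.
have kt : 2 ^+ k * t <= Num.min d e1 by rewrite mulrC -ler_pdivlMr// ge_min lexx orbT.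
have t01 : 0 <= t <= 1 by rewrite (ltW t0).
have ktd : (1 + t) ^+ k <= 1 + d.
  by apply: (le_trans (expD1_le k t01)); rewrite lerD2l (le_trans kt)// ge_min lexx.
have kte : (1 + t) ^+ k <= 1 + e1.
  by apply: (le_trans (expD1_le k t01)); rewrite lerD2l (le_trans kt)// ge_min lexx orbT.
have L0 : 0 < b' - a' by rewrite subr_gt0.
(* The zeros end up within [2 * dd] of [x0]. The second bound serves the quotient at distance [r0]
   from [x0], the third the weight on $[a, b]$, whose distance from [x0] is at least
   [b' - a' + gam]. *)
pose dd := Num.min (b' - a') (Num.min (t * r0 / 2) (t * (b' - a' + gam) / 4)).
have Lg : 0 < b' - a' + gam by exact: addr_gt0.
have dd0 : 0 < dd by rewrite !lt_min L0 !divr_gt0// mulr_gt0.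
have ddL : dd <= b' - a' by rewrite ge_min lexx.
have ddr : 2 * dd <= t * r0.
  by have : dd <= t * r0 / 2 by [rewrite !ge_min lexx orbT]; lra.
have ddg : 4 * dd <= t * (b' - a' + gam).
  by have : dd <= t * (b' - a' + gam) / 4 by [rewrite !ge_min lexx !orbT]; lra.
have [N2 hN2] := zeros_localized k ab' tauE gam0 sep ch' m0' hmM' dd0 ddL.
have disj x : a' <= x <= b' -> ~~ (a <= x <= b).
  rewrite (tau_range tauE) => /andP[_ h1]; apply/negP => /sep /andP[h2 _].
  by move: h1 h2 gam0; lra.
have taun := tau_norm tauE; have tau2 := tau_sqr tauE.
exists (maxn N1 N2) => n P; rewrite geq_max => /andP[n1 n2] mP sP o1 o2 z zab zr zx.
have [s' [s [PE ks ns i1 i2]]] := root_splitting ab' ab disj ch' ch h0' h0 mP sP o1 o2.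
rewrite PE in o1 o2 *.
have loc := hN2 n s s' n2 ns ks i2 i1 o1.
have sr y : y \in s' -> 0 <= tau * (y - x0) by move=> /i1; rewrite (tau_range tauE) => /andP[].
pose sg := tau ^+ k.
have sg1 : `|sg| = 1 by rewrite normrX taun expr1n.
have pE x : sg * (XC s').[x] = \prod_(y <- s') (tau * (x - x0) - tau * (y - x0)).
  rewrite /sg -ks -prod_cst horner_prod -big_split; apply: eq_bigr => y _ /=.
  by rewrite hornerXsubC; ring.
have hp x : a <= x <= b -> [/\ 0 < sg * (XC s').[x],
     sg * (XC s').[x] <= (1 + d) * `|x - x0| ^+ k & `|x - x0| ^+ k <= (1 + d) * (sg * (XC s').[x])].
  move=> /sep /andP[x1 _].
  have -> : `|x - x0| = tau * (x - x0).
    by rewrite -[`|_|]mul1r -taun -normrM ger0_norm// (le_trans _ x1)// ltW.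
  rewrite pE; set X := tau * (x - x0) in x1 *.
  have X0 : 0 < X by exact: lt_le_trans x1.
  have dX : 4 * dd <= t * X by apply: (le_trans ddg); rewrite ler_pM2l.
  have tX : t * X <= X by rewrite ger_pMl.
  have pos : {in s', forall y, 0 < X - tau * (y - x0)}.
    by move=> y /loc; lra.
  have p0 : 0 < \prod_(y <- s') (X - tau * (y - x0)).
    by rewrite big_seq; apply: prodr_gt0 => y /pos.
  split => //.
  - have H' : {in s', forall y, 0 <= X - tau * (y - x0) <= 1 * X}.
      by move=> y ys; rewrite (ltW (pos y ys)) mul1r gerBl sr.
    have := @prod_geometric R s' (fun y => X - tau * (y - x0)) (fun=> X) 1 ler01 H'.
    rewrite expr1n mul1r prod_cst ks => /le_trans -> //.
    by rewrite ler_peMl ?exprn_ge0 ?(ltW X0)// lerDl ltW.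
  - have H' : {in s', forall y, 0 <= X <= (1 + t) * (X - tau * (y - x0))}.
      move=> y ys; rewrite (ltW X0) /=.
      have y0 := sr y ys; have y1 := loc y ys.
      have : t * (tau * (y - x0)) <= tau * (y - x0) by exact: ler_piMl.
      lra.
    have t1' : 0 <= 1 + t by lra.
    have := @prod_geometric R s' (fun=> X) (fun y => X - tau * (y - x0)) (1 + t) t1' H'.
    rewrite prod_cst ks => /le_trans -> //.
    by rewrite ler_pM2r.
have mq : XC s \is monic by exact: monic_prod_XsubC.
have sq : size (XC s) = n.+1 by rewrite size_prod_XsubC ns.
have oq l : (l < n)%N -> Iab a b (fun x => (XC s).[x] * x ^+ l * ((XC s').[x] * h x)) = 0.
  by move=> /o2 <-; apply: Iab_eq => x _; rewrite hornerM; ring.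
have hq := hN1 n (XC s') (XC s) sg n1 mq sq sg1 hp oq z zab zr.
have zx0 : z - x0%:C != 0 by rewrite -normc_eq0 gt_eqF// (lt_le_trans r00).
have zx0' : z <> x0%:C by move=> zE; rewrite zE subrr eqxx in zx0.
rewrite (szego_factorE ab hw x0_notin hS zab zx0') cevalM.
set X := ceval (XC s) z / _ * _ * _ in hq.
pose Y := \prod_(y <- s') ((z - y%:C) / (z - x0%:C)).
have -> : ceval (XC s') z * ceval (XC s) z / (szego a b w dmu z / szego_infty a b w dmu *
     ((1 - zeta a b w x0%:C * zeta a b w z)^-1) ^+ k * (z - x0%:C) ^+ k * phi a b w z ^+ n) = Y * X.
  have -> : Y = ceval (XC s') z / (z - x0%:C) ^+ k.
    rewrite /Y ceval_prod big_split /= -ks; congr (_ * _).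
    by elim: (s') => [|y s0 IH]; rewrite ?big_nil ?invr1// big_cons exprS invfM IH.
  rewrite /X !invfM exprVn !invrK.
  ring.
have hY : normc (Y - 1) <= e1.
  have H' : {in s', forall y, normc ((z - y%:C) / (z - x0%:C) - 1) <= t}.
    move=> y ys; have -> : (z - y%:C) / (z - x0%:C) - 1 = (x0 - y)%:C / (z - x0%:C).
      by rewrite rmorphB/=; field.
    rewrite Normc.normcM Normc.normcV normcR ler_pdivrMr ?(lt_le_trans r00)//.
    apply: (@le_trans _ _ (t * r0)); last by rewrite ler_pM2l.
    have -> : `|x0 - y| = tau * (y - x0).
      by rewrite distrC -[LHS]mul1r -taun -normrM ger0_norm ?sr.
    exact: le_trans (loc y ys) ddr.
  apply: (le_trans (prod_near1 (ltW t0) H')); rewrite ks.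
  by move: kte; lra.
have -> : Y * X - 1 = (Y - 1) * X + (X - 1) by ring.
rewrite (le_trans (le_normcD _ _))//.
have nX : normc X <= 2.
  have -> : X = (X - 1) + 1 by ring.
  by rewrite (le_trans (le_normcD _ _))// Normc.normc1; move: hq e11; lra.
have : normc ((Y - 1) * X) <= e1 * 2 by rewrite Normc.normcM ler_pM ?normc_ge0.
by move: hq e1e; lra.
Qed.

End fixed_number_of_outer_zeros.

(** * Compact subsets of the extended plane *)

Section extended_plane.
Context {R : realType}.
Implicit Types (x y e M : R) (z : R[i]).

Lemma compact_cbox M : compact [set z : R[i] | `|Re z| <= M /\ `|Im z| <= M].
Proof.
pose f (p : R * R) : R[i] := p.1 +i* p.2.
have cf : continuous f.
  move=> p; apply/(@cvgrPdist_lt _ _ _ (nbhs p) (nbhs_filter p)) => e; case: e => e e'.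
  rewrite ltcE/= => /andP[/eqP -> e0].
  have e2 : 0 < e / 2 by rewrite divr_gt0.
  apply/nbhs_ballP; exists (e / 2) => // q [/= q1 q2].
  rewrite normrcE ltcR; apply: (le_lt_trans (le_normc_ReIm _)) => /=.
  by move: q1 q2; rewrite /ball/=; lra.
have -> : [set z : R[i] | `|Re z| <= M /\ `|Im z| <= M] = f @` (`[- M, M] `*` `[- M, M]).
  apply/seteqP; split => [[u v] /= [hu hv]|_ [[u v] /= [hu hv] <-] /=].
    by exists (u, v) => //=; rewrite !in_itv/= -!ler_norml.
  by move: hu hv; rewrite !in_itv/= -!ler_norml.
apply: continuous_compact; first exact: continuous_subspaceT.
by apply: compact_setX; exact: segment_compact.
Qed.

Definition infty_one (f : R[i] -> R[i]) : Prop :=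
  forall e, 0 < e -> exists M, forall z, M < normc z -> normc (f z - 1) < e.

Lemma infty_oneM f g : infty_one f -> infty_one g -> infty_one (fun z => f z * g z).
Proof.
move=> hf hg e e0; pose t := Num.min e 1 / 3.
have me0 : 0 < Num.min e 1 by rewrite lt_min e0 ltr01.
have t0 : 0 < t by rewrite divr_gt0.
have te : 3 * t <= e by rewrite /t mulrCA divff// mulr1 ge_min lexx.
have t1 : 3 * t <= 1 by rewrite /t mulrCA divff// mulr1 ge_min lexx orbT.
have [M1 h1] := hf t t0; have [M2 h2] := hg t t0.
exists (Num.max M1 M2) => z; rewrite gt_max => /andP[/h1 z1 /h2 z2].
have -> : f z * g z - 1 = (f z - 1) * (g z - 1) + (f z - 1) + (g z - 1) by ring.
apply: (le_lt_trans (le_normcD _ _)).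
have := le_normcD ((f z - 1) * (g z - 1)) (f z - 1).
rewrite Normc.normcM; have := normc_ge0 (f z - 1); have := normc_ge0 (g z - 1).
by move: z1 z2; nra.
Qed.

Lemma infty_one_cst1 : infty_one (fun=> 1).
Proof. by move=> e e0; exists 0 => z _; rewrite subrr Normc.normc0. Qed.

Lemma infty_oneX f n : infty_one f -> infty_one (fun z => f z ^+ n).
Proof.
move=> hf; elim: n => [|n IH]; first exact: infty_one_cst1.
rewrite (_ : (fun z => _) = fun z => f z * f z ^+ n); first exact: infty_oneM.
by apply/funext => z; rewrite exprS.
Qed.

Lemma infty_oneV f : infty_one f -> infty_one (fun z => (f z)^-1).
Proof.
move=> hf e e0; have [M hM] := hf (Num.min (e / 2) 2^-1) ltac:(by rewrite lt_min (divr_gt0 e0)//= invr_gt0 ltr0n).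
exists M => z /hM; rewrite lt_min => /andP[z1 z2].
have f2 : 2^-1 < normc (f z).
  have := le_normcD (f z) (1 - f z); rewrite addrCA subrr addr0 Normc.normc1 (normcB 1).
  have : (2^-1 : R) * 2 = 1 by rewrite mulVf.
  by move: z2; lra.
have fz : f z != 0 by rewrite -normc_eq0 gt_eqF// (lt_trans _ f2)// invr_gt0.
have -> : (f z)^-1 - 1 = (1 - f z) / f z by field.
rewrite Normc.normcM Normc.normcV normcB ltr_pdivrMr ?(lt_trans _ f2)// ?invr_gt0//.
apply: (lt_le_trans z1); rewrite ler_pM2l// ltW//.
Qed.

Lemma infty_one_prod s : infty_one (fun z => \prod_(y <- s) ((z - y%:C) / z)).
Proof.
elim: s => [|y s IH].
  rewrite (_ : (fun z => _) = fun=> 1); first exact: infty_one_cst1.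
  by apply/funext => z; rewrite big_nil.
rewrite (_ : (fun z => _) = fun z => (z - y%:C) / z * \prod_(y <- s) ((z - y%:C) / z)); last first.
  by apply/funext => z; rewrite big_cons.
apply: infty_oneM => // e e0; exists (`|y| / e) => z.
rewrite ltr_pdivrMr// => h.
have z0 : z != 0.
  by rewrite -normc_eq0; apply/eqP => zz; move: h; rewrite zz mul0r ltNge normr_ge0.
have -> : (z - y%:C) / z - 1 = - y%:C / z by field.
rewrite Normc.normcM Normc.normcV normcN normcR ltr_pdivrMr; first by rewrite mulrC.
by rewrite lt_neqAle normc_ge0 eq_sym normc_eq0 z0.
Qed.

Variables (a b : R) (w : R[i] -> R[i]) (x0 : R).
Hypotheses (ab : a < b) (hw : is_wbranch a b w).

(** Both bounds are written with one parameter [d] tending to 0 and hold near each point of [K] for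
    small [d]; compactness makes [d] uniform. Near infinity, $\zeta$ is small and every [d] below
    one half works. *)
Lemma compact_away (K : set (sphere R)) : compact K ->
  K `<=` ~` (Some @` ([set x0%:C] `|` cseg a b)) ->
  exists rho r0, [/\ 0 <= rho < 1, 0 < r0 & forall z, K (Some z) ->
    [/\ ~ cseg a b z, normc (zeta a b w z) <= rho & r0 <= normc (z - x0%:C)]].
Proof.
move=> cK KD.
have Kz z : K (Some z) -> ~ cseg a b z /\ z <> x0%:C.
  by move=> /KD h; split => h'; apply: h; exists z => //; [right|left].
pose Q (d : R) (p : sphere R) : Prop := if p is Some z then
  normc (zeta a b w z) <= 1 - d /\ d <= normc (z - x0%:C) else True.
suff : \forall d \near (0 : R)^'+, K `<=` Q d.
  move=> H.
  have [d [d0 d1 hd]] : exists d : R, [/\ 0 < d, d < 1 & K `<=` Q d].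
    have h1 : \forall d \near (0 : R)^'+, 0 < d by exact: nbhs_right_gt.
    have h2 : \forall d \near (0 : R)^'+, d < 1 by exact: nbhs_right_lt.
    have h3 := filterI (filterI h1 h2 : nbhs (0 : R)^'+ _) H.
    by have [d [[? ?] ?]] := filter_ex (h3 _ _); exists d.
  exists (1 - d), d; split => //; first by apply/andP; split; lra.
  by move=> z Kz0; have [? ?] := Kz z Kz0; have [? ?] := hd _ Kz0.
move/compact_near_coveringP : cK => /(_ R 0^'+ Q _); apply => -[z|] Kp.
  have [zab zx] := Kz z Kp.
  have z1 := zeta_lt1 ab hw zab.
  pose e := (1 - normc (zeta a b w z)) / 2; have e0 : 0 < e by rewrite divr_gt0// subr_gt0.
  have cz : {for z, continuous (zeta a b w)}.
    apply: (@continuousM _ _ (fun=> _) (fun z => (phi a b w z)^-1)); first exact: cts_cst.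
    apply: continuousV; first exact: phi_neq0.
    exact: cts_phi.
  have /ctsP/(_ e e0) [d d0 hd] := cz.
  have nx : 0 < normc (z - x0%:C).
    by rewrite lt_neqAle normc_ge0 eq_sym normc_eq0 subr_eq0 andbT; apply/eqP.
  pose d1 := Num.min d (normc (z - x0%:C) / 2).
  have d10 : 0 < d1 by rewrite lt_min d0 divr_gt0.
  exists (Some @` [set y | normc (y - z) < d1], [set t | t < Num.min e (normc (z - x0%:C) / 2)]) => /=.
    split.
      apply: one_point_compactification_some_nbhs; apply/nbhs_ballP; exists d1%:C; first by rewrite /= ltcR.
      by move=> y; rewrite -ball_normE /ball_ /= normrcE ltcR normcB.
    by apply: nbhs_right_lt; rewrite lt_min e0 divr_gt0.
  move=> [_ t] /= [[y /= + <-]]; rewrite !lt_min => /andP[/hd y1 y2] /andP[t1 t2].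
  split.
    have := normc_dist (zeta a b w y) (zeta a b w z); rewrite ler_norml => /andP[_].
    by move: y1 t1; rewrite /e; lra.
  have := normc_dist (y - x0%:C) (z - x0%:C); rewrite opprB addrA subrK ler_norml => /andP[h _].
  by move: y2 t2 h; lra.
have [M1 h1] := @zeta_infty _ _ _ _ ab hw 2^-1 ltac:(by rewrite invr_gt0).
pose M2 := `|x0| + 1.
pose M := Num.max M1 M2.
exists ((Some @` (~` [set z : R[i] | `|Re z| <= M /\ `|Im z| <= M])) `|` [set None],
   [set t : R | t < 2^-1]) => /=.
  split; last by apply: nbhs_right_lt; rewrite invr_gt0.
  exists [set z : R[i] | `|Re z| <= M /\ `|Im z| <= M] => //.
  split; first exact: compact_cbox.
  by apply: compact_closed; [exact: norm_hausdorff|exact: compact_cbox].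
move=> [p t] /= [[[y hy <-]|->]] //= t1.
have yM : M < normc y.
  rewrite ltNge; apply/negP => h; apply: hy; split.
    exact: le_trans (Re_le_normc y) h.
  exact: le_trans (Im_le_normc y) h.
move: yM; rewrite gt_max => /andP[/h1 y1 y2].
have : (2^-1 : R) * 2 = 1 by rewrite mulVf.
split; first by lra.
have := normc_dist y (y - x0%:C); rewrite opprB addrCA subrr addr0 normcR ler_norml => /andP[_].
by move: y2; rewrite /M2; lra.
Qed.

End extended_plane.

(** * The theorem *)

Section one_sided.
Context {R : realType}.
Variables (a b : R) (w S : R[i] -> R[i]) (h dmu : R -> R) (m M : R).
Variables (a' b' x0 tau D gam : R) (h' : R -> R) (m' M' : R).
Hypotheses (ab : a < b) (hw : is_wbranch a b w).
Hypotheses (ch : contR h) (m0 : 0 < m) (hmM : forall x, m <= h x <= M).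
Hypothesis dmuE : forall x, a <= x <= b -> dmu x = h x.
Hypotheses (ab' : a' < b') (tauE : (tau = 1 /\ x0 = a') \/ (tau = -1 /\ x0 = b')).
Hypotheses (gam0 : 0 < gam)
  (sep : forall s, a <= s <= b -> b' - a' + gam <= tau * (s - x0) <= D).
Hypotheses (ch' : contR h') (m0' : 0 < m') (hmM' : forall x, m' <= h' x <= M').
Hypothesis hS : is_szego_factor a b w x0 S.
Variables (P : nat * nat -> {poly R}) (kk nn : nat * nat -> nat).
Hypotheses (kn : forall n, (kk n + nn n = n.1 + n.2)%N).
Hypotheses (mP : forall n, P n \is monic) (sP : forall n, size (P n) = (kk n + nn n).+1).
Hypothesis o1 : forall n l, (l < kk n)%N -> Iab a' b' (fun x => (P n).[x] * x ^+ l * h' x) = 0.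
Hypothesis o2 : forall n l, (l < nn n)%N -> Iab a b (fun x => (P n).[x] * x ^+ l * h x) = 0.
Implicit Types (x y : R) (z : R[i]).

Local Notation XC s := (\prod_(y <- s) ('X - y%:P)).
Local Notation main n z := (szego a b w dmu z / szego_infty a b w dmu *
   S z ^+ kk n * (z - x0%:C) ^+ kk n * phi a b w z ^+ nn n).

(** Numerator and denominator are both equivalent to the same power of [z] with coefficient 1. So
    for each fixed multi-index the value of the ratio at infinity is exactly 1. *)
Lemma ratio_infty n : infty_one (fun z => ceval (P n) z / main n z).
Proof.
have h0 x : 0 < h x by have /andP[h1 _] := hmM x; exact: lt_le_trans h1.
have h0' x : 0 < h' x by have /andP[h1 _] := hmM' x; exact: lt_le_trans h1.
have mh x : m <= h x by have /andP[] := hmM x.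
have disj x : a' <= x <= b' -> ~~ (a <= x <= b).
  rewrite (tau_range tauE) => /andP[_ h1]; apply/negP => /sep /andP[h2 _].
  by move: h1 h2 gam0; lra.
have [s' [s [PE ks ns _ _]]] := root_splitting ab' ab disj ch' ch h0' h0 (mP n) (sP n) (@o1 n) (@o2 n).
have iz : infty_one (fun z => szego a b w dmu z / szego_infty a b w dmu).
  rewrite (szego_inftyE ab hw ch m0 mh dmuE) => e.
  exact: szego_cvg ab hw ch m0 mh dmuE _.
have iS : infty_one S by case: hS => _ _ /cvg_cinftyP.
have ip : infty_one (fun z => phi a b w z / z) by exact: phi_infty hw.
have ix := infty_one_prod [:: x0].
have ir := infty_one_prod (s' ++ s).
have := infty_oneM ir (infty_oneV (infty_oneM (infty_oneM iz (infty_oneX (kk n) iS))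
  (infty_oneM (infty_oneX (kk n) ix) (infty_oneX (nn n) ip)))).
move=> H e e0; have [N hN] := H e e0.
exists (Num.max N 0) => z; rewrite gt_max => /andP[/hN + z0].
have zn : z != 0 by rewrite -normc_eq0 gt_eqF.
suff -> : ceval (P n) z / main n z = \prod_(y <- s' ++ s) ((z - y%:C) / z) *
    (szego a b w dmu z / szego_infty a b w dmu * S z ^+ kk n *
     ((\prod_(y <- [:: x0]) ((z - y%:C) / z)) ^+ kk n * (phi a b w z / z) ^+ nn n))^-1 by [].
have -> : \prod_(y <- s' ++ s) ((z - y%:C) / z) = ceval (P n) z / z ^+ (kk n + nn n).
  rewrite PE -big_cat ceval_prod big_split /= -ks -ns -size_cat; congr (_ * _).
  by elim: (s' ++ s) => [|y s0 IH]; rewrite ?big_nil ?invr1// big_cons exprS invfM IH.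
move: (phi a b w z) => f; rewrite big_seq1 !expr_div_n exprD.
have zk : z ^+ kk n != 0 by rewrite expf_neq0.
have zn' : z ^+ nn n != 0 by rewrite expf_neq0.
move: zk zn'; set U := z ^+ kk n; set V := z ^+ nn n => zk zn'.
set Z := (z - _) ^+ _; set F := f ^+ _; set A := szego a b w dmu z / _; set B := S z ^+ _.
set X := ceval _ _.
clearbody U V Z F A B X; rewrite !invfM !invrK.
transitivity ((U^-1 * U) * (V^-1 * V) * (X * (A^-1 * B^-1 * Z^-1 * F^-1))); last by ring.
by rewrite !mulVf// !mul1r.
Qed.

(** Boundedness of [kk n] leaves finitely many values of [k], so the thresholds obtained for each
    [k] have a maximum. *)
Lemma one_sided_asymptotics (N0 : set (nat * nat)) :
  (exists2 C : R, 0 < C & forall n, N0 n -> (kk n)%:R <= C) ->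
  locally_unif_equiv N0 (~` (Some @` ([set x0%:C] `|` cseg a b)))
    (fun n z => ceval (P n) z) (fun n z => main n z).
Proof.
move=> [C C0 hC] K cK KD eps e0.
have [rho [r0 [rho01 r00 hK]]] := compact_away ab hw cK KD.
have e2 : 0 < eps / 2 by rewrite divr_gt0.
have /choice[Nf hNf] := fun k => asymptotics_fixed_k k ab hw ch m0 hmM dmuE ab' tauE gam0 sep
  ch' m0' hmM' hS rho01 r00 e2.
pose B := Num.bound C.
(* The summand [B] absorbs [kk n], so that a large total degree makes [nn n] exceed every
   threshold. *)
exists (\max_(k < B) Nf k + B)%N => n Nn nB [z|] Kz; last first.
  rewrite /sphere_ratio.
  have -> : lim (ceval (P n) z / main n z @[z --> cinfty]) = 1.
    by apply/cvg_lim; [exact: norm_hausdorff|apply/cvg_cinftyP; exact: ratio_infty].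
  by rewrite subrr normr0 ltcR.
have kB : (kk n < B)%N.
  by rewrite -(ltr_nat R) (le_lt_trans (hC n Nn))// archi_boundP// ltW.
have [zab zr zx] := hK z Kz.
have Nk : (Nf (kk n) <= nn n)%N.
  apply: (@leq_trans (\max_(k < B) Nf k)); first exact: (leq_bigmax (Ordinal kB)).
  by rewrite -(leq_add2l (kk n)) kn (leq_trans _ nB)// addnC leq_add2l ltnW.
have := hNf (kk n) (nn n) (P n) Nk (mP n) (sP n) (@o1 n) (@o2 n) z zab zr zx.
rewrite normrcE ltcR => /le_lt_trans -> //.
by rewrite ltr_pdivrMr// ltr_pMr// ltr1n.
Qed.

End one_sided.

Theorem theorem3p1 (R : realType) (a1 b1 a2 b2 : R)
  (lt_a1b1 : a1 < b1) (lt_b1a2 : b1 < a2) (lt_a2b2 : a2 < b2)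
  (mu1 mu2 : {measure set (measurableTypeR R) -> \bar R})
  (dmu1 dmu2 : R -> R)
  (dens1 : is_density mu1 dmu1) (dens2 : is_density mu2 dmu2)
  (supp1 : msupp mu1 = `[a1, b1]%classic) (supp2 : msupp mu2 = `[a2, b2]%classic)
  (hol1 : holomorphic_nonvanishing_extension a1 b1 dmu1)
  (hol2 : holomorphic_nonvanishing_extension a2 b2 dmu2)
  (P : nat * nat -> {poly R})
  (typeII : forall n, is_typeII mu1 mu2 n (P n))
  (w1 w2 : R[i] -> R[i])
  (hw1 : is_wbranch a1 b1 w1) (hw2 : is_wbranch a2 b2 w2)
  (S St : R[i] -> R[i])
  (hS : is_szego_factor a2 b2 w2 a1 S)
  (hSt : is_szego_factor a1 b1 w1 b2 St) :
  (forall N0 : set (nat * nat), infinite_set N0 ->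
     (exists2 C : R, 0 < C & forall n, N0 n -> (n.1)%:R <= C) ->
     locally_unif_equiv N0
       (~` (Some @` ([set a1%:C] `|` cseg a2 b2)))
       (fun n z => ceval (P n) z)
       (fun n z => szego a2 b2 w2 dmu2 z / szego_infty a2 b2 w2 dmu2 *
          S z ^+ n.1 * (z - a1%:C) ^+ n.1 * phi a2 b2 w2 z ^+ n.2)) /\
  (forall N1 : set (nat * nat), infinite_set N1 ->
     (exists2 C : R, 0 < C & forall n, N1 n -> (n.2)%:R <= C) ->
     locally_unif_equiv N1
       (~` (Some @` (cseg a1 b1 `|` [set b2%:C])))
       (fun n z => ceval (P n) z)
       (fun n z => szego a1 b1 w1 dmu1 z / szego_infty a1 b1 w1 dmu1 *
          St z ^+ n.2 * (z - b2%:C) ^+ n.2 * phi a1 b1 w1 z ^+ n.1)).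
Proof.
have [_ d1 _] := dens1; have [_ d2 _] := dens2.
have [h1 [m1 [M1 [ch1 m10 hm1 hE1]]]] := continuous_weight lt_a1b1 d1 hol1.
have [h2 [m2 [M2 [ch2 m20 hm2 hE2]]]] := continuous_weight lt_a2b2 d2 hol2.
have cp n l : contR (fun x => (P n).[x] * x ^+ l) by have c1 := @cont_id R; cont.
have o1 n l : (l < n.1)%N -> Iab a1 b1 (fun x => (P n).[x] * x ^+ l * h1 x) = 0.
  by case: (typeII n) => _ _ + _ => /[apply]; exact: integral_density_Iab dens1 _ _ supp1 _ _ ch1 hE1 (cp n l).
have o2 n l : (l < n.2)%N -> Iab a2 b2 (fun x => (P n).[x] * x ^+ l * h2 x) = 0.
  by case: (typeII n) => _ _ _ /[apply]; exact: integral_density_Iab dens2 _ _ supp2 _ _ ch2 hE2 (cp n l).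
have mP n : P n \is monic by case: (typeII n).
have sP n : size (P n) = (n.1 + n.2).+1 by case: (typeII n).
have sP' n : size (P n) = (n.2 + n.1).+1 by rewrite sP addnC.
have g0 : 0 < a2 - b1 by rewrite subr_gt0.
split => [N0 _ hC|N1 _ hC].
  (* The gap [gam] is [a2 - b1], so the lower bound in the separation hypothesis becomes [a2 - a1];
     [D] is the full span [b2 - a1]. *)
  apply: (one_sided_asymptotics (tau := 1) (D := b2 - a1) lt_a2b2 hw2 ch2 m20 hm2 hE2 lt_a1b1 _ g0 _ ch1 m10 hm1 hS
    (fun n => erefl) mP sP o1 o2 hC); first by left.
  by move=> s /andP[s1 s2]; rewrite mul1r; apply/andP; split; lra.
(* The mirror image: distances are now measured leftwards from [b2], and the two sets of
   orthogonality conditions exchange roles. *)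
rewrite setUC; apply: (one_sided_asymptotics (tau := -1) (D := b2 - a1) lt_a1b1 hw1 ch1 m10 hm1 hE1 lt_a2b2 _ g0 _
  ch2 m20 hm2 hSt (fun n => addnC _ _) mP sP' o2 o1 hC); first by right.
by move=> s /andP[s1 s2]; rewrite mulN1r; apply/andP; split; lra.
Qed.
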